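(* Let $G=(V,E)$ be a directed graph with $n$ vertices, $m$ edges and polynomially bounded edge weights $w_e>0$, let $s\in V$ be a fixed root, and let $S\ni s$ be the source side of a fixed minimum $s$-cut. Given an $s$-arborescence $T$ with $|T\cap\partial^+(S)|=1$, the Centroid Algorithm (described in the context) outputs a minimum $s$-cut of $G$ in time $O((F(m,n)+m)\log n)$, where $F(m,n)$ is the time complexity of an $s$-$t$ maximum flow computation on a graph with $n$ vertices and $m$ edges.
   Context: An $s$-arborescence is a directed spanning tree rooted at $s$ with all edges directed away from $s$. For $S\subseteq V$, $\partial^+(S)$ is the set of edges from $S$ to $\overline{S}=V\setminus S$, and $w(A,\overline{A})$ denotes the total weight of edges from $A$ to $\overline{A}$. A minimum $s$-cut is $(S,\overline S)$ with $s\in S$, $\overline S\neq\emptyset$, minimizing $w(S,\overline S)$. For a tree on vertex set $U$, a centroid is a vertex whose removal leaves connected components each with at most $|U|/2$ vertices. Centroid Algorithm. Stage I (centroid decomposition, treating $T$ as undirected): let $C_0=\{s\}$, let $P_1$ be the set of (vertex sets of) components obtained by removing $s$ from $T$, and $i=1$. While $P_i\neq\emptyset$: let $C_i$ consist of a centroid $u$ of each subtree $U\in P_i$, and let $P_{i+1}$ be the set of all components obtained by removing the centroid $u$ from each $U\in P_i$; set $\ell=i$ and increment $i$. Stage II: for each $i=1,\dots,\ell$, build the digraph $G_i$ on $V\cup\{t_i\}$ with edges $E_1\cup E_2\cup E_3$: $E_1=E\cap\bigcup_{U\in P_i}(U\times U)$ with capacities equal to their weights; $E_2$ contains, for each edge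 $(u,v)\in E\setminus E_1$, an edge $(s,v)$ with capacity equal to the weight of $(u,v)$; $E_3=\{(u,t_i):u\in C_i\}$ with infinite capacity. Compute a maximum $s$-$t_i$ flow $f^*_i$ in $G_i$. For each $U\in P_i$ with centroid $u$, the flow value of $f^*_i$ on $(u,t_i)$ is a candidate cut value, and the set of vertices of $U$ that can reach $u$ in the residual graph is a candidate for $\overline{S}$. Output the smallest candidate cut value and the corresponding cut $(S,\overline{S})$.
   Formalization: The time bound F(m,n) is assumed nondecreasing in m and n with F(2m,2n)=O(F(m,n)), the usual convention; without it the bound fails (e.g. F=2^m), since the graphs G_i have n+1 vertices and up to m+n-1 edges. *)

(* Defs.v *)
From mathcomp Require Import all_boot all_order all_algebra.

Set Implicit Arguments.
Unset Strict Implicit.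
Unset Printing Implicit Defensive.

Import Order.TTheory GRing.Theory Num.Theory.


(* The values of [weight] outside [edges] are irrelevant. *)
Record digraph (R : Type) (V : finType) := Digraph {
  edges : {set V * V};
  weight : V * V -> R }.

Section Graphs.
Local Open Scope ring_scope.
Variables (R : realDomainType) (V : finType).
Implicit Types (G : digraph R V) (A S U : {set V}) (T : {set V * V}).

Definition poly_bounded (k : nat) G : Prop :=
  forall e, e \in edges G -> 0 < weight G e <= #|V|%:R ^+ k.

Definition out_edges G S : {set V * V} :=
  [set e in edges G | (e.1 \in S) && (e.2 \notin S)].

Definition cut_weight G A : R := \sum_(e in out_edges G A) weight G e.

(* A cut (S, ~: S) is given by its source side S. *)
Definition is_scut (s : V) S : Prop := s \in S /\ ~: S != set0.

Definition is_min_scut G (s : V) S : Prop :=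
  is_scut s S /\ forall A, is_scut s A -> cut_weight G S <= cut_weight G A.

(* A spanning subgraph of G in which the root s has no parent, any other vertex
   has exactly one parent, and any vertex is reached from s. *)
Definition arborescence G (s : V) T : Prop :=
  [/\ T \subset edges G,
      forall v, #|[set e in T | e.2 == v]| = (v != s)
    & forall v, connect [rel x y | (x, y) \in T] s v].

Definition induced_adj T U : rel V :=
  [rel x y | [&& x \in U, y \in U & ((x, y) \in T) || ((y, x) \in T)]].

Definition components T U : {set {set V}} :=
  [set [set y in U | connect (induced_adj T U) x y] | x in U].

Definition is_centroid T U (u : V) : Prop :=
  u \in U /\ forall W, W \in components T (U :\ u) -> (2 * #|W| <= #|U|)%N.

End Graphs.


(* Arcs are abstract labels, so that parallel arcs are possible; the capacity
   None is infinite. *)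
Record network (R : Type) (V A : finType) := Network {
  arcs : {set A};
  tail : {ffun A -> V};
  head : {ffun A -> V};
  cap : {ffun A -> option R};
  source : V;
  sink : V }.

Section Flows.
Local Open Scope ring_scope.
Variables (R : realDomainType) (V A : finType).
Implicit Types (N : network R V A) (f : A -> R).

Definition outflow N f (v : V) : R := \sum_(a in arcs N | tail N a == v) f a.
Definition inflow N f (v : V) : R := \sum_(a in arcs N | head N a == v) f a.

Definition is_flow N f : Prop :=
  (forall a, a \in arcs N ->
     0 <= f a /\ (if cap N a is Some c then f a <= c else true)) /\
  (forall v, v != source N -> v != sink N -> inflow N f v = outflow N f v).

Definition flow_value N f : R :=
  outflow N f (source N) - inflow N f (source N).

Definition is_max_flow N f : Prop :=
  is_flow N f /\ forall g, is_flow N g -> flow_value N g <= flow_value N f.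

Definition residual N f : rel V :=
  [rel x y | [exists a in arcs N,
     [&& tail N a == x, head N a == y
       & if cap N a is Some c then f a < c else true]
     || [&& head N a == x, tail N a == y & 0 < f a]]].

(* The last condition (a cut without infinite arcs exists) is what makes the
   maximum flow finite. *)
Definition admissible (k : nat) N : Prop :=
  [/\ source N != sink N,
      forall a c, a \in arcs N -> cap N a = Some c -> 0 < c <= #|V|%:R ^+ k
    & exists X : {set V}, [/\ source N \in X, sink N \notin X &
        forall a, a \in arcs N -> tail N a \in X -> head N a \notin X ->
          cap N a <> None]].

End Flows.

(* Isomorphic networks carrying corresponding flows. *)
Definition flow_iso (R : Type) (V1 A1 V2 A2 : finType)
    (N1 : network R V1 A1) (f1 : A1 -> R)
    (N2 : network R V2 A2) (f2 : A2 -> R) : Prop :=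
  exists (hV : V1 -> V2) (hA : A1 -> A2),
    [/\ bijective hV, {in arcs N1 &, injective hA}, hA @: arcs N1 = arcs N2,
        hV (source N1) = source N2 /\ hV (sink N1) = sink N2
      & forall a, a \in arcs N1 ->
          [/\ tail N2 (hA a) = hV (tail N1 a), head N2 (hA a) = hV (head N1 a),
              cap N2 (hA a) = cap N1 a & f2 (hA a) = f1 a]].


Section CentroidAlgorithm.
Local Open Scope ring_scope.
Variables (R : realDomainType) (V : finType).
Variables (G : digraph R V) (s : V) (T : {set V * V}).

(* An execution is determined by the centroids and maximum flows that are
   picked. The parts occurring during the decomposition are pairwise distinct,
   so a single function can record the centroid picked in each of them. *)
Record run := Run {
  run_centroid : {set V} -> V;
  run_depth : nat;
  run_flow : nat -> (V * V) + V -> R;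
  run_value : R;
  run_Sbar : {set V} }.

(* Levels are numbered from 0: [parts cen i] is P_(i+1). *)
Fixpoint parts (cen : {set V} -> V) (i : nat) : {set {set V}} :=
  if i is j.+1 then \bigcup_(U in parts cen j) components T (U :\ cen U)
  else components T [set~ s].

Definition inner_edges (P : {set {set V}}) : {set V * V} :=
  [set e in edges G | [exists U in P, (e.1 \in U) && (e.2 \in U)]].

(* The vertex None is the sink t_i. An edge e of G yields the arc [inl e], whose
   tail is moved to s unless e is in E_1; [inr u] is the arc of E_3 leaving u. *)
Definition level_network (P : {set {set V}}) (C : {set V}) :
    network R (option V) ((V * V) + V)%type :=
  {| arcs := (inl @: edges G) :|: (inr @: C);
     tail := [ffun a => match a with
                        | inl e => if e \in inner_edges P then Some e.1 else Some s
                        | inr u => Some u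
                        end];
     head := [ffun a => if a is inl e then Some e.2 else None];
     cap := [ffun a => if a is inl e then Some (weight G e) else None];
     source := Some s;
     sink := None |}.

Definition run_network (r : run) (i : nat) :=
  let P := parts (run_centroid r) i in
  level_network P (run_centroid r @: P).

Definition candidate_value (r : run) (i : nat) (U : {set V}) : R :=
  run_flow r i (inr (run_centroid r U)).

Definition candidate_Sbar (r : run) (i : nat) (U : {set V}) : {set V} :=
  [set v in U | connect (residual (run_network r i) (run_flow r i))
                        (Some v) (Some (run_centroid r U))].

Definition is_candidate (r : run) (i : nat) (U : {set V}) : Prop :=
  (i < run_depth r)%N /\ U \in parts (run_centroid r) i.

Definition centroid_run (r : run) : Prop :=
  [/\ (forall i, (i < run_depth r)%N -> parts (run_centroid r) i != set0)
        /\ parts (run_centroid r) (run_depth r) = set0,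
      forall i U, is_candidate r i U -> is_centroid T U (run_centroid r U),
      forall i, (i < run_depth r)%N ->
        is_max_flow (run_network r i) (run_flow r i)
    & exists i U,
        [/\ is_candidate r i U,
            forall j W, is_candidate r j W ->
              candidate_value r i U <= candidate_value r j W,
            run_value r = candidate_value r i U
          & run_Sbar r = candidate_Sbar r i U]].

End CentroidAlgorithm.


(* A program works on natural-number registers and arrays, and on registers and
   arrays holding weights. Registers and arrays are named by numbers, and arrays
   are unbounded. All operations have unit cost; there is no multiplication and
   no conversion between numbers and weights. *)

Inductive nexp :=
| NConst of nat
| NReg of nat
| NLoad of nat & nexp
| NAdd of nexp & nexp
| NSub of nexp & nexp.

Inductive wexp :=
| WZero
| WReg of nat
| WLoad of nat & nexp
| WAdd of wexp & wexp
| WSub of wexp & wexp.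

Inductive bexp :=
| BLe of nexp & nexp
| BWLe of wexp & wexp
| BNot of bexp
| BAnd of bexp & bexp.

Inductive cmd :=
| Skip
| NSet of nat & nexp
| NStore of nat & nexp & nexp
| WSet of nat & wexp
| WStore of nat & nexp & wexp
| Then of cmd & cmd
| If of bexp & cmd & cmd
| While of bexp & cmd
| MaxFlow.

Record state (R : Type) := State {
  nreg : nat -> nat;
  narr : nat -> nat -> nat;
  wreg : nat -> R;
  warr : nat -> nat -> R }.

(* Input: numbers of vertices and of edges, root; endpoints and weight of each
   edge, and whether it belongs to T. *)
Definition r_n := 0%N.
Definition r_m := 1%N.
Definition r_s := 2%N.
Definition a_tail := 0%N.
Definition a_head := 1%N.
Definition a_tree := 2%N.
Definition w_weight := 0%N.
(* Arguments of MaxFlow: numbers of vertices and of arcs, source, sink;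
   endpoints of each arc, whether its capacity is infinite (any nonzero value),
   and its capacity otherwise. Result: the flow on each arc. *)
Definition r_fn := 3%N.
Definition r_fm := 4%N.
Definition r_fs := 5%N.
Definition r_ft := 6%N.
Definition a_ftail := 3%N.
Definition a_fhead := 4%N.
Definition a_finf := 5%N.
Definition w_fcap := 1%N.
Definition w_flow := 2%N.
(* Output: the value of the cut (a weight register), and the characteristic
   vector of the sink side of the cut. *)
Definition wr_value := 0%N.
Definition a_Sbar := 6%N.

Record instance (R : Type) := Instance {
  inst_n : nat;
  inst_m : nat;
  inst_net : network R 'I_inst_n 'I_inst_m }.

Definition upd (B : Type) (f : nat -> B) (k : nat) (v : B) : nat -> B :=
  fun j => if j == k then v else f j.

Section Machine.
Local Open Scope ring_scope.
Variable R : realDomainType.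
Implicit Types (st : state R) (I : instance R).

Fixpoint neval st (e : nexp) : nat :=
  match e with
  | NConst k => k
  | NReg x => nreg st x
  | NLoad a e => narr st a (neval st e)
  | NAdd e1 e2 => (neval st e1 + neval st e2)%N
  | NSub e1 e2 => (neval st e1 - neval st e2)%N
  end.

Fixpoint weval st (e : wexp) : R :=
  match e with
  | WZero => 0
  | WReg x => wreg st x
  | WLoad a e => warr st a (neval st e)
  | WAdd e1 e2 => weval st e1 + weval st e2
  | WSub e1 e2 => weval st e1 - weval st e2
  end.

Fixpoint beval st (b : bexp) : bool :=
  match b with
  | BLe e1 e2 => (neval st e1 <= neval st e2)%N
  | BWLe e1 e2 => weval st e1 <= weval st e2
  | BNot b => ~~ beval st b
  | BAnd b1 b2 => beval st b1 && beval st b2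
  end.

Definition set_nreg st (x v : nat) : state R :=
  {| nreg := upd (nreg st) x v;
     narr := narr st; wreg := wreg st; warr := warr st |}.
Definition set_narr st (a i v : nat) : state R :=
  {| narr := upd (narr st) a (upd (narr st a) i v);
     nreg := nreg st; wreg := wreg st; warr := warr st |}.
Definition set_wreg st (x : nat) (v : R) : state R :=
  {| wreg := upd (wreg st) x v;
     nreg := nreg st; narr := narr st; warr := warr st |}.
Definition set_warr st (a i : nat) (v : R) : state R :=
  {| warr := upd (warr st) a (upd (warr st a) i v);
     nreg := nreg st; narr := narr st; wreg := wreg st |}.

Definition flow_args st I : Prop :=
  [/\ nreg st r_fn = inst_n I, nreg st r_fm = inst_m I,
      nreg st r_fs = source (inst_net I), nreg st r_ft = sink (inst_net I)
    & arcs (inst_net I) = setT /\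
      forall j : 'I_(inst_m I),
        [/\ narr st a_ftail j = tail (inst_net I) j,
            narr st a_fhead j = head (inst_net I) j
          & cap (inst_net I) j =
              if narr st a_finf j == 0%N then Some (warr st w_fcap j) else None]].

Definition set_flow st (m : nat) (f : 'I_m -> R) : state R :=
  {| warr := upd (warr st) w_flow
       (fun j => if insub j is Some k then f k else warr st w_flow j);
     nreg := nreg st; narr := narr st; wreg := wreg st |}.

Definition oracle := forall I, 'I_(inst_m I) -> R.

Definition max_flow_oracle (k : nat) (MF : oracle) : Prop :=
  forall I, admissible k (inst_net I) -> is_max_flow (inst_net I) (MF I).

(* [exec F MF c st st' t l]: from the state st, the command c halts in the state
   st' after t steps, having called the maximum-flow subroutine MF on the list l
   of instances. A call on n vertices and m arcs takes F m n steps. A command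
   with expressions costs a single step, as the size of these expressions does
   not depend on the input. *)
Inductive exec (F : nat -> nat -> nat) (MF : oracle) :
    cmd -> state R -> state R -> nat -> seq (instance R) -> Prop :=
| ExSkip st : exec F MF Skip st st 1 [::]
| ExNSet st x e : exec F MF (NSet x e) st (set_nreg st x (neval st e)) 1 [::]
| ExNStore st a i e :
    exec F MF (NStore a i e) st (set_narr st a (neval st i) (neval st e)) 1 [::]
| ExWSet st x e : exec F MF (WSet x e) st (set_wreg st x (weval st e)) 1 [::]
| ExWStore st a i e :
    exec F MF (WStore a i e) st (set_warr st a (neval st i) (weval st e)) 1 [::]
| ExThen c1 c2 st st1 st2 t1 t2 l1 l2 :
    exec F MF c1 st st1 t1 l1 -> exec F MF c2 st1 st2 t2 l2 ->
    exec F MF (Then c1 c2) st st2 (t1 + t2)%N (l1 ++ l2)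
| ExIf b c1 c2 st st' t l :
    exec F MF (if beval st b then c1 else c2) st st' t l ->
    exec F MF (If b c1 c2) st st' t.+1 l
| ExWhileEnd b c st : ~~ beval st b -> exec F MF (While b c) st st 1 [::]
| ExWhile b c st st1 st2 t1 t2 l1 l2 :
    beval st b ->
    exec F MF c st st1 t1 l1 -> exec F MF (While b c) st1 st2 t2 l2 ->
    exec F MF (While b c) st st2 (t1 + t2).+1%N (l1 ++ l2)
| ExMaxFlow st I :
    flow_args st I ->
    exec F MF MaxFlow st (set_flow st (MF I)) (F (inst_m I) (inst_n I)).+1 [:: I].

(* es lists the edges of G, in any order. *)
Definition input_state n (G : digraph R 'I_n) (s : 'I_n) (T : {set 'I_n * 'I_n})
    (es : seq ('I_n * 'I_n)) : state R :=
  {| nreg := upd (upd (upd (fun=> 0%N) r_n n) r_m (size es)) r_s (val s);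
     narr := upd (upd (upd (fun=> fun=> 0%N)
       a_tail (nth 0%N [seq val e.1 | e <- es]))
       a_head (nth 0%N [seq val e.2 | e <- es]))
       a_tree (nth 0%N [seq nat_of_bool (e \in T) | e <- es]);
     wreg := fun=> 0;
     warr := upd (fun=> fun=> 0)
       w_weight (nth 0 [seq weight G e | e <- es]) |}.

(* An execution that called MF on the instances l and halted in st carried out
   the run r: the successive calls are those of Stage II (with the arcs of each
   network listed in some order), and the output is that of r. *)
Definition carries_out n (G : digraph R 'I_n) (s : 'I_n) (T : {set 'I_n * 'I_n})
    (MF : oracle) (st : state R) (l : seq (instance R)) (r : run R 'I_n) : Prop :=
  [/\ exists I : nat -> instance R, l = [seq I i | i <- iota 0 (run_depth r)] /\
        forall i, (i < run_depth r)%N ->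
          flow_iso (inst_net (I i)) (MF (I i))
                   (run_network G s T r i) (run_flow r i),
      wreg st wr_value = run_value r
    & forall v : 'I_n, narr st a_Sbar v = (v \in run_Sbar r)].

End Machine.

(* The usual convention on time bounds: F is nondecreasing, and
   F(O(m), O(n)) = O(F(m, n)). It is needed because the networks G_i are slightly
   larger than G. *)
Definition regular_time (F : nat -> nat -> nat) : Prop :=
  (forall m m' n n', m <= m' -> n <= n' -> F m n <= F m' n') /\
  (exists K, forall m n, 0 < m -> 1 < n -> F (2 * m) (2 * n) <= K * F m n).

(* Main.v *)
Require Import Defs.
From mathcomp Require Import all_boot all_order all_algebra.
From mathcomp Require Import zify ring lra.
Import Defs.

Set Implicit Arguments.
Unset Strict Implicit.
Unset Printing Implicit Defensive.

Import Order.TTheory GRing.Theory Num.Theory.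

(** Let W be a set of vertices inside a part U of some level, containing the
    centroid u of U. Flow conservation on W says that the flow on the arc from u
    to the sink is at most the weight of the edges entering W, with equality when
    W is the set of vertices of U that reach u in the residual graph: the arcs
    entering that set are saturated and the arcs leaving it towards U are empty
    (the root cannot reach u, since the flow is maximum). So every candidate is
    the value of the cut that comes with it. Conversely, as T crosses the minimum
    cut only once, the sink side B of this cut is connected in T. Hence B stays
    inside one part until a centroid u is taken in B, and at that level the
    candidate of u is at most the weight of the edges entering B.

    For the running time, parts are at least halved at each level. The program
    sorts the vertices by a breadth-first search of T. In a part, subtree sizes
    then follow bottom-up, and a centroid is the last vertex, in this order,
    whose subtree has more than half of the vertices. *)

(** * Maximum flows and minimum cuts *)

(** The obstacle is to match a decomposition into families of sets with a machine that has only
    registers and arrays. The link is that the parts of a level are the components of a single set,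
    that of the vertices not yet removed: deleting the centroids of all parts at once affects each
    part exactly as deleting its own centroid does. One boolean array then stores a level, and a
    part is named by its vertex closest to the root, so that two vertices are compared in constant
    time. A part may have two centroids. Requiring a majority subtree and no child with a majority
    subtree singles out one of them, so the centroids of the run that the program carries out are a
    function of the parts, fixed in advance. For the costs, the arborescence gives [n <= m.+1]. A
    level network thus has at most [2 * m] arcs and [2 * n] vertices, a size that the regularity of
    [F] absorbs, and all the other work of a level is linear in [m]. *)

Section MaxFlow.
Local Open Scope ring_scope.
Variables (R : realDomainType) (V A : finType).
Implicit Types (N : network R V A) (f d : A -> R).

(** Supplies the amount to push along a path: a finite minimum, since the ring has no division. The
    value 1 serves the empty list. *)
Lemma positive_lower_bound (I : eqType) (r : seq I) (F : I -> R) :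
  {in r, forall i, 0 < F i} ->
  exists2 eps, 0 < eps & {in r, forall i, eps <= F i}.
Proof.
elim: r => [|i r IHr] Fpos; first by exists 1.
have [j jr|eps eps_gt0 le_eps] := IHr; first by rewrite Fpos // inE jr orbT.
exists (Num.min eps (F i)) => [|j]; first by rewrite lt_min eps_gt0 Fpos ?mem_head.
rewrite inE => /predU1P[-> | /le_eps]; first by rewrite ge_min lexx orbT.
by rewrite ge_min => ->.
Qed.

Definition divergence N f v : R := outflow N f v - inflow N f v.

Definition unsaturated N f a : bool :=
  if cap N a is Some c then f a < c else true.

(* Since the path is simple, an arc is used at most once, so that the direction
   has coefficients in {-1, 0, 1}; over a discrete ring larger coefficients
   could not be scaled down. *)
Lemma augmenting_direction N f x p :
  path (residual N f) x p -> uniq (x :: p) ->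
  exists d : A -> R,
    [/\ forall a, d a != 0 -> (tail N a \in x :: p) && (head N a \in x :: p),
        forall a, [|| d a == 0, (d a == 1) && unsaturated N f a
                    | (d a == -1) && (0 < f a)]
      & forall v, divergence N d v = (v == x)%:R - (v == last x p)%:R].
Proof.
elim/last_ind: p => [|p y IHp].
  move=> _ _; exists (fun=> 0); split=> [a|a|v]; rewrite ?eqxx //.
  by rewrite /divergence /outflow /inflow !big1 // !subrr.
rewrite rcons_path -rcons_cons rcons_uniq last_rcons.
move=> /andP[p_path res_y] /andP[y_notin p_uniq].
have [d [d_supp d_val d_div]] := IHp p_path p_uniq.
case/exists_inP: res_y => a a_arc a_res.
pose z := last x p; have z_in : z \in x :: p by apply: mem_last.
have zy : z != y by apply: contraNneq y_notin => <-.
(* The new arc touches [y], which is off the path so far, so [d] vanishes on it and can be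
   overridden there. *)
have d_a : d a = 0.
  apply: contraNeq y_notin => /d_supp/andP[ta ha].
  by case/orP: a_res => /and3P[_ /eqP <- _].
have ends : (tail N a \in rcons (x :: p) y) && (head N a \in rcons (x :: p) y).
  rewrite !mem_rcons.
  by case/orP: a_res => /and3P[/eqP -> /eqP -> _]; rewrite !(in_cons y) eqxx -/z z_in orbT.
have supp e : forall b, (if b == a then e else d b) != 0 ->
    (tail N b \in rcons (x :: p) y) && (head N b \in rcons (x :: p) y).
  move=> b; case: (b =P a) => [-> //|_ /d_supp/andP[tb hb]].
  by rewrite !mem_rcons !(in_cons y) tb hb !orbT.
have sumE (Q : pred A) e :
    \sum_(b in arcs N | Q b) (if b == a then e else d b) =
    (if Q a then e else 0) + \sum_(b in arcs N | Q b) d b.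
  case Qa: (Q a); last first.
    rewrite add0r; apply: eq_bigr => b /andP[_ Qb].
    by case: eqP => // ba; rewrite ba Qa in Qb.
  rewrite (bigD1 a) /=; last by rewrite a_arc Qa.
  rewrite [in RHS](bigD1 a) /=; last by rewrite a_arc Qa.
  rewrite eqxx d_a add0r; congr (_ + _).
  by apply: eq_bigr => b /andP[_ /negPf ->].
have divE e v : divergence N (fun b => if b == a then e else d b) v =
   divergence N d v + (if tail N a == v then e else 0) - (if head N a == v then e else 0).
  by rewrite /divergence /outflow /inflow !sumE; ring.
case/orP: a_res => /and3P[/eqP ta /eqP ha a_sat].
- exists (fun b => if b == a then 1 else d b); split=> [|b|v]; first exact: supp.
    by case: (b =P a) => [->|_]; rewrite ?d_val // eqxx /unsaturated a_sat orbT.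
  rewrite divE d_div ta ha -/z (eq_sym _ v) (eq_sym _ v).
  by case: (v == z); case: (v == y); case: (v == x) => /=; ring.
- exists (fun b => if b == a then -1 else d b); split=> [|b|v]; first exact: supp.
    by case: (b =P a) => [->|_]; rewrite ?d_val // eqxx a_sat !orbT.
  rewrite divE d_div ta ha -/z (eq_sym _ v) (eq_sym _ v).
  by case: (v == z); case: (v == y); case: (v == x) => /=; ring.
Qed.

(** Pushing [eps] along a simple residual path respects all capacities and raises the value by
    exactly [eps], against maximality. *)
Lemma max_flow_no_augmenting_path N f :
  source N != sink N -> is_max_flow N f ->
  ~~ connect (residual N f) (source N) (sink N).
Proof.
move=> st_neq [[f_cap f_cons] f_max]; apply/negP=> /connectP[p0 p0_path].
case/shortenP: p0_path => p p_path p_uniq _ p_last {p0}.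
have [d [_ d_val d_div]] := augmenting_direction p_path p_uniq.
(* The slack of an arc in the direction of [d]: residual capacity forwards, the flow itself
   backwards. Where nothing constrains the step, any positive value serves, here 1. *)
pose room a : R := if d a == 1 then (if cap N a is Some c then c - f a else 1)
                   else if d a == -1 then f a else 1.
have [a _ |eps eps_gt0 le_eps] := @positive_lower_bound A (enum A) room.
  rewrite /room; case/or3P: (d_val a) => [/eqP ->|/andP[/eqP -> ]|/andP[/eqP ->]].
  - by rewrite eq_sym oner_eq0 eq_sym oppr_eq0 oner_eq0.
  - by rewrite eqxx /unsaturated; case: (cap N a) => // c; rewrite subr_gt0.
  - by rewrite eqxx; case: eqP => //; lra.
pose g a := f a + eps * d a.
have g_out v : outflow N g v = outflow N f v + eps * outflow N d v.
  by rewrite /outflow big_split mulr_sumr.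
have g_in v : inflow N g v = inflow N f v + eps * inflow N d v.
  by rewrite /inflow big_split mulr_sumr.
have g_flow : is_flow N g.
  split=> [a a_arc|v vs vt].
    have [f_ge0 f_le] := f_cap a a_arc.
    have := le_eps a (mem_enum _ a); rewrite /room /g.
    case/or3P: (d_val a) => [/eqP -> _|/andP[/eqP ->]|/andP[/eqP ->]].
    - by rewrite mulr0 addr0.
    - rewrite eqxx mulr1 => _; case: (cap N a) => [c|] ebound; split=> //; lra.
    - case: eqP => [|_ _]; first lra.
      by rewrite eqxx mulrN1; case: (cap N a) f_le => [c|] fc ebound; split=> //; lra.
  have := d_div v; rewrite -p_last (negPf vs) (negPf vt) subrr /divergence.
  by move/eqP; rewrite subr_eq0 => /eqP dv; rewrite g_in g_out f_cons // dv.
have := f_max g g_flow; rewrite /flow_value g_in g_out.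
have := d_div (source N); rewrite -p_last eqxx (negPf st_neq) subr0 /divergence => dv.
rewrite -subr_ge0.
have -> : outflow N f (source N) - inflow N f (source N) -
    (outflow N f (source N) + eps * outflow N d (source N) -
     (inflow N f (source N) + eps * inflow N d (source N))) =
    - (eps * (outflow N d (source N) - inflow N d (source N))) by ring.
by rewrite dv mulr1 oppr_ge0 leNgt eps_gt0.
Qed.

(** When conservation is summed over [W], each arc with both ends in [W] occurs once on either side
    and cancels. *)
Lemma flow_across_set N f (W : {set V}) :
  is_flow N f -> source N \notin W -> sink N \notin W ->
  \sum_(a in arcs N | (head N a \in W) && (tail N a \notin W)) f a =
  \sum_(a in arcs N | (tail N a \in W) && (head N a \notin W)) f a.
Proof.
move=> [_ f_cons] sW tW.
have sum_ends (h : A -> V) :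
    \sum_(v in W) \sum_(a in arcs N | h a == v) f a = \sum_(a in arcs N | h a \in W) f a.
  rewrite (partition_big h (mem W)) /= => [|a /andP[]//].
  apply: eq_bigr => v vW; apply: eq_bigl => a.
  by case: eqP => [->|]; rewrite ?vW ?andbF ?andbT.
have : \sum_(v in W) inflow N f v = \sum_(v in W) outflow N f v.
  apply: eq_bigr => v vW; apply: f_cons.
    by apply: contraNneq sW => <-.
  by apply: contraNneq tW => <-.
rewrite !sum_ends (bigID (fun a => tail N a \in W)) /=.
rewrite [in RHS](bigID (fun a => head N a \in W)) /=.
rewrite (eq_bigl (fun a => (a \in arcs N) && (tail N a \in W) && (head N a \in W))); last first.
  by move=> a; rewrite andbAC.
move/addrI => eq_sums.
rewrite (eq_bigl _ _ (fun a => andbA _ _ _)) eq_sums.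
by apply: eq_bigl => a; rewrite andbA.
Qed.

End MaxFlow.

(** * The networks of the levels *)

Section LevelNetwork.
Local Open Scope ring_scope.
Variables (R : realDomainType) (V : finType) (G : digraph R V) (s : V).
Variables (P : {set {set V}}) (cen : {set V} -> V).
Hypothesis P_disjoint : forall U W x, U \in P -> W \in P -> x \in U -> x \in W -> U = W.
Hypothesis s_notin : forall U, U \in P -> s \notin U.
Hypothesis cen_in : forall U, U \in P -> cen U \in U.

Let N := level_network G s P (cen @: P).
Implicit Types (f : (V * V) + V -> R) (U W : {set V}).

Lemma mem_level_arcs_inl e : (inl e \in arcs N) = (e \in edges G).
Proof.
rewrite inE mem_imset; last by move=> ? ? [].
by case: imsetP => [[u _]|]; rewrite ?orbF.
Qed.

Lemma mem_level_arcs_inr u : (inr u \in arcs N) = (u \in cen @: P).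
Proof.
rewrite inE [X in _ || X]mem_imset; last by move=> ? ? [].
by case: imsetP => [[e _]|].
Qed.

Lemma sum_level_arcs (Q : pred ((V * V) + V)) f :
  \sum_(a in arcs N | Q a) f a =
  \sum_(e in edges G | Q (inl e)) f (inl e) + \sum_(u in cen @: P | Q (inr u)) f (inr u).
Proof.
rewrite big_sumType; congr (_ + _); apply: eq_bigl => x /=.
  by rewrite mem_level_arcs_inl.
by rewrite mem_level_arcs_inr.
Qed.

Lemma level_arc_tail e : tail N (inl e) = Some (if e \in inner_edges G P then e.1 else s).
Proof. by rewrite ffunE; case: ifP. Qed.

(** Arcs entering [W] correspond to edges of [G] entering [W]: an edge outside E_1 with head in [W]
    cannot start in [W], as it would then lie inside [U], and its moved tail [s] is outside [W] too.
    Moved arcs never leave [W], so only inner arcs and the sink arc of [cen U] do. *)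
Lemma level_flow_balance f U W :
  is_flow N f -> U \in P -> cen U \in W -> W \subset U ->
  f (inr (cen U)) +
    \sum_(e in edges G | [&& e \in inner_edges G P, e.1 \in W & e.2 \notin W]) f (inl e)
  = \sum_(e in edges G | (e.1 \notin W) && (e.2 \in W)) f (inl e).
Proof.
move=> f_flow UP cenW WU.
have sW : s \notin W by apply: contra (s_notin UP); apply: (subsetP WU).
have someW x : (Some x \in Some @: W) = (x \in W) by rewrite mem_imset // => ? ? [].
have noneW : None \notin Some @: W by apply/negP=> /imsetP[].
have := @flow_across_set _ _ _ N f (Some @: W) f_flow.
rewrite someW => /(_ sW noneW); rewrite !sum_level_arcs.
have -> : \sum_(u in cen @: P | (head N (inr u) \in Some @: W) && (tail N (inr u) \notin Some @: W))
            f (inr u) = 0.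
  by rewrite big1 // => u /andP[_]; rewrite /= ffunE (negPf noneW).
have -> : \sum_(u in cen @: P | (tail N (inr u) \in Some @: W) && (head N (inr u) \notin Some @: W))
            f (inr u) = f (inr (cen U)).
  rewrite (big_pred1 (cen U)) // => u /=; rewrite !ffunE noneW andbT someW.
  apply/andP/eqP => [[/imsetP[U' U'P ->] cW]|->].
    by congr cen; apply: P_disjoint U'P UP (cen_in U'P) (subsetP WU _ cW).
  by rewrite imset_f.
rewrite addr0 addrC.
have -> : \sum_(i in edges G | (tail N (inl i) \in Some @: W) && (head N (inl i) \notin Some @:
  W)) f (inl i)
    = \sum_(e in edges G | [&& e \in inner_edges G P, e.1 \in W & e.2 \notin W]) f (inl e).
  apply: eq_bigl => e; rewrite level_arc_tail !someW /= ffunE someW.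
  by case: ifP => _ //=; rewrite (negPf sW) andbF.
move=> <-; apply: eq_bigl => e.
rewrite level_arc_tail !someW /= ffunE someW [X in _ && X]andbC; case: ifPn => // eNinner.
have e1W : e \in edges G -> e.2 \in W -> e.1 \notin W.
  move=> eG e2W; apply: contra eNinner => e1W; rewrite inE eG; apply/exists_inP.
  by exists U; rewrite ?(subsetP WU).
rewrite sW; case: (boolP (e \in edges G)) => //= eG.
by case: (boolP (e.2 \in W)) => e2W; rewrite ?andbF // e1W.
Qed.

Lemma level_flow_le_capacity f e : is_flow N f -> e \in edges G -> f (inl e) <= weight G e.
Proof.
move=> [f_cap _] eG; have [|_] := f_cap (inl e); first by rewrite mem_level_arcs_inl.
by rewrite /= ffunE.
Qed.

Lemma cut_weight_compl W :
  cut_weight G (~: W) = \sum_(e in edges G | (e.1 \notin W) && (e.2 \in W)) weight G e.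
Proof.
by rewrite /cut_weight /out_edges; apply: eq_bigl => e; rewrite !inE negbK.
Qed.

Lemma level_flow_le_cut f U W :
  is_flow N f -> U \in P -> cen U \in W -> W \subset U ->
  f (inr (cen U)) <= cut_weight G (~: W).
Proof.
move=> f_flow UP cenW WU; rewrite cut_weight_compl.
apply: (@le_trans _ _ (\sum_(e in edges G | (e.1 \notin W) && (e.2 \in W)) f (inl e))).
  rewrite -(level_flow_balance f_flow UP cenW WU) lerDl sumr_ge0 // => e /andP[eG _].
  by case: f_flow => f_cap _; case: (f_cap (inl e)); rewrite ?mem_level_arcs_inl.
by apply: ler_sum => e /andP[eG _]; apply: level_flow_le_capacity.
Qed.

(** The arc from a centroid to the sink has infinite capacity, so it is never saturated. *)
Lemma level_sink_reachable f U (v : V) :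
  U \in P -> connect (residual N f) (Some v) (Some (cen U)) ->
  connect (residual N f) (Some v) None.
Proof.
move=> UP v_cen; apply: connect_trans v_cen (connect1 _); apply/exists_inP.
by exists (inr (cen U)); rewrite ?mem_level_arcs_inr ?imset_f // /residual /= !ffunE !eqxx.
Qed.

Lemma level_max_flow_is_cut f U :
  is_max_flow N f -> U \in P ->
  f (inr (cen U)) =
  cut_weight G (~: [set v in U | connect (residual N f) (Some v) (Some (cen U))]).
Proof.
move=> f_max UP; set W := [set v in U | _].
have WU : W \subset U by apply/subsetP=> v; rewrite inE => /andP[].
have cenW : cen U \in W by rewrite inE cen_in // connect0.
have [f_flow _] := f_max.
have s_cut : ~~ connect (residual N f) (Some s) (Some (cen U)).
  by apply: contra (max_flow_no_augmenting_path _ f_max) => //; apply: level_sink_reachable.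
rewrite cut_weight_compl.
set Z := \sum_(e in edges G | [&& e \in inner_edges G P, e.1 \in W & e.2 \notin W]) f (inl e).
(* Parts are disjoint, so an edge inside some part with one end in [U] lies inside [U]. *)
have inner_U e : e \in inner_edges G P -> (e.1 \in U) || (e.2 \in U) -> (e.1 \in U) && (e.2 \in U).
  rewrite inE => /andP[_ /exists_inP[U' U'P /andP[e1 e2]]] /orP[] eU.
    by rewrite (P_disjoint UP U'P eU e1) e1 e2.
  by rewrite (P_disjoint UP U'P eU e2) e1 e2.
(* A loaded inner arc leaving [W] can be traversed backwards in the residual graph, so its head
   would reach the centroid and belong to [W]. *)
have Z0 : Z = 0.
  rewrite /Z big1 // => e /andP[eG /and3P[e_in e1W e2W]].
  have e1U := subsetP WU _ e1W; have /andP[_ e2U] := inner_U e e_in (introT orP (or_introl e1U)).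
  have [f_cap _] := f_flow; have [fe_ge0 _] := f_cap (inl e) (etrans (mem_level_arcs_inl e) eG).
  apply: contraNeq e2W => fe_neq0; rewrite inE e2U; move: e1W; rewrite inE => /andP[_].
  apply: connect_trans; apply: connect1; apply/exists_inP; exists (inl e).
    by rewrite mem_level_arcs_inl.
  by rewrite /residual /= !ffunE e_in !eqxx lt0r fe_neq0 fe_ge0 orbT.
rewrite -[LHS]addr0 -[X in _ + X = _]Z0 (level_flow_balance f_flow UP cenW WU).
apply: eq_bigr => e /andP[eG /andP[e1W e2W]]; apply/eqP.
(* If an entering arc had room left, its tail in the network would reach the centroid. An inner tail
   would then lie in [W]; a moved tail is the root, which cannot reach the centroid. *)
rewrite eq_le level_flow_le_capacity //= leNgt; apply/negP=> e_unsat.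
have e2U := subsetP WU _ e2W.
have e_res x : tail N (inl e) = Some x -> connect (residual N f) (Some x) (Some (cen U)).
  move=> ex; move: (e2W); rewrite inE => /andP[_]; apply: connect_trans.
  apply: connect1; apply/exists_inP; exists (inl e); first by rewrite mem_level_arcs_inl.
  by rewrite /residual /= ffunE in ex *; rewrite ex !ffunE !eqxx e_unsat.
move: (level_arc_tail e); case: ifP => [e_in|_] /e_res; last by rewrite (negPf s_cut).
have /andP[e1U _] := inner_U e e_in (introT orP (or_intror e2U)).
by move=> e1_cen; case/negP: e1W; rewrite inE e1U.
Qed.

End LevelNetwork.

(** * Centroid decomposition and correctness *)

Section Components.
Variables (V : finType) (T : {set V * V}).
Implicit Types (A B U W : {set V}).

Lemma induced_adj_sym A : symmetric (induced_adj T A).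
Proof. by move=> x y; rewrite /induced_adj /= andbCA orbC. Qed.

Lemma connect_induced_sym A : connect_sym (induced_adj T A).
Proof. by apply: sym_connect_sym; apply: induced_adj_sym. Qed.

Lemma connect_induced_sub A B x y :
  A \subset B -> connect (induced_adj T A) x y -> connect (induced_adj T B) x y.
Proof.
move=> AB; apply: connect_sub => a b /= /and3P[aA bA ab]; apply: connect1.
by rewrite /induced_adj /= !(subsetP AB).
Qed.

Lemma connect_induced_mem A x y : connect (induced_adj T A) x y -> x \in A -> y \in A.
Proof.
case/connectP=> p; elim: p x => [|z p IHp] x /=; first by move=> _ ->.
by case/andP=> /and3P[_ zA _] pz yE _; apply: IHp pz yE zA.
Qed.

Definition component A x : {set V} := [set y in A | connect (induced_adj T A) x y].

Lemma componentsP A U :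
  reflect (exists2 x, x \in A & U = component A x) (U \in components T A).
Proof. exact: imsetP. Qed.

Lemma mem_component A x : x \in A -> x \in component A x.
Proof. by move=> xA; rewrite inE xA connect0. Qed.

Lemma component_in A x : x \in A -> component A x \in components T A.
Proof. by move=> xA; apply/componentsP; exists x. Qed.

Lemma component_eq A U x : U \in components T A -> x \in U -> U = component A x.
Proof.
case/componentsP=> z zA -> ; rewrite inE => /andP[xA zx]; apply/setP=> y; rewrite !inE.
by case: (y \in A) => //=; apply: same_connect (connect_induced_sym A) _ _ zx _.
Qed.

Lemma components_sub A U : U \in components T A -> U \subset A.
Proof. by case/componentsP=> z _ ->; apply/subsetP=> x; rewrite inE => /andP[]. Qed.

Lemma components_disjoint A U W x :
  U \in components T A -> W \in components T A -> x \in U -> x \in W -> U = W.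
Proof. by move=> UA WA xU xW; rewrite (component_eq UA xU) (component_eq WA xW). Qed.

Lemma components_eq0 A : (components T A == set0) = (A == set0).
Proof. by rewrite imset_eq0. Qed.

(** A path from [x] that avoids all the centroids stays in the component of [x] in [A], so among
    these centroids only the one of that component matters to it. *)
Lemma component_setD A (c : {set V} -> V) x :
    (forall U, U \in components T A -> c U \in U) ->
    x \in A :\: c @: components T A ->
  component (component A x :\ c (component A x)) x = component (A :\: c @: components T A) x.
Proof.
move=> c_in xD; have [xA xC] : x \in A /\ x \notin c @: components T A.
  by move: xD; rewrite inE => /andP[].
set U := component A x; have UA : U \in components T A by apply: component_in.
have sub : U :\ c U \subset A :\: c @: components T A.
  apply/subsetP=> y; rewrite !in_setD in_set1 => /andP[yc yU].
  rewrite (subsetP (components_sub UA)) // andbT; apply: contra yc => /imsetP[W WA yW].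
  by rewrite yW (components_disjoint UA WA yU) // yW c_in.
have xU : x \in U :\ c U.
  rewrite in_setD1 mem_component // andbT; apply: contraNneq xC => ->.
  by rewrite imset_f.
apply/setP=> y; rewrite [LHS]inE [RHS]inE; apply/andP/andP => [[yU xy]|[yD xy]].
  by split; [apply: (subsetP sub) | apply: connect_induced_sub xy].
suff xy' : connect (induced_adj T (U :\ c U)) x y.
  by split=> //; apply: connect_induced_mem xy' xU.
case/connectP: xy => p p_path ->;
  elim: p x xD xA xC U UA sub xU p_path => [|z p IHp] x xD xA xC U UA sub xU /=.
  by move=> _; apply: connect0.
case/andP=> /and3P[_ zD xz] p_path.
have [zA zC] : z \in A /\ z \notin c @: components T A by move: zD; rewrite inE => /andP[].
have zU : z \in U.
  have xU' : x \in U by move: xU; rewrite in_setD1 => /andP[].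
  by rewrite (component_eq UA xU') inE zA connect1 // /induced_adj /= xA zA.
have zUe : component A z = U by rewrite -(component_eq UA zU).
have zUc : z \in U :\ c U.
  by rewrite in_setD1 zU andbT; apply: contraNneq zC => ->; rewrite imset_f.
apply: (@connect_trans _ _ z); first by apply: connect1; rewrite /induced_adj /= xU zUc.
by rewrite -zUe; apply: IHp; rewrite ?zUe.
Qed.

End Components.

(** * Levels of the decomposition as components of a single set *)

Section Decomposition.
Variables (V : finType) (s : V) (T : {set V * V}) (cen : {set V} -> V).

(** A level given by one set instead of a family of sets; the program keeps it in [a_left]. *)
Fixpoint remaining i : {set V} :=
  if i is j.+1 then remaining j :\: cen @: parts s T cen j else [set~ s].

Lemma notin_centroids A U x :
    (forall W, W \in components T A -> cen W \in W) ->
    U \in components T A -> x \in U ->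
  (x \notin cen @: components T A) = (x != cen U).
Proof.
move=> cen_in UA xU; congr (~~ _); apply/imsetP/eqP=> [[W WA xW]|->]; last by exists U.
by rewrite xW (components_disjoint UA WA xU) // xW cen_in.
Qed.

(** Relies on each chosen vertex lying in its own part: one lying elsewhere would delete a vertex of
    [remaining] that the recursion of [parts] keeps. *)
Lemma parts_components i :
    (forall j U, j < i -> U \in parts s T cen j -> cen U \in U) ->
  parts s T cen i = components T (remaining i).
Proof.
elim: i => [//|i IHi] cen_in /=.
have partsE : parts s T cen i = components T (remaining i).
  by apply: IHi => j U ji; apply: cen_in; apply: ltnW.
have cen_in' U : U \in components T (remaining i) -> cen U \in U.
  by rewrite -partsE; apply: cen_in.
rewrite partsE; set A := remaining i in cen_in' *.
apply/setP=> W; apply/bigcupP/componentsP => [[U UA]|[x xD ->]].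
  case/componentsP=> x; rewrite in_setD1 => /andP[xc xU] ->; exists x.
    by rewrite in_setD (subsetP (components_sub UA)) // (notin_centroids _ UA) ?xc.
  rewrite [in LHS](component_eq UA xU) component_setD //.
  by rewrite in_setD (subsetP (components_sub UA)) // (notin_centroids _ UA) ?xc.
have [xA xC] : x \in A /\ x \notin cen @: components T A.
  by move: xD; rewrite in_setD => /andP[].
exists (component T A x); first exact: component_in.
rewrite -component_setD //; apply: component_in.
by rewrite in_setD1 mem_component // andbT -(notin_centroids _ (component_in T xA)) ?mem_component.
Qed.

Lemma remaining_root i : s \notin remaining i.
Proof. by elim: i => [|i IHi] /=; rewrite ?inE ?eqxx // (negPf IHi) andbF. Qed.

Section Levels.
Variable d : nat.
Hypothesis cen_in : forall i U, i < d -> U \in parts s T cen i -> cen U \in U.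

Lemma parts_level i : i <= d -> parts s T cen i = components T (remaining i).
Proof. by move=> id; apply: parts_components => j U ji; apply: cen_in; apply: leq_trans id. Qed.

Lemma parts_disjoint i U W x : i <= d ->
  U \in parts s T cen i -> W \in parts s T cen i -> x \in U -> x \in W -> U = W.
Proof. by move=> id; rewrite parts_level //; apply: components_disjoint. Qed.

Lemma parts_root i U : i <= d -> U \in parts s T cen i -> s \notin U.
Proof.
by move=> id; rewrite parts_level // => /components_sub/subsetP UA;
  apply: contra (remaining_root i) => /UA.
Qed.

(* The part is the one containing B at the last level at which B has not lost a
   vertex: B is connected, hence never split before that. *)
Lemma connected_set_centroid (B : {set V}) :
    B != set0 -> s \notin B -> {in B &, forall x y, connect (induced_adj T B) x y} ->
    parts s T cen d = set0 ->
  exists i U, [/\ i < d, U \in parts s T cen i, B \subset U & cen U \in B].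
Proof.
move=> /set0Pn[b bB] sB B_conn parts0.
pose found := [exists i : 'I_d, [exists U in parts s T cen i, (B \subset U) && (cen U \in B)]].
suff /existsP[i /exists_inP[U UP /andP[BU cB]]] : found by exists i, U.
(* Either a suitable part exists or [B] is intact at every level; at level [d] nothing remains,
   which excludes the latter. *)
suff H i : i <= d -> found || (B \subset remaining i).
  have := H d (leqnn d); case/orP=> // Bsub.
  move/eqP: parts0; rewrite parts_level // components_eq0 => /eqP R0.
  by move/subsetP/(_ b bB): Bsub; rewrite R0 inE.
elim: i => [_|i IHi id].
  by apply/orP; right; apply/subsetP=> x xB; rewrite !inE; apply: contraNneq sB => <-.
have [->//|Bsub] := orP (IHi (ltnW id)).
set U := component T (remaining i) b; have bR := subsetP Bsub _ bB.
have UA : U \in components T (remaining i) by apply: component_in.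
have BU : B \subset U.
  apply/subsetP=> x xB; rewrite inE (subsetP Bsub) //=.
  exact: connect_induced_sub Bsub (B_conn _ _ bB xB).
have [cB|cB] := boolP (cen U \in B).
  apply/orP; left; apply/existsP; exists (Ordinal id); apply/exists_inP; exists U.
    by rewrite parts_level // ltnW.
  by rewrite BU.
apply/orP; right; apply/subsetP=> x xB /=; rewrite in_setD (subsetP Bsub) // andbT.
rewrite (parts_level (ltnW id)) (notin_centroids _ UA) ?(subsetP BU) //.
  by apply: contraNneq cB => <-.
by move=> W; rewrite -(parts_level (ltnW id)); apply: cen_in.
Qed.

End Levels.
End Decomposition.

(** * Correctness of every run *)

Section Correctness.
Local Open Scope ring_scope.
Variables (R : realDomainType) (V : finType) (G : digraph R V) (s : V).
Variables (S : {set V}) (T : {set V * V}).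

(** On a path of [T] from [s] to a vertex outside [S], the last edge leaving [S] must be [(a, b)],
    and what follows stays outside [S]. So every vertex there is joined to [b]. *)
Lemma arborescence_connected_compl :
    arborescence G s T -> s \in S -> #|T :&: out_edges G S| = 1 ->
  {in ~: S &, forall x y, connect (induced_adj T (~: S)) x y}.
Proof.
case=> T_sub _ T_conn sS /eqP/cards1P[[a b] crossE].
have from_b v : v \in ~: S -> connect (induced_adj T (~: S)) b v.
  case/connectP: (T_conn v) => p; elim/last_ind: p v => [|p y IHp] v /=.
    by move=> _ ->; rewrite inE sS.
  rewrite rcons_path last_rcons => /andP[p_path xyT] ->; move: xyT => /= xyT ySb.
  have [xS|xSb] := boolP (last s p \in S).
    suff /eqP[_ ->] : (last s p, y) == (a, b) by apply: connect0.
    rewrite -in_set1 -crossE !inE xyT (subsetP T_sub) //= xS /=.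
    by move: ySb; rewrite inE.
  apply: (@connect_trans _ _ (last s p)); first by apply: IHp; rewrite ?inE.
  by apply: connect1; rewrite /induced_adj /= ySb xyT inE xSb.
move=> x y xSb ySb; apply: connect_trans (from_b y ySb).
by rewrite connect_induced_sym from_b.
Qed.

Lemma run_correct (r : run R V) :
    is_min_scut G s S -> arborescence G s T -> #|T :&: out_edges G S| = 1 ->
    centroid_run G s T r ->
  is_min_scut G s (~: run_Sbar r) /\ run_value r = cut_weight G (~: run_Sbar r).
Proof.
move=> [[sS Sbar_n0] S_min] T_arb T_cross.
case=> [[_ parts0] r_cen r_flow [i0 [U0 [[i0d U0P] r_min r_val r_Sbar]]]].
set cen := run_centroid r in parts0 r_cen r_min r_val r_Sbar U0P *.
have cen_in i U : (i < run_depth r)%N -> U \in parts s T cen i -> cen U \in U.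
  by move=> id UP; case: (r_cen i U (conj id UP)).
have cut_in i U : (i < run_depth r)%N -> U \in parts s T cen i ->
    candidate_value r i U = cut_weight G (~: candidate_Sbar G s T r i U).
  move=> id UP; apply: (@level_max_flow_is_cut R V G s (parts s T cen i) cen) => //.
  - by move=> ? ? ?; apply: parts_disjoint (ltnW id).
  - by move=> W; apply: parts_root (ltnW id).
  - by move=> W; apply: cen_in.
  - exact: r_flow.
have sSb : s \notin ~: S by rewrite inE sS.
have [i [U [id UP BU cB]]] := connected_set_centroid cen_in Sbar_n0 sSb
  (arborescence_connected_compl T_arb sS T_cross) parts0.
have val0E := cut_in i0 U0 i0d U0P; rewrite -r_Sbar -r_val in val0E.
split=> //; split.
  rewrite r_Sbar; split.
    rewrite inE; apply: contra (parts_root cen_in (ltnW i0d) U0P).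
    by rewrite inE => /andP[].
  rewrite setCK; apply/set0Pn; exists (cen U0); rewrite inE connect0 andbT.
  exact: cen_in i0d U0P.
(* The output is at most the candidate of [U], itself at most the weight of the minimum cut. Being a
   cut weight, the output is then minimum. *)
move=> A A_cut; apply: le_trans (S_min A A_cut); rewrite -val0E r_val.
apply: le_trans (r_min i U (conj id UP)) _; rewrite -[S]setCK.
apply: (@level_flow_le_cut R V G s (parts s T cen i) cen) BU => //.
- by move=> ? ? ?; apply: parts_disjoint (ltnW id).
- by move=> W; apply: parts_root (ltnW id).
- by move=> W; apply: cen_in.
- by case: (r_flow i id).
Qed.

End Correctness.

(** * Subtrees and centroids of a rooted tree *)

Section FunctionIterates.
Variables (V : finType) (f : V -> V).

Lemma fconnect_step x y : fconnect f x y = (x == y) || fconnect f (f x) y.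
Proof.
apply/idP/orP=> [/iter_findex <-|[/eqP -> //|]]; last exact: connect_trans (fconnect1 f x).
by case: (findex f x y) => [|k]; [left | right; rewrite iterSr fconnect_iter].
Qed.

(** Both are iterates of [x], so the later one is an iterate of the earlier one. *)
Lemma fconnect_comparable x a b :
  fconnect f x a -> fconnect f x b -> fconnect f a b \/ fconnect f b a.
Proof.
move=> /iter_findex <- /iter_findex <-.
have [ij|/ltnW ji] := leqP (findex f x a) (findex f x b); [left | right].
  by rewrite -(subnK ij) iterD fconnect_iter.
by rewrite -(subnK ji) iterD fconnect_iter.
Qed.

Lemma fconnect_fixed x y : f x = x -> fconnect f x y -> x = y.
Proof. by move=> fx /iter_findex <-; rewrite iter_fix. Qed.

Lemma fconnect_fixed_unique x a b :
  fconnect f x a -> f a = a -> fconnect f x b -> f b = b -> a = b.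
Proof.
move=> xa fa xb fb; case: (fconnect_comparable xa xb) => /fconnect_fixed; first exact.
by move=> ->.
Qed.

End FunctionIterates.

Fact half_complement a b c : a < 2 * b -> b <= a -> c <= a - b -> 2 * c <= a.
Proof. lia. Qed.

Section RootedTree.
Variables (V : finType) (s : V) (T : {set V * V}) (par : V -> V) (depth : V -> nat).
Hypothesis T_par : forall x y, ((x, y) \in T) = (y != s) && (x == par y).
Hypothesis depth_par : forall v, v != s -> depth v = (depth (par v)).+1.
Implicit Types (A U W : {set V}).

(** A vertex whose parent is outside [A] is made a fixed point. For [A] without the root, [fconnect]
    of this total map is then the ancestor relation inside [A], and its fixed points in [A] are the
    roots of the forest that [T] induces on [A]. *)
Definition climb A v := if par v \in A then par v else v.

(** The root of the tree of [v] in that forest; it names the component of [v]. By [topP], the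
    default is never taken in a root-free [A]. *)
Definition top A v := odflt v [pick t | fconnect (climb A) v t && (climb A t == t)].

Definition subtree A v : {set V} := [set w in A | fconnect (climb A) w v].

Section RootFree.
Variable A : {set V}.
Hypothesis sA : s \notin A.

Let non_root v : v \in A -> v != s. Proof. by apply: contraTneq => ->. Qed.

Lemma climb_in v : v \in A -> climb A v \in A.
Proof. by move=> vA; rewrite /climb; case: ifP. Qed.

Lemma fconnect_climb_in v w : fconnect (climb A) v w -> v \in A -> w \in A.
Proof.
move/iter_findex <-; elim: (findex _ _ _) => //= k IHk vA.
by rewrite climb_in ?IHk.
Qed.

Lemma climb_depth v : v \in A -> climb A v != v -> depth (climb A v) < depth v.
Proof.
by move=> vA; rewrite /climb; case: ifP => [_ _|]; rewrite ?eqxx // [depth v]depth_par ?non_root.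
Qed.

Lemma fconnect_climb_depth v w :
  v \in A -> fconnect (climb A) v w -> v != w -> depth w < depth v.
Proof.
move=> vA vw; move: vw (vA); move/iter_findex <-; elim: (findex _ _ _) => [|k IHk] _ /=.
  by rewrite eqxx.
set u := iter k _ v in IHk *.
have uA : u \in A by apply: fconnect_climb_in vA; rewrite fconnect_iter.
have [-> |fu] := eqVneq (climb A u) u; first exact: IHk.
have [->|vu _] := eqVneq v u; first by rewrite climb_depth.
by apply: ltn_trans (climb_depth uA fu) (IHk vA vu).
Qed.

Lemma child_depth c v : c \in A -> par c = v -> depth v < depth c.
Proof. by move=> /non_root cs <-; rewrite [depth c]depth_par. Qed.

Lemma topP v : v \in A -> fconnect (climb A) v (top A v) /\ climb A (top A v) = top A v.
Proof.
rewrite /top => vA; case: pickP => [t /andP[vt /eqP tt] //|none].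
suff [t vt tt] : exists2 t, fconnect (climb A) v t & climb A t = t.
  by have := none t; rewrite vt tt eqxx.
move: {-1}(depth v) (erefl (depth v)) vA {none} => k; elim/ltn_ind: k v => k IHk v vk vA.
have [vv|vv] := eqVneq (climb A v) v; first by exists v; rewrite ?connect0.
have [|t vt tt] := IHk _ _ (climb A v) erefl (climb_in vA).
  by rewrite -vk climb_depth.
by exists t => //; apply: connect_trans (fconnect1 _ _) vt.
Qed.

Lemma top_unique v t :
  v \in A -> fconnect (climb A) v t -> climb A t = t -> top A v = t.
Proof. by move=> /topP[vt tt] vt' tt'; apply: fconnect_fixed_unique vt tt vt' tt'. Qed.

Lemma top_in v : v \in A -> top A v \in A.
Proof. by move=> vA; have [vt _] := topP vA; apply: fconnect_climb_in vt vA. Qed.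

Lemma top_idem v : v \in A -> top A (top A v) = top A v.
Proof. by move=> vA; apply: top_unique; rewrite ?top_in ?connect0 //; case: (topP vA). Qed.

Lemma top_fconnect v w : v \in A -> fconnect (climb A) v w -> top A w = top A v.
Proof.
move=> vA vw; have wA := fconnect_climb_in vw vA.
have [wt tt] := topP wA; apply/esym/top_unique => //; exact: connect_trans vw wt.
Qed.

(** The recursion by which the program computes tops, parents first. *)
Lemma top_par v : v \in A -> top A v = if par v \in A then top A (par v) else v.
Proof.
move=> vA; case: ifP => pA.
  by apply/esym/top_fconnect => //; rewrite fconnect_step {2}/climb pA connect0 orbT.
by apply: top_unique; rewrite ?connect0 // /climb pA.
Qed.

Lemma adj_top x y : induced_adj T A x y -> top A x = top A y.
Proof.
rewrite /induced_adj /= !T_par => /and3P[xA yA] /orP[] /andP[_ /eqP xy].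
  by rewrite [RHS]top_par // -xy xA.
by rewrite [LHS]top_par // -xy yA.
Qed.

Lemma connect_fconnect x y :
  x \in A -> fconnect (climb A) x y -> connect (induced_adj T A) x y.
Proof.
move=> xA /iter_findex <-; elim: (findex _ _ _) => [|k IHk] //=.
apply: connect_trans IHk _; set u := iter k _ x.
have uA : u \in A by apply: fconnect_climb_in xA; rewrite fconnect_iter.
rewrite /climb; case: ifP => // pA; apply: connect1.
by rewrite /induced_adj /= uA pA !T_par eqxx (non_root uA) orbT.
Qed.

(** An edge joins a vertex to its parent, so [top] is constant along paths; conversely, each vertex
    climbs to its top inside [A]. *)
Lemma connect_top x y :
  x \in A -> y \in A -> connect (induced_adj T A) x y = (top A x == top A y).
Proof.
move=> xA yA; apply/idP/eqP=> [/connectP[p p_path ->] {y yA}|xy].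
  elim: p x p_path {xA} => //= z p IHp x /andP[xz /IHp <-]; exact: adj_top.
apply: (@connect_trans _ _ (top A x)); first by apply: connect_fconnect => //; case: (topP xA).
by rewrite connect_induced_sym xy; apply: connect_fconnect => //; case: (topP yA).
Qed.

Lemma component_top x : x \in A -> component T A x = [set y in A | top A y == top A x].
Proof.
by move=> xA; apply/setP=> y; rewrite !inE; case yA: (y \in A); rewrite //= connect_top // eq_sym.
Qed.

Lemma subtree_top x : x \in A -> subtree A (top A x) = component T A x.
Proof.
move=> xA; rewrite component_top //; apply/setP=> y; rewrite !inE.
case yA: (y \in A) => //=; apply/idP/eqP=> [|<-]; last by case: (topP yA).
by move=> yx; apply: top_unique => //; case: (topP xA).
Qed.

Lemma subtree_self v : v \in A -> v \in subtree A v.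
Proof. by rewrite inE connect0 andbT. Qed.

Lemma subtree_sub v w : w \in subtree A v -> subtree A w \subset subtree A v.
Proof.
rewrite inE => /andP[_ wv]; apply/subsetP=> x; rewrite !inE => /andP[-> xw].
exact: connect_trans xw wv.
Qed.

Lemma subtree_child v w :
  w \in subtree A v -> w != v -> exists c, [/\ c \in A, par c = v & w \in subtree A c].
Proof.
rewrite inE => /andP[wA /iter_findex <-].
elim: (findex _ _ _) => [|k IHk] /=; first by rewrite eqxx.
set u := iter k _ w in IHk *.
have uA : u \in A by apply: fconnect_climb_in wA; rewrite fconnect_iter.
rewrite /climb; case: ifP => // _ _; exists u.
by rewrite inE wA fconnect_iter.
Qed.

(** Two vertices with a common descendant are comparable, and comparable vertices with the same
    parent coincide for reasons of depth. *)
Lemma subtree_child_unique v w c c' :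
    c \in A -> c' \in A -> par c = v -> par c' = v ->
    w \in subtree A c -> w \in subtree A c' -> c = c'.
Proof.
have sub x y : x \in A -> y \in A -> par x = par y -> fconnect (climb A) x y -> x = y.
  move=> xA yA pxy; rewrite fconnect_step => /predU1P[//|].
  rewrite /climb; case: ifP => [pA|pA] xy; last first.
    by apply: fconnect_fixed xy; rewrite pA.
  have := child_depth yA (esym pxy); rewrite ltnNge => /negP[].
  have [-> //|/(fconnect_climb_depth pA xy)/ltnW //] := eqVneq (par x) y.
move=> cA c'A <- pc' /setIdP[_ wc] /setIdP[_ wc'].
by case: (fconnect_comparable wc wc') => /sub; [apply | move=> ->].
Qed.

(** Double counting: a vertex strictly below [v] lies below exactly one child of [v]. The program
    uses this recursion children first. *)
Lemma card_subtree v : v \in A ->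
  #|subtree A v| = (\sum_(c in A | par c == v) #|subtree A c|).+1.
Proof.
move=> vA; rewrite (cardsD1 v) subtree_self // add1n; congr _.+1.
have cardE (B : {set V}) : B \subset A -> #|B| = \sum_(w in A) (w \in B).
  move=> BA; rewrite -sum1_card [RHS](big_setID B) /= (setIidPr BA).
  rewrite [X in _ = _ + X]big1 ?addn0 => [|w]; last by rewrite inE => /andP[/negPf ->].
  by apply: eq_bigr => w ->.
have sub_in w : subtree A w \subset A by apply/subsetP=> x /setIdP[].
rewrite cardE; last by apply: subset_trans (subsetDl _ _) (sub_in v).
rewrite [RHS](eq_bigr (fun c => \sum_(w in A) (w \in subtree A c))) => [|c _]; last exact: cardE.
rewrite exchange_big /=; apply: eq_bigr => w wA; rewrite in_setD1.
have [/andP[wv wsub]|] := boolP ((w != v) && (w \in subtree A v)).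
  have [c [cA pc wc]] := subtree_child wsub wv.
  rewrite (bigD1 c) /=; last by rewrite cA pc eqxx.
  rewrite wc big1 // => c' /andP[/andP[c'A /eqP pc'] c'c].
  by apply/eqP; rewrite eqb0; apply: contra c'c => wc';
    rewrite (subtree_child_unique c'A cA pc' pc wc' wc).
move=> wnot; rewrite big1 // => c /andP[cA /eqP pc]; apply/eqP; rewrite eqb0.
apply: contra wnot => wc.
have cv : c \in subtree A v.
  by rewrite inE cA fconnect_step {2}/climb pc vA connect0 orbT.
rewrite (subsetP (subtree_sub cv)) // andbT.
apply: contraTneq (child_depth cA pc) => <-; rewrite -leqNgt.
case/setIdP: wc => _ wc; have [-> //|/(fconnect_climb_depth wA wc)/ltnW //] := eqVneq w c.
Qed.

Lemma climb_component U x : U \in components T A -> x \in U -> climb U x = climb A x.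
Proof.
move=> UA xU; have xA := subsetP (components_sub UA) _ xU.
rewrite /climb (_ : (par x \in U) = (par x \in A)) //.
apply/idP/idP=> [/(subsetP (components_sub UA)) //|pA].
by rewrite (component_eq UA xU) component_top // inE pA [top A x]top_par // pA eqxx.
Qed.

(** Climbing never leaves a component, so the subtree sizes of all parts of a level can be computed
    together in [A]. *)
Lemma subtree_component U v : U \in components T A -> v \in U -> subtree U v = subtree A v.
Proof.
move=> UA vU; have UAs := subsetP (components_sub UA); have vA := UAs _ vU.
have iter_climb w k : w \in U -> iter k (climb U) w = iter k (climb A) w /\ iter k (climb A) w
  \in U.
  move=> wU; elim: k => //= k [-> kU]; rewrite (climb_component UA) //; split=> //.
  rewrite -(climb_component UA kU) /climb; case: ifP => //.
apply/setP=> w; rewrite !inE; apply/andP/andP=> [[wU]|[wA wv]].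
  by move/iter_findex <-; rewrite (iter_climb _ _ wU).1 fconnect_iter UAs.
have wU : w \in U.
  by rewrite (component_eq UA vU) component_top // inE wA (top_fconnect wA wv) eqxx.
by split=> //; move/iter_findex: wv <-; rewrite -(iter_climb _ _ wU).1 fconnect_iter.
Qed.

End RootFree.

(** Singles out one centroid when there are two, by the orientation of the tree. *)
Definition heavy_centroid U v : bool :=
  [&& v \in U, #|U| < 2 * #|subtree U v|
    & [forall c in U, (par c == v) ==> (2 * #|subtree U c| <= #|U|)]].

Definition centroid_of U : V := odflt s [pick v | heavy_centroid U v].

(** Two majority subtrees meet, so their roots are comparable. If these differed, the lower one
    would lie below a child of the upper one, yet such a child has at most half of the vertices
    below it. *)
Lemma heavy_centroid_unique U v w :
  s \notin U -> heavy_centroid U v -> heavy_centroid U w -> v = w.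
Proof.
move=> sU.
have below x y : heavy_centroid U x -> heavy_centroid U y -> fconnect (climb U) x y -> x = y.
  case/and3P=> xU x_heavy _ /and3P[_ _ /forall_inP y_light] xy; apply/eqP; apply: contraT => xny.
  have xsub : x \in subtree U y by rewrite inE xU.
  have [c [cU /eqP pc xc]] := subtree_child xsub xny.
  have := implyP (y_light c cU) pc; rewrite leqNgt => /negP[].
  by apply: leq_trans x_heavy _; rewrite leq_mul2l subset_leq_card ?subtree_sub.
move=> hv hw; have [/and3P[vU v2 _] /and3P[wU w2 _]] := (hv, hw).
have : subtree U v :&: subtree U w != set0.
  rewrite -card_gt0; have := cardsUI (subtree U v) (subtree U w).
  have : #|subtree U v :|: subtree U w| <= #|U|.
    by apply: subset_leq_card; apply/subsetP=> x; rewrite !inE => /orP[]/andP[].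
  lia.
case/set0Pn=> x; rewrite !inE => /andP[/andP[_ xv] /andP[_ xw]].
by case: (fconnect_comparable xv xw) => vw; [|apply/esym]; apply: below.
Qed.

Section Centroids.
Variables (A U : {set V}).
Hypotheses (sA : s \notin A) (UA : U \in components T A).

Let sU : s \notin U. Proof. by apply: contra sA => /(subsetP (components_sub UA)). Qed.

(** Take a vertex of greatest depth among those with a majority subtree; the top is one of them, as
    its subtree is all of [U]. *)
Lemma centroid_ofP : heavy_centroid U (centroid_of U).
Proof.
rewrite /centroid_of; case: pickP => //= none.
case/componentsP: (UA) => x xA Ux.
pose heavy v := (v \in U) && (#|U| < 2 * #|subtree U v|).
have tU : top A x \in U by rewrite Ux (component_top sA xA) inE (top_in sA xA) (top_idem sA xA) /=.
have t_heavy : heavy (top A x).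
  rewrite /heavy tU (subtree_component sA UA tU) (subtree_top sA xA) -Ux mul2n -addnn.
  by rewrite -[ltnLHS]addn0 ltn_add2l card_gt0; apply/set0Pn; exists (top A x).
have [v /andP[vU v_heavy] v_max] := arg_maxnP depth t_heavy.
have := none v; rewrite /heavy_centroid vU v_heavy => /negbT/negP[].
apply/forall_inP=> c cU; apply/implyP=> /eqP pc; rewrite leqNgt; apply/negP=> c_heavy.
have := v_max c; rewrite /heavy cU c_heavy => /(_ isT).
by rewrite /geq /= leqNgt (child_depth sU cU pc).
Qed.

Lemma centroid_of_unique v : heavy_centroid U v -> centroid_of U = v.
Proof. exact: (heavy_centroid_unique sU centroid_ofP). Qed.

(** A component left by [u] either hangs below a child of [u], whose subtree is small enough, or
    avoids the subtree of [u], outside of which fewer than half of the vertices lie. *)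
Lemma centroid_of_is_centroid : is_centroid T U (centroid_of U).
Proof.
set u := centroid_of U; have /and3P[uU u_heavy /forall_inP u_light] := centroid_ofP.
split=> // W; set B := U :\ u => WB.
have sB : s \notin B by rewrite in_setD1 (negPf sU) andbF.
have BU : B \subset U by apply: subsetDl.
case/componentsP: (WB) => x xB ->; rewrite -(subtree_top sB xB); set t := top B x.
have [tB tfix] : t \in B /\ climb B t = t by split; [apply: (top_in sB xB) | case: (topP sB xB)].
have [tu tU] : t != u /\ t \in U by move: tB; rewrite in_setD1 => /andP[].
have [pt|pt] := eqVneq (par t) u.
  apply: leq_trans (implyP (u_light t tU) _); last exact/eqP.
  rewrite leq_mul2l /=; apply: subset_leq_card; apply/subsetP=> w; rewrite !inE => /andP[wB wt].
  have /andP[_ ->] := wB.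
  rewrite /=; apply: connect_sub wt => a b /eqP <-; rewrite [climb B a]/climb.
  case: ifP => pB; last exact: connect0.
  by rewrite fconnect_step [climb U a]/climb (subsetP BU _ pB) connect0 orbT.
have sub : subtree B t \subset U :\: subtree U u.
  apply/subsetP=> w; rewrite !inE => /andP[/andP[wu wU] wt]; rewrite wU andbT /=.
  have wB : w \in B by rewrite in_setD1 wu.
  (* Climbing in [U] and in [B] differs only at a child of [u]. Such a child is fixed in [B], so
     meeting it from [w] would make it equal to [t], against [pt]. *)
  have iterE k : iter k (climb U) w = iter k (climb B) w.
    elim: k => //= k ->; set y := iter k _ w.
    have wy : fconnect (climb B) w y by apply: fconnect_iter.
    rewrite /climb in_setD1; case pyU: (par y \in U); last by rewrite andbF.
    rewrite andbT; case: eqVneq => //= pyu.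
    have yfix : climb B y = y by rewrite /climb pyu in_setD1 eqxx.
    by rewrite (fconnect_fixed_unique wt tfix wy yfix) pyu eqxx in pt.
  apply/negP=> wuc; have := fconnect_climb_in (fconnect_iter (climb B) (findex (climb U) w u) w) wB.
  by rewrite -iterE iter_findex // in_setD1 eqxx.
have := subset_leq_card sub; rewrite cardsD.
have -> : U :&: subtree U u = subtree U u by apply/setIidPr/subsetP=> y /setIdP[].
have : #|subtree U u| <= #|U| by apply: subset_leq_card; apply/subsetP=> y /setIdP[].
exact: half_complement.
Qed.

End Centroids.
End RootedTree.

Lemma parts_card_bound (V : finType) (s : V) (T : {set V * V}) (cen : {set V} -> V) d :
    (forall i U, i < d -> U \in parts s T cen i -> is_centroid T U (cen U)) ->
  forall i U, i <= d -> U \in parts s T cen i -> 2 ^ i * #|U| <= #|V|.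
Proof.
move=> cenP; elim=> [|i IHi] U id; first by rewrite mul1n max_card.
case/bigcupP=> W WP UW; have [_ /(_ U UW)] := cenP i W id WP.
rewrite expnSr -mulnA => U_le; apply: leq_trans (IHi W (ltnW id) WP).
by rewrite leq_mul2l U_le orbT.
Qed.

Section ArborescenceParents.
Variables (R : realDomainType) (V : finType) (G : digraph R V) (s : V) (T : {set V * V}).

(** The root is its own parent, as in the array [a_par] of the program. Elsewhere the in-degree is
    one, so the default never occurs in an arborescence. *)
Definition parent v : V := if v == s then s else odflt s [pick x | (x, v) \in T].

Hypothesis T_arb : arborescence G s T.

Lemma arborescence_parent x y : ((x, y) \in T) = (y != s) && (x == parent y).
Proof.
case: T_arb => _ in_deg _; have := in_deg y; rewrite /parent.
have [-> /eqP|ys /eqP/cards1P[[a b] in_y]] := eqVneq y s.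
  rewrite cards_eq0 => /eqP in_s; apply/negP=> xsT.
  by move/setP/(_ (x, s)): in_s; rewrite !inE xsT eqxx.
have xyE z : ((z, y) \in T) = ((z, y) == (a, b)).
  by rewrite -in_set1 -in_y inE eqxx andbT.
have /setIdP[abT /eqP /= by_] : (a, b) \in [set e in T | e.2 == y] by rewrite in_y set11.
case: pickP => [z|/(_ a)] /=; last by rewrite -by_ abT.
by rewrite !xyE !xpair_eqE => /andP[/eqP -> ->]; rewrite andbT.
Qed.

(** The least number of parent steps to the root, which exists because [s] reaches every vertex. *)
Lemma arborescence_depth :
  exists depth : V -> nat, forall v, v != s -> depth v = (depth (parent v)).+1.
Proof.
case: T_arb => _ _ T_conn.
have reach v : exists k, iter k parent v == s.
  case/connectP: (T_conn v) => p; elim/last_ind: p v => [|p y IHp] v /=; first by move=> _ ->;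
    exists 0.
  rewrite rcons_path last_rcons => /andP[p_path xyT] ->; have [k kE] := IHp _ p_path erefl.
  move: xyT; rewrite /= arborescence_parent => /andP[_ /eqP py].
  by exists k.+1; rewrite iterSr -py.
exists (fun v => ex_minn (reach v)) => v vs.
case: ex_minnP => -[|k]; first by rewrite /= (negPf vs).
rewrite iterSr => kE k_min; case: ex_minnP => j jE j_min; congr _.+1; apply/eqP.
by rewrite eqn_leq (j_min k kE) andbT -ltnS k_min // iterSr.
Qed.


(** Distinct non-root vertices have distinct parent edges. The time bound uses this to absorb [n]
    into the number of edges. *)
Lemma arborescence_card_edges : #|V| <= #|edges G|.+1.
Proof.
have [T_sub _ _] := T_arb.
rewrite (cardD1 s) inE add1n ltnS.
apply: leq_trans (subset_leq_card T_sub).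
rewrite -(card_in_imset (f := fun v => (parent v, v)) (D := [predD1 V & s])); last first.
  by move=> x y _ _ [].
by apply/subset_leq_card/subsetP=> e /imsetP[v]; rewrite inE andbT => vs ->;
  rewrite arborescence_parent vs eqxx.
Qed.

End ArborescenceParents.

(** * Running time of programs *)

Fixpoint loop_free (c : cmd) : bool :=
  match c with
  | Then c1 c2 | If _ c1 c2 => loop_free c1 && loop_free c2
  | While _ _ | MaxFlow => false
  | _ => true
  end.

Fixpoint cmd_size (c : cmd) : nat :=
  match c with
  | Then c1 c2 => cmd_size c1 + cmd_size c2
  | If _ c1 c2 => (cmd_size c1 + cmd_size c2).+1
  | While _ c => (cmd_size c).+1
  | _ => 1
  end.

(* The tag is 0 for number registers, 1 for number arrays, 2 for weight
   registers and 3 for weight arrays. *)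
Fixpoint modified (c : cmd) : seq (nat * nat) :=
  match c with
  | Skip => [::]
  | NSet x _ => [:: (0, x)]
  | NStore a _ _ => [:: (1, a)]
  | WSet x _ => [:: (2, x)]
  | WStore a _ _ => [:: (3, a)]
  | Then c1 c2 | If _ c1 c2 => modified c1 ++ modified c2
  | While _ c => modified c
  | MaxFlow => [:: (3, w_flow)]
  end.

Definition For (i x : nat) (c : cmd) : cmd :=
  Then (NSet i (NConst 0))
       (While (BLe (NAdd (NReg i) (NConst 1)) (NReg x))
          (Then c (NSet i (NAdd (NReg i) (NConst 1))))).

Section Execution.
Variables (R : realDomainType) (F : nat -> nat -> nat) (MF : oracle R).
Implicit Types (st : state R) (c : cmd) (Q : state R -> Prop).

Definition frame (L : seq (nat * nat)) st st' : Prop :=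
  [/\ forall x, (0, x) \notin L -> nreg st' x = nreg st x,
      forall x, (1, x) \notin L -> narr st' x = narr st x,
      forall x, (2, x) \notin L -> wreg st' x = wreg st x
    & forall x, (3, x) \notin L -> warr st' x = warr st x].

Lemma frame_trans L st1 st2 st3 : frame L st1 st2 -> frame L st2 st3 -> frame L st1 st3.
Proof.
move=> [a1 b1 c1 d1] [a2 b2 c2 d2].
by split=> x xL; rewrite ?a2 ?a1 ?b2 ?b1 ?c2 ?c1 ?d2 ?d1.
Qed.

Lemma frame_sub L L' st st' : {subset L <= L'} -> frame L st st' -> frame L' st st'.
Proof.
move=> sLL [a b c d].
by split=> x xL; [apply: a|apply: b|apply: c|apply: d]; apply: contra xL; apply: sLL.
Qed.

(** The footprint is read off the program text, so the side conditions about untouched variables are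
    settled by computation. *)
Lemma exec_frame c st st' t l : exec F MF c st st' t l -> frame (modified c) st st'.
Proof.
have updE (B : Type) (f : nat -> B) k v j : j != k -> upd f k v j = f j.
  by rewrite /upd => /negPf ->.
elim=> {c st st' t l} /=.
- by [].
- by move=> st x e; split=> y //=; rewrite inE xpair_eqE /= => ?; rewrite updE.
- by move=> st x i e; split=> y //=; rewrite inE xpair_eqE /= => ?; rewrite updE.
- by move=> st x e; split=> y //=; rewrite inE xpair_eqE /= => ?; rewrite updE.
- by move=> st x i e; split=> y //=; rewrite inE xpair_eqE /= => ?; rewrite updE.
- move=> c1 c2 st st1 st2 t1 t2 l1 l2 _ fr1 _ fr2.
  by apply: frame_trans (frame_sub _ fr1) (frame_sub _ fr2) => z; rewrite mem_cat => ->;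
    rewrite ?orbT.
- move=> b c1 c2 st st' t l _; apply: frame_sub => z.
  by case: ifP => _; rewrite mem_cat => ->; rewrite ?orbT.
- by [].
- by move=> b c st st1 st2 t1 t2 l1 l2 _ _ fr1 _; apply: frame_trans fr1.
- by move=> st I _; split=> y //=; rewrite inE xpair_eqE /= => ?; rewrite updE.
Qed.

(** The last case is a placeholder, as only [loop_free] commands are evaluated. All loop bodies
    except that of the outermost loop are of this kind, so their effect is obtained by
    computation. *)
Fixpoint straight c st : state R :=
  match c with
  | NSet x e => set_nreg st x (neval st e)
  | NStore a i e => set_narr st a (neval st i) (neval st e)
  | WSet x e => set_wreg st x (weval st e)
  | WStore a i e => set_warr st a (neval st i) (weval st e)
  | Then c1 c2 => straight c2 (straight c1 st)
  | If b c1 c2 => if beval st b then straight c1 st else straight c2 st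
  | _ => st
  end.

Lemma straight_exec c st :
  loop_free c -> exists2 t, exec F MF c st (straight c st) t [::] & t <= cmd_size c.
Proof.
elim: c st => //=.
- by exists 1 => //; apply: ExSkip.
- by exists 1 => //; apply: ExNSet.
- by exists 1 => //; apply: ExNStore.
- by exists 1 => //; apply: ExWSet.
- by exists 1 => //; apply: ExWStore.
- move=> c1 IH1 c2 IH2 st /andP[/(IH1 st)[t1 e1 b1] /(IH2 (straight c1 st))[t2 e2 b2]].
  by exists (t1 + t2); [rewrite -[[::]]cats0; apply: ExThen e1 e2 | apply: leq_add].
- move=> b c1 IH1 c2 IH2 st /andP[/(IH1 st)[t1 e1 b1] /(IH2 st)[t2 e2 b2]].
  case: ifP => bE; [exists t1.+1|exists t2.+1]; rewrite ?ltnS.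
  + by apply: ExIf; rewrite bE.
  + exact: leq_trans b1 (leq_addr _ _).
  + by apply: ExIf; rewrite bE.
  + exact: leq_trans b2 (leq_addl _ _).
Qed.

Lemma straight_frame c st : loop_free c -> frame (modified c) st (straight c st).
Proof. by case/(straight_exec st) => t /exec_frame. Qed.

Definition halts c st (B : nat) l Q : Prop :=
  exists st' t, [/\ exec F MF c st st' t l, t <= B & Q st'].

Lemma halts_then c1 c2 st B1 B2 l1 l2 Q1 Q :
    halts c1 st B1 l1 Q1 -> (forall st1, Q1 st1 -> halts c2 st1 B2 l2 Q) ->
  halts (Then c1 c2) st (B1 + B2) (l1 ++ l2) Q.
Proof.
move=> [st1 [t1 [e1 b1 q1]]] /(_ st1 q1)[st2 [t2 [e2 b2 q2]]].
by exists st2, (t1 + t2); split; [apply: ExThen e1 e2 | apply: leq_add |].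
Qed.

Lemma halts_weaken c st B B' l Q Q' :
  B <= B' -> (forall st', Q st' -> Q' st') -> halts c st B l Q -> halts c st B' l Q'.
Proof.
move=> BB QQ [st' [t [e b q]]]; exists st', t.
by split=> //; [apply: leq_trans BB | apply: QQ].
Qed.

Lemma halts_frame c st B l Q :
  halts c st B l Q -> halts c st B l (fun st' => Q st' /\ frame (modified c) st st').
Proof. by move=> [st' [t [e b q]]]; exists st', t; split=> //; split=> //; apply: exec_frame e. Qed.

(** The number carried by [Inv] is a variant. It bounds the rounds, each of which costs the body and
    one test; the final failing test adds one. *)
Lemma halts_while (Inv : nat -> state R -> Prop) b c k st :
    loop_free c -> Inv k st ->
    (forall j st', Inv j st' -> beval st' b -> exists2 j', j' < j & Inv j' (straight c st')) ->
  halts (While b c) st (k * (cmd_size c).+1).+1 [::]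
    (fun st' => (exists j, Inv j st') /\ ~~ beval st' b).
Proof.
move=> c_lf Inv_k Inv_step; elim/ltn_ind: k st Inv_k => k IHk st Inv_k.
have [b_true|b_false] := boolP (beval st b); last first.
  by exists st, 1; split=> //; [apply: ExWhileEnd | split=> //; exists k].
have [j jk Inv_j] := Inv_step k st Inv_k b_true.
have [t1 e1 b1] := straight_exec st c_lf.
have [st2 [t2 [e2 b2 q2]]] := IHk j jk _ Inv_j.
exists st2, (t1 + t2).+1; split=> //.
  by rewrite -[[::]]cats0; apply: ExWhile b_true e1 e2.
rewrite ltnS; apply: leq_trans (leq_add b1 b2) _.
have : j.+1 * (cmd_size c).+1 <= k * (cmd_size c).+1 by rewrite leq_mul2r jk orbT.
by rewrite mulSn addnS -addSn.
Qed.

(* The time is proportional to the size of the program text and to X, which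
   bounds the number of iterations of each loop. *)
Definition linear_time c st (X : nat) Q : Prop := halts c st (6 * cmd_size c * X) [::] Q.

Lemma linear_straight c st X Q : 0 < X -> loop_free c -> Q (straight c st) -> linear_time c st X Q.
Proof.
move=> X0 /(straight_exec st)[t e b] q; exists (straight c st), t; split=> //.
by apply: leq_trans b _; rewrite mulnAC; apply: leq_pmull; rewrite muln_gt0.
Qed.

(** Sequencing adds program sizes and leaves [X] alone, so that no constant has to be tracked. *)
Lemma linear_then c1 c2 st X Q1 Q :
    linear_time c1 st X Q1 -> (forall st1, Q1 st1 -> frame (modified c1) st st1 -> linear_time c2
      st1 X Q) ->
  linear_time (Then c1 c2) st X Q.
Proof.
move=> /halts_frame h1 h2; rewrite /linear_time /= mulnDr mulnDl.
by apply: (halts_then (l2 := [::]) h1) => st1 [q1 f1]; apply: h2.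
Qed.

Lemma linear_weaken c st X (Q Q' : state R -> Prop) :
  (forall st', Q st' -> Q' st') -> linear_time c st X Q -> linear_time c st X Q'.
Proof. by move=> QQ; apply: halts_weaken. Qed.

Lemma linear_frame c st X Q :
  linear_time c st X Q -> linear_time c st X (fun st' => Q st' /\ frame (modified c) st st').
Proof. exact: halts_frame. Qed.

Lemma linear_if b c1 c2 st X Q :
    0 < X -> (beval st b -> linear_time c1 st X Q) -> (~~ beval st b -> linear_time c2 st X Q) ->
  linear_time (If b c1 c2) st X Q.
Proof.
move=> X0 h1 h2; have [st' [t [e tb q]]] :
    halts (if beval st b then c1 else c2) st (6 * (cmd_size c1 + cmd_size c2) * X) [::] Q.
  case: ifPn => [/h1|/h2]; apply: halts_weaken => //.
    by rewrite leq_mul2r leq_mul2l leq_addr !orbT.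
  by rewrite leq_mul2r leq_mul2l leq_addl !orbT.
exists st', t.+1; split=> //; first exact: ExIf e.
apply: leq_ltn_trans tb _; rewrite ltn_mul2r X0 ltn_mul2l //=.
Qed.

Lemma linear_while (Inv : nat -> state R -> Prop) b c k st X :
    loop_free c -> k < X -> Inv k st ->
    (forall j st', Inv j st' -> beval st' b -> exists2 j', j' < j & Inv j' (straight c st')) ->
  linear_time (While b c) st X (fun st' => (exists j, Inv j st') /\ ~~ beval st' b).
Proof.
move=> c_lf kX Inv_k /(halts_while c_lf Inv_k); apply: halts_weaken => //=.
rewrite -mulnA (mulnC _ X) mulnA.
have : (k * (cmd_size c).+1).+1 <= X * (cmd_size c).+1.
  apply: leq_trans (leq_mul kX (leqnn _)); rewrite mulSn; lia.
move/leq_trans; apply; rewrite leq_mul2r; lia.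
Qed.

Lemma linear_for (Inv : nat -> state R -> Prop) i x c N st X :
    loop_free c -> (0, i) \notin modified c -> (0, x) \notin modified c -> x != i ->
    nreg st x = N -> N < X -> Inv 0 (set_nreg st i 0) ->
    (forall k st', k < N -> frame ((0, i) :: modified c) st st' -> nreg st' i = k ->
       Inv k st' -> Inv k.+1 (set_nreg (straight c st') i k.+1)) ->
  linear_time (For i x c) st X (fun st' => frame ((0, i) :: modified c) st st' /\ Inv N st').
Proof.
move=> c_lf ic xc xi stx NX Inv0 Inv_step.
have X0 : 0 < X by apply: leq_ltn_trans NX.
have fr_i st1 v : frame ((0, i) :: modified c) st1 (set_nreg st1 i v).
  by split=> y //=; rewrite inE xpair_eqE /= negb_or => /andP[/negPf]; rewrite /upd => ->.
apply: (@linear_then _ _ _ _ (fun st1 => st1 = set_nreg st i 0)).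
  exact: linear_straight.
move=> st1 -> _.
(* The variant [j] is the number of rounds left. *)
pose J j st' := exists k, [/\ j + k = N, nreg st' i = k, frame ((0, i) :: modified c) st st' &
  Inv k st'].
have xL : (0, x) \notin (0, i) :: modified c.
  by rewrite inE negb_or xc andbT xpair_eqE /=.
apply: linear_weaken (@linear_while J _ _ N _ X _ NX _ _); last 1 first.
- move=> j st' [k [jk ik fr Ik]] /=; have [frn _ _ _] := fr.
  rewrite ik (frn x xL) stx addn1 => kN; exists j.-1; first by lia.
  exists k.+1; have [frs _ _ _] := straight_frame st' c_lf.
  rewrite frs // ik addn1; split; [lia | by rewrite /= /upd eqxx | | exact: Inv_step].
  apply: frame_trans fr _; apply: frame_trans (fr_i _ _); apply: frame_sub (straight_frame _ c_lf).
  by move=> z zc; rewrite inE zc orbT.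
- move=> st' [[j [k [jk ik fr Ik]]] /=]; have [frn _ _ _] := fr.
  rewrite ik (frn x xL) stx addn1 -leqNgt => Nk; split=> //.
  by have -> : N = k by lia.
- by rewrite /= c_lf.
by exists 0; rewrite addn0 /= /upd eqxx.
Qed.

Lemma linear_for_then (Inv : nat -> state R -> Prop) i x c N c2 st X Q :
    loop_free c -> (0, i) \notin modified c -> (0, x) \notin modified c -> x != i ->
    nreg st x = N -> N < X -> Inv 0 (set_nreg st i 0) ->
    (forall k st', k < N -> frame ((0, i) :: modified c) st st' -> nreg st' i = k ->
       Inv k st' -> Inv k.+1 (set_nreg (straight c st') i k.+1)) ->
    (forall st1, frame ((0, i) :: modified c) st st1 -> Inv N st1 -> linear_time c2 st1 X Q) ->
  linear_time (Then (For i x c) c2) st X Q.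
Proof.
move=> c_lf ic xc xi stx NX Inv0 Inv_step h2.
apply: linear_then (linear_for c_lf ic xc xi stx NX Inv0 Inv_step) _.
by move=> st1 [fr Inv_N] _; apply: h2.
Qed.

Lemma linear_for_end (Inv : nat -> state R -> Prop) i x c N st X Q :
    loop_free c -> (0, i) \notin modified c -> (0, x) \notin modified c -> x != i ->
    nreg st x = N -> N < X -> Inv 0 (set_nreg st i 0) ->
    (forall k st', k < N -> frame ((0, i) :: modified c) st st' -> nreg st' i = k ->
       Inv k st' -> Inv k.+1 (set_nreg (straight c st') i k.+1)) ->
    (forall st1, frame ((0, i) :: modified c) st st1 -> Inv N st1 -> Q st1) ->
  linear_time (For i x c) st X Q.
Proof.
move=> c_lf ic xc xi stx NX Inv0 Inv_step hQ.
apply: linear_weaken (linear_for c_lf ic xc xi stx NX Inv0 Inv_step).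
by move=> st1 [fr Inv_N]; apply: hQ.
Qed.

End Execution.

(** * Breadth-first search *)

Notation v_i := 7 (only parsing).
Notation v_x := 8 (only parsing).
Notation v_y := 9 (only parsing).
Notation v_head := 10 (only parsing).
Notation v_size := 11 (only parsing).
Notation v_ptr := 12 (only parsing).
Notation v_gn := 17 (only parsing).
Notation v_gm := 18 (only parsing).
Notation v_root := 19 (only parsing).
Notation a_gtail := 7 (only parsing).
Notation a_ghead := 8 (only parsing).
Notation a_first := 9 (only parsing).
Notation a_next := 10 (only parsing).
Notation a_seen := 11 (only parsing).
Notation a_queue := 12 (only parsing).

Definition Decr (e : nexp) := NSub e (NConst 1).
Definition Incr (e : nexp) := NAdd e (NConst 1).
Definition Pos (e : nexp) : bexp := BLe (NConst 1) e.

(* Adjacency lists: [a_first] and [a_next] hold arc numbers shifted by 1, and 0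
   ends a list. *)
Definition bfs_init : cmd :=
  Then (For v_i v_gn
         (Then (NStore a_first (NReg v_i) (NConst 0)) (NStore a_seen (NReg v_i) (NConst 0))))
  (Then (For v_i v_gm
         (Then (NStore a_next (NReg v_i) (NLoad a_first (NLoad a_gtail (NReg v_i))))
               (NStore a_first (NLoad a_gtail (NReg v_i)) (Incr (NReg v_i)))))
  (Then (NStore a_seen (NReg v_root) (NConst 1))
  (Then (NStore a_queue (NConst 0) (NReg v_root))
  (Then (NSet v_head (NConst 0))
  (Then (NSet v_size (NConst 1))
        (NSet v_ptr (NConst 0))))))).

(** Scanning an arc and dequeuing a vertex are rounds of one flat loop. Its body is then loop-free,
    and the count of rounds is vertices plus arcs instead of a product. *)
Definition bfs_step : cmd :=
  If (Pos (NReg v_ptr))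
    (Then (NSet v_x (NLoad a_ghead (Decr (NReg v_ptr))))
    (Then (NSet v_ptr (NLoad a_next (Decr (NReg v_ptr))))
          (If (Pos (NLoad a_seen (NReg v_x))) Skip
             (Then (NStore a_seen (NReg v_x) (NConst 1))
             (Then (NStore a_queue (NReg v_size) (NReg v_x))
                   (NSet v_size (Incr (NReg v_size))))))))
    (Then (NSet v_ptr (NLoad a_first (NLoad a_queue (NReg v_head))))
          (NSet v_head (Incr (NReg v_head)))).

Definition bfs : cmd :=
  Then bfs_init
       (While (BNot (BAnd (BNot (Pos (NReg v_ptr))) (BLe (NReg v_size) (NReg v_head)))) bfs_step).

Section BreadthFirstSearch.
Variables (N M : nat) (gt gh : nat -> nat) (r : nat).

(** Closure under arcs shows that all reachable vertices are in [q]; the earlier in-neighbours show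
    the converse. In a tree this in-neighbour is the parent, so parents precede children. *)
Definition bfs_order (q : seq nat) : Prop :=
  [/\ uniq q /\ all (gtn N) q, 0 < size q /\ nth 0 q 0 = r,
      forall k, 0 < k < size q ->
        exists k' j, [/\ k' < k, j < M, gt j = nth 0 q k' & gh j = nth 0 q k]
    & forall j, j < M -> gt j \in q -> gh j \in q].

(** The contents of the adjacency lists: the number, shifted by 1, of the last arc leaving [v] among
    the first [b] arcs, or 0. Lists thus run through decreasing arc numbers. *)
Fixpoint last_arc v b :=
  if b is b'.+1 then if gt b' == v then b else last_arc v b' else 0.

Lemma last_arc_le v b : last_arc v b <= b.
Proof. by elim: b => //= b IHb; case: ifP => // _; apply: leqW. Qed.

Lemma last_arc_tail v b : 0 < last_arc v b -> gt (last_arc v b).-1 = v.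
Proof. by elim: b => //= b IHb; case: ifP => [/eqP|_ /IHb]. Qed.

Lemma last_arc_none v b j : last_arc v b <= j -> j < b -> gt j != v.
Proof.
elim: b => //= b IHb; case: ifP => [_ bj|gb lj]; first by rewrite ltnS leqNgt bj.
by rewrite ltnS leq_eqVlt => /predU1P[->|]; [rewrite gb | apply: IHb].
Qed.

Hypothesis arcs_in : forall j, j < M -> gt j < N /\ gh j < N.
Hypothesis r_in : r < N.

Variables (R : realDomainType) (F : nat -> nat -> nat) (MF : oracle R).
Implicit Types (st : state R).

(** [take h q] holds the dequeued vertices, and the entry [h.-1] is being scanned. As lists
    decrease, its pending arcs are those numbered below the pointer [c]. *)
Definition unscanned (q : seq nat) h c : {set 'I_M} :=
  [set j : 'I_M | (gt j \notin take h q) || ((gt j == nth 0 q h.-1) && (j < c))].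

Definition bfs_inv mu st : Prop :=
  let h := nreg st v_head in let c := nreg st v_ptr in
  (forall j, j < M -> narr st a_gtail j = gt j /\ narr st a_ghead j = gh j) /\
  (forall v, v < N -> narr st a_first v = last_arc v M) /\
  (forall j, j < M -> narr st a_next j = last_arc (gt j) j) /\
  exists q,
  [/\ uniq q /\ all (gtn N) q, 0 < size q /\ nth 0 q 0 = r,
      forall k, 0 < k < size q ->
        exists k' j, [/\ k' < k, j < M, gt j = nth 0 q k' & gh j = nth 0 q k],
      [/\ nreg st v_size = size q, forall k, k < size q -> narr st a_queue k = nth 0 q k
        & forall v, v < N -> narr st a_seen v = (v \in q)]
    & [/\ h <= size q, c <= M /\ (0 < c -> 0 < h /\ gt c.-1 = nth 0 q h.-1),
          forall j, j < M -> gt j \in take h q ->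
            gh j \in q \/ (gt j = nth 0 q h.-1 /\ j < c)
        & mu = (N - h) + #|unscanned q h c|]].

Lemma size_order q : uniq q -> all (gtn N) q -> size q <= N.
Proof.
move=> uq qN; rewrite -[N](size_iota 0); apply: uniq_leq_size => // x /(allP qN).
by rewrite mem_iota.
Qed.

Lemma mem_take_nth (q : seq nat) h k : k < h -> k < size q -> nth 0 q k \in take h q.
Proof. by move=> kh kq; rewrite -(nth_take 0 kh) mem_nth // size_take; case: ifP. Qed.

Lemma bfs_stepP mu st :
  bfs_inv mu st -> beval st (BNot (BAnd (BNot (Pos (NReg v_ptr))) (BLe (NReg v_size) (NReg
    v_head)))) ->
  exists2 mu', mu' < mu & bfs_inv mu' (straight bfs_step st).
Proof.
rewrite /bfs_inv; set h := nreg st v_head; set c := nreg st v_ptr => /=.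
move=> [Earc [Efst [Enxt [q [[uq qN] [q0 qr] q_pred [Esz Eq Eseen] [hq [cM c_pos] closed ->]]]]]].
have [c0|c0] := posnP c; rewrite ?c0 /= -/c -/h ?c0 /=; last first.
  move=> _; have [h0 gc] := c_pos c0; have cM' : c.-1 < M by rewrite prednK.
  rewrite /upd /= subn1; have [Egt Egh] := Earc _ cM'; rewrite Egh (Enxt _ cM') gc.
  have [gcN ghN] := arcs_in cM'; set y := gh c.-1 in ghN *.
  rewrite Eseen // lt0b; set x := nth 0 q h.-1; set c' := last_arc x c.-1.
  have hq' : h.-1 < size q by rewrite prednK.
  have x_take : x \in take h q by rewrite mem_take_nth // prednK.
  have c'c : c' < c by rewrite -(prednK c0) ltnS last_arc_le.
  (* Arc [c.-1] has just been scanned and drops out of the pending set. *)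
  have scan_lt q' : take h q' = take h q -> nth 0 q' h.-1 = x -> #|unscanned q' h c'| <
    #|unscanned q h c|.
    move=> qt qx; apply: proper_card; apply/properP; split.
      apply/subsetP=> j; rewrite !inE qt qx => /orP[->//|/andP[-> jc]].
      by rewrite (ltn_trans jc) // orbT.
    exists (Ordinal cM'); rewrite !inE /= gc; first by rewrite eqxx /= prednK // leqnn orbT.
    by rewrite qt qx x_take eqxx /= -leqNgt last_arc_le.
  (* No arc [j] of the current vertex satisfies [c' <= j < c.-1], and arc [c.-1] itself leads to
     [y]. *)
  have closed' q' : take h q' = take h q -> nth 0 q' h.-1 = x -> {subset q <= q'} -> y \in q' ->
      forall j, j < M -> gt j \in take h q' -> gh j \in q' \/ gt j = nth 0 q' h.-1 /\ j < c'.
    move=> qt qx sub yq j jM; rewrite qt qx => /(closed j jM)[/sub|[gj jc]]; first by left.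
    have [jc'|jc'] := ltnP j c'; first by right.
    have [jc1|] := ltnP j c.-1; first by have := last_arc_none jc' jc1; rewrite gj eqxx.
    by rewrite -ltnS prednK // => cj; left; rewrite (_ : j = c.-1) //; lia.
  have c'_pos q' : nth 0 q' h.-1 = x -> c' <= M /\ (0 < c' -> 0 < h /\ gt c'.-1 = nth 0 q' h.-1).
    by move=> ->; split; [lia | move=> c'0; split=> //; apply: last_arc_tail].
  case: (boolP (y \in q)) => yq /=.
    exists (N - h + #|unscanned q h c'|); first by rewrite ltn_add2l scan_lt.
    rewrite /upd /=; split=> //; split=> //; split=> //; exists q.
    by split=> //; split=> //; [apply: c'_pos | apply: closed'].
  have rt : take h (rcons q y) = take h q by rewrite -cats1 takel_cat.
  have rx : nth 0 (rcons q y) h.-1 = x by rewrite nth_rcons hq'.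
  exists (N - h + #|unscanned (rcons q y) h c'|); first by rewrite ltn_add2l scan_lt.
  rewrite /upd /= Esz; split=> //; split=> //; split=> //; exists (rcons q y); rewrite size_rcons.
  split.
  - by rewrite rcons_uniq yq uq all_rcons /= ghN.
  - by rewrite nth_rcons q0.
  - move=> k /andP[k0]; rewrite ltnS leq_eqVlt nth_rcons => /predU1P[kq|kq].
      by exists h.-1, c.-1; rewrite rx kq ltnn eqxx.
    have [|k' [j [k'k jM tj hj]]] := q_pred k; first by rewrite k0.
    by exists k', j; rewrite kq nth_rcons (ltn_trans k'k kq).
  - split=> [|k|v vN].
    + by rewrite addn1.
    + rewrite ltnS leq_eqVlt nth_rcons; case: (eqVneq k (size q)) => [->|kne] /=;
      first by rewrite ltnn.
      by move=> kq; rewrite kq Eq.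
    + by rewrite mem_rcons inE; case: eqP => //= _; rewrite Eseen.
  - split=> //; [exact: leqW | exact: c'_pos | apply: closed' => //;
    last by rewrite mem_rcons mem_head].
    by move=> z zq; rewrite mem_rcons inE zq orbT.
rewrite -ltnNge Esz => hlt.
have xN : nth 0 q h < N by have /allP/(_ _ (mem_nth 0 hlt)) := qN.
have x_notin : nth 0 q h \notin take h q.
  by have := uq; rewrite -{1}(cat_take_drop h q) (drop_nth 0 hlt) cat_uniq => /and3P[_ /hasPn/(_
    _ (mem_head _ _))].
have take_S : take h.+1 q = rcons (take h q) (nth 0 q h) by apply: take_nth.
rewrite /upd /= addn1 Eq // Efst //; set x := nth 0 q h in xN x_notin take_S *.
have hN : h < N by apply: leq_trans hlt (size_order uq qN).
(* Dequeuing [x] creates no pending arc, since the arcs of [x] were pending already. So the second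
   summand does not grow while the first one drops. *)
exists (N - h.+1 + #|unscanned q h.+1 (last_arc x M)|).
  have : #|unscanned q h.+1 (last_arc x M)| <= #|unscanned q h c|.
    apply/subset_leq_card/subsetP=> j; rewrite !inE take_S mem_rcons inE negb_or.
    by case/orP=> [/andP[_ ->] //|/andP[/eqP -> _]]; rewrite x_notin.
  by rewrite c0; move: #|_| #|_|; lia.
split=> //; split=> //; split=> //; exists q; split=> //; split=> //.
  by split; [apply: last_arc_le | move=> l0; split=> //; apply: last_arc_tail].
move=> j jM; rewrite take_S mem_rcons inE => /predU1P[gj|gj].
  by right; split=> //; rewrite ltnNge; apply/negP=> lj; have := last_arc_none lj jM;
    rewrite gj eqxx.
by left; have [//|[_]] := closed j jM gj; rewrite c0.
Qed.

Lemma bfs_linear st X :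
    nreg st v_gn = N -> nreg st v_gm = M -> nreg st v_root = r ->
    (forall j, j < M -> narr st a_gtail j = gt j /\ narr st a_ghead j = gh j) ->
    N + M < X ->
  linear_time F MF bfs st X (fun st' => exists q,
    [/\ bfs_order q, nreg st' v_size = size q,
        forall k, k < size q -> narr st' a_queue k = nth 0 q k
      & forall v, v < N -> narr st' a_seen v = (v \in q)]).
Proof.
move=> EN EM Er Earc NMX.
have X0 : 0 < X by lia.
apply: (@linear_then _ _ _ _ _ _ _ (fun st1 => exists2 mu, mu < X & bfs_inv mu st1)).
  apply: (@linear_for_then _ _ _ (fun k st1 => forall v, v < k -> narr st1 a_first v = 0 /\ narr
    st1 a_seen v = 0)
            _ _ _ N) => //; first lia.
    move=> k st1 kN _ Ei IH v; rewrite ltnS leq_eqVlt /= /upd /= Ei.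
    by case: (eqVneq v k) => //= _; apply: IH.
  move=> st1 [fr1 fr1a _ _] Inv1.
  have E1 j : j < M -> narr st1 a_gtail j = gt j /\ narr st1 a_ghead j = gh j.
    by move=> jM; rewrite !fr1a //; apply: Earc.
  apply: (@linear_for_then _ _ _ (fun k st2 => (forall v, v < N -> narr st2 a_first v = last_arc
    v k) /\
            (forall j, j < k -> narr st2 a_next j = last_arc (gt j) j)) _ _ _ M) => //;
              rewrite ?fr1 //.
  - lia.
  - by split=> // v vN /=; case: (Inv1 v vN).
  - move=> k st2 kM [_ fr2a _ _] Ei [IH1 IH2] /=; rewrite /upd /= Ei.
    have [Egt _] := E1 k kM; rewrite fr2a // Egt; have [gN _] := arcs_in kM.
    split=> [v vN|j]; first by rewrite eq_sym addn1; case: eqP => // _; apply: IH1.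
    rewrite ltnS leq_eqVlt; case: (eqVneq j k) => [-> _|_ /IH2 //]; exact: IH1.
  move=> st2 [fr2 fr2a _ _] [Inv2 Inv2'].
  apply: linear_straight => //=; exists (N + #|unscanned [:: r] 0 0|).
    by apply: leq_ltn_trans NMX; rewrite leq_add2l -[leqRHS]card_ord max_card.
  have Er2 : nreg st2 v_root = r by rewrite fr2 // fr1.
  rewrite /bfs_inv /= /upd /= Er2; split.
    by move=> j jM; rewrite !fr2a //; apply: E1.
  split=> //; split=> //; exists [:: r].
  split=> //=; rewrite ?r_in ?andbT //.
  - by case=> [|[]].
  - split=> // [|v vN]; first by case.
    by rewrite inE; case: eqP => //= _; rewrite fr2a //; case: (Inv1 v vN).
  - by split=> //; rewrite subn0.
move=> st1 [mu muX Inv_mu] _.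
apply: linear_weaken (@linear_while _ _ _ bfs_inv _ _ _ _ X _ muX Inv_mu _) => //;
  last exact: bfs_stepP.
move=> st' [[mu' [_ [_ [_ [q [uq q0 q_pred [Esz Eq Eseen] [hq _ closed _]]]]]]]].
rewrite [beval _ _]/= negbK -eqn0Ngt => /andP[/eqP c0].
rewrite Esz => qh; exists q; split=> //; split=> // j jM gj.
have := closed j jM; rewrite c0 take_oversize //; last by lia.
Qed.

End BreadthFirstSearch.

(** * Finding the centroids of a level *)

Notation v_rem := 13 (only parsing).
Notation v_have := 14 (only parsing).
Notation v_better := 15 (only parsing).
Notation v_best := 16 (only parsing).
Notation a_order := 13 (only parsing).
Notation a_par := 14 (only parsing).
Notation a_left := 15 (only parsing).
Notation a_size := 16 (only parsing).
Notation a_top := 17 (only parsing).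
Notation a_cen := 18 (only parsing).

Definition Par (e : nexp) := NLoad a_par e.
Definition Left (e : nexp) := Pos (NLoad a_left e).
Definition Top (e : nexp) := NLoad a_top e.
Definition EqN (e1 e2 : nexp) := BAnd (BLe e1 e2) (BLe e2 e1).

(** All parts are treated together. The size stored at a top is that of its whole part, and later
    heavy vertices overwrite earlier ones in [a_cen]. *)
Definition find_centroids : cmd :=
  Then (For v_i r_n (NStore a_size (NReg v_i) (NConst 1)))
  (Then (For v_i r_n
          (Then (NSet v_x (NLoad a_order (NSub (Decr (NReg r_n)) (NReg v_i))))
                (If (BAnd (Left (NReg v_x)) (Left (Par (NReg v_x))))
                   (NStore a_size (Par (NReg v_x))
                      (NAdd (NLoad a_size (Par (NReg v_x))) (NLoad a_size (NReg v_x))))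
                   Skip)))
        (For v_i r_n
          (Then (NSet v_x (NLoad a_order (NReg v_i)))
                (If (Left (NReg v_x))
                   (Then (If (Left (Par (NReg v_x)))
                            (NStore a_top (NReg v_x) (Top (Par (NReg v_x))))
                            (NStore a_top (NReg v_x) (NReg v_x)))
                         (If (BLe (Incr (NLoad a_size (Top (NReg v_x))))
                                  (NAdd (NLoad a_size (NReg v_x)) (NLoad a_size (NReg v_x))))
                            (NStore a_cen (Top (NReg v_x)) (NReg v_x))
                            Skip))
                   Skip)))).

Section CentroidSearch.
Variables (R : realDomainType) (F : nat -> nat -> nat) (MF : oracle R).
Variables (n : nat) (s : 'I_n) (T : {set 'I_n * 'I_n}) (par : 'I_n -> 'I_n).
Variables (depth : 'I_n -> nat) (order pos : 'I_n -> 'I_n) (A : {set 'I_n}).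
Hypothesis T_par : forall x y, ((x, y) \in T) = (y != s) && (x == par y).
Hypothesis depth_par : forall v, v != s -> depth v = (depth (par v)).+1.
Hypotheses (orderK : cancel order pos) (posK : cancel pos order).
Hypothesis pos_par : forall v, v != s -> pos (par v) < pos v.
Hypothesis sA : s \notin A.

Definition tree_state (st : state R) : Prop :=
  [/\ nreg st r_n = n, forall v : 'I_n, narr st a_par v = par v
    & forall k : 'I_n, narr st a_order k = order k].

Definition left_state (st : state R) : Prop := forall v : 'I_n, narr st a_left v = (v \in A).

Let sub v := #|subtree par A v|.

Let child_pos c v : c \in A -> par c == v -> pos v < pos c.
Proof. by move=> cA /eqP <-; apply: pos_par; apply: contraTneq cA => ->. Qed.

Let pos_order k (kn : k < n) v : (pos v == k :> nat) = (v == order (Ordinal kn)).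
Proof.
apply/eqP/eqP=> [vk|->]; last by rewrite orderK.
by rewrite -[v]posK; congr order; apply: val_inj.
Qed.

(** The condition on [pos c] selects the children already added: the reverse scan has covered the
    last [k] positions. *)
Let sizes_inv k (st : state R) : Prop := forall v : 'I_n, v \in A ->
  narr st a_size v = (\sum_(c in A | (par c == v) && (n - k <= pos c)) sub c).+1.

Let heavy c := #|component T A c| < 2 * sub c.

(** A top is itself heavy, so [w] exists as soon as the top has been scanned, and a value left in
    [a_cen] by an earlier level is overwritten. *)
Let tops_inv k (st : state R) : Prop :=
  (forall v : 'I_n, v \in A -> pos v < k -> narr st a_top v = top par A v) /\
  (forall t : 'I_n, t \in A -> top par A t = t -> pos t < k -> exists w,
     [/\ w \in A, top par A w = t, heavy w,
         forall c, c \in A -> top par A c = t -> pos c < k -> heavy c -> pos c <= pos w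
       & narr st a_cen t = w]).

Lemma sizes_step k st (kn : k < n) :
  tree_state st -> left_state st -> nreg st v_i = k -> sizes_inv k st ->
  sizes_inv k.+1 (set_nreg (straight
          (Then (NSet v_x (NLoad a_order (NSub (Decr (NReg r_n)) (NReg v_i))))
                (If (BAnd (Left (NReg v_x)) (Left (Par (NReg v_x))))
                   (NStore a_size (Par (NReg v_x))
                      (NAdd (NLoad a_size (Par (NReg v_x))) (NLoad a_size (NReg v_x))))
                   Skip)) st) v_i k.+1).
Proof.
move=> [En Epar Eord] Eleft Ei IH v vA /=; rewrite /upd /= Ei En.
have k'n : n - 1 - k < n by lia.
rewrite (Eord (Ordinal k'n)); set x := order _; rewrite Epar !Eleft !lt0b.
have posx : pos x = n - 1 - k :> nat by rewrite orderK.
have -> : \sum_(c in A | (par c == v) && (n - k.+1 <= pos c)) sub c =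
    \sum_(c in A | (par c == v) && (n - k <= pos c)) sub c + (if (x \in A) && (par x == v) then
      sub x else 0).
  case: ifPn => [/andP[xA px]|xnot].
    rewrite (bigD1 x) /=; last by rewrite xA px posx; lia.
    rewrite addnC; congr (_ + _); apply: eq_bigl => c; rewrite -!andbA; do 2!congr (_ && _).
    have -> : (c != x) = (pos c != n - 1 - k :> nat) by rewrite (pos_order k'n).
    lia.
  rewrite addn0; apply: eq_bigl => c; case: (boolP (c \in A)) => //= cA.
  case: (boolP (par c == v)) => //= pc.
  have : (c != x) by apply: contraNneq xnot => <-; rewrite cA pc.
  by rewrite -(pos_order k'n); lia.
(* All children of [x] come after it in the order, so its size is final when it is added to that of
   its parent. *)
have sizex : x \in A -> narr st a_size x = sub x.
  move=> xA; rewrite IH // /sub (card_subtree depth_par sA xA); congr _.+1.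
  apply: eq_bigl => c; case: (boolP (c \in A)) => //= cA.
  case: (boolP (par c == x)) => //= pc.
  by have := child_pos cA pc; rewrite posx; lia.
have [xA|xA] := boolP (x \in A); last by rewrite /= addn0 IH.
have [px|px] := boolP (par x \in A); rewrite /= /upd /= /upd /=; last first.
  by case: eqP => [pv|_]; [rewrite pv vA in px | rewrite addn0 IH].
have -> : (par x == v) = (v == par x :> nat) by rewrite eq_sym.
case: eqP => [/val_inj pv|_]; last by rewrite addn0 IH.
by rewrite -pv IH // sizex // addSn.
Qed.

Lemma tops_step k st (kn : k < n) :
  tree_state st -> left_state st -> (forall v : 'I_n, v \in A -> narr st a_size v = sub v) ->
  nreg st v_i = k -> tops_inv k st ->
  tops_inv k.+1 (set_nreg (straight
          (Then (NSet v_x (NLoad a_order (NReg v_i)))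
                (If (Left (NReg v_x))
                   (Then (If (Left (Par (NReg v_x)))
                            (NStore a_top (NReg v_x) (Top (Par (NReg v_x))))
                            (NStore a_top (NReg v_x) (NReg v_x)))
                         (If (BLe (Incr (NLoad a_size (Top (NReg v_x))))
                                  (NAdd (NLoad a_size (NReg v_x)) (NLoad a_size (NReg v_x))))
                            (NStore a_cen (Top (NReg v_x)) (NReg v_x))
                            Skip))
                   Skip)) st) v_i k.+1).
Proof.
move=> [En Epar Eord] Eleft Esize Ei [IHtop IHcen].
rewrite /= /upd /= Ei (Eord (Ordinal kn)); set x := order _; rewrite Epar !Eleft !lt0b.
have ltS v : (pos v < k.+1) = (pos v < k) || (v == x).
  by rewrite ltnS leq_eqVlt (pos_order kn) orbC.
have [xA|xA] := boolP (x \in A); last first.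
  rewrite /tops_inv /=; split=> [v vA|t tA tt]; rewrite ltS.
    by case: eqP => [vx|_]; [rewrite -vx vA in xA | rewrite orbF; apply: IHtop].
  case: eqP => [tx|_]; [by rewrite -tx tA in xA | rewrite orbF => /(IHcen t tA tt)].
  move=> [w [wA wt wh w_max Ew]]; exists w; split=> // c cA ct; rewrite ltS.
  by case: eqP => [cx|_]; [rewrite -cx cA in xA | rewrite orbF; apply: w_max].
set st1 := if par x \in A then _ else _.
have Etop1 j : narr st1 a_top j = if j == x :> nat then top par A x : nat else narr st a_top j.
  rewrite (top_par depth_par sA xA) /st1; case: ifP => pA; rewrite /= /upd /= /upd /=;
    case: eqP => // _.
  rewrite IHtop //; have := child_pos xA (eqxx _).
  by rewrite {2}/x orderK /=.
have E1 a : a != a_top -> narr st1 a = narr st a by rewrite /st1; case: ifP => _ /negPf at_ /=;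
  rewrite /upd at_.
have Ex1 : nreg st1 v_x = x by rewrite /st1; case: ifP.
rewrite Ex1 Etop1 eqxx !E1 //; set t0 := top par A x.
have t0A : t0 \in A by apply: (top_in depth_par sA xA).
have t0t0 : top par A t0 = t0 by apply: (top_idem depth_par sA xA).
rewrite !Esize // addn1 addnn -mul2n.
have -> : (sub t0 < 2 * sub x) = heavy x by rewrite /heavy -(subtree_top T_par depth_par sA xA).
have heavy_t0 : heavy t0.
  rewrite /heavy -(subtree_top T_par depth_par sA t0A) t0t0 -/(sub t0).
  have : 0 < sub t0 by rewrite card_gt0; apply/set0Pn; exists t0; apply: subtree_self.
  by move: (sub t0) => z; lia.
split=> [v vA|t tA tt]; rewrite ltS.
  have -> : narr (set_nreg (if heavy x then set_narr st1 a_cen t0 x else st1) v_i k.+1) a_top v =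
            narr st1 a_top v by case: ifP.
  rewrite Etop1 val_eqE; case: eqP => [-> //|_]; rewrite orbF; exact: IHtop.
have Ecen : narr (set_nreg (if heavy x then set_narr st1 a_cen t0 x else st1) v_i k.+1) a_cen t =
    if heavy x && (t == t0) then x : nat else narr st a_cen t.
  by case: ifP => hx /=; rewrite /upd /= ?E1 // /upd val_eqE; case: eqP.
rewrite Ecen; case: (boolP (heavy x)) => hx /=; last first.
  have [tx|_] := eqVneq t x; last rewrite orbF.
    by move: heavy_t0; rewrite /t0 -tx tt tx (negPf hx).
  move/(IHcen t tA tt) => [w [wA wt wh w_max Ew]]; exists w; split=> // c cA ct; rewrite ltS.
  by case: eqP => [->|_]; [rewrite (negPf hx) | rewrite orbF; apply: w_max].
case: (eqVneq t t0) => [->|tt0].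
  move=> _; exists x; split=> // c cA _; rewrite ltS => /orP[ck _|/eqP -> //].
  by rewrite /x orderK ltnW.
have [tx|_] := eqVneq t x; first by rewrite /t0 -tx tt eqxx in tt0.
rewrite orbF => /(IHcen t tA tt)[w [wA wt wh w_max Ew]]; exists w; split=> // c cA ct; rewrite ltS.
by case: eqP => [cx|_]; [rewrite -ct cx eqxx in tt0 | rewrite orbF; apply: w_max].
Qed.

Lemma find_centroids_linear st X :
    tree_state st -> left_state st -> n < X ->
  linear_time F MF find_centroids st X (fun st' =>
    (forall v : 'I_n, v \in A -> narr st' a_top v = top par A v) /\
    (forall v : 'I_n, v \in A -> top par A v = v ->
       narr st' a_cen v = centroid_of s par (component T A v))).
Proof.
move=> tree_st left_st nX; have [En Epar Eord] := tree_st.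
have tree_frame st1 st2 L : frame L st1 st2 -> tree_state st1 ->
    all (fun x => x \notin L) [:: (0, r_n); (1, a_par); (1, a_order)] -> tree_state st2.
  move=> [f0 f1 _ _] [h1 h2 h3] /and4P[n1 n2 n3 _].
  by split; rewrite ?f0 ?f1.
have left_frame st1 st2 L : frame L st1 st2 -> left_state st1 -> (1, a_left) \notin L ->
  left_state st2.
  by move=> [_ f1 _ _] h aL v; rewrite f1.
apply: (@linear_for_then _ _ _ (fun k st1 => forall v, v < k -> narr st1 a_size v = 1) _ _ _ n)
  => //.
  move=> k st1 kn _ Ei IH v; rewrite ltnS leq_eqVlt /= /upd /= Ei.
  by case: (eqVneq v k) => //= _; apply: IH.
move=> st1 fr1 sizes1.
have tree1 := tree_frame _ _ _ fr1 tree_st isT; have left1 := left_frame _ _ _ fr1 left_st isT.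
apply: (@linear_for_then _ _ _ sizes_inv _ _ _ n) => //; first by case: tree1.
- move=> v vA /=; rewrite sizes1 ?ltn_ord // big1 // => c /andP[_ /andP[_]].
  by rewrite subn0 leqNgt ltn_ord.
- move=> k st2 kn fr2 Ei IH; apply: sizes_step => //; first exact: tree_frame fr2 tree1 isT.
  exact: left_frame fr2 left1 isT.
move=> st2 fr2 sizes2.
have tree2 := tree_frame _ _ _ fr2 tree1 isT; have left2 := left_frame _ _ _ fr2 left1 isT.
have Esize v : v \in A -> narr st2 a_size v = sub v.
  move=> vA; rewrite sizes2 // /sub (card_subtree depth_par sA vA); congr _.+1.
  by apply: eq_bigl => c; rewrite subnn leq0n andbT.
apply: (@linear_for_end _ _ _ tops_inv _ _ _ n) => //; first by case: tree2.
- move=> k st3 kn fr3 Ei IH; apply: tops_step => //; first exact: tree_frame fr3 tree2 isT.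
    exact: left_frame fr3 left2 isT.
  by case: fr3 => _ f1 _ _ v vA; rewrite f1 // Esize.
move=> st3 _ [IHtop IHcen]; split=> [v vA|v vA vv]; first exact: IHtop.
have [|w [wA wt wh w_max ->]] := IHcen v vA vv; first exact: ltn_ord.
have UA : component T A v \in components T A by apply: component_in.
have wU : w \in component T A v by rewrite (component_top T_par depth_par sA vA) inE wA wt vv eqxx.
have subE c : c \in component T A v -> subtree par (component T A v) c = subtree par A c.
  exact: (subtree_component T_par depth_par sA UA).
have compE c : c \in component T A v -> component T A c = component T A v.
  by move=> cU; rewrite -(component_eq UA cU).
rewrite (centroid_of_unique T_par depth_par sA UA (v := w)) // /heavy_centroid wU subE //.
have wh' : #|component T A v| < 2 * #|subtree par A w| by rewrite -(compE w wU).
rewrite wh' /=; apply/forall_inP=> c cU; apply/implyP=> pc; rewrite subE //.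
have := cU; rewrite {1}(component_top T_par depth_par sA vA) inE => /andP[cA /eqP ct].
(* A heavy child would come after [w] in the order, against the choice of [w]. *)
rewrite leqNgt; apply/negP; rewrite -(compE c cU) => ch.
have := w_max c cA; rewrite ct vv ltn_ord => /(_ erefl isT ch).
by rewrite leqNgt (child_pos cA pc).
Qed.

End CentroidSearch.

(** * The flow instance of a level *)

Section FlowIsomorphism.
Local Open Scope ring_scope.
Variables (R : realDomainType) (V1 A1 V2 A2 : finType).
Variables (N1 : network R V1 A1) (N2 : network R V2 A2) (hV : V1 -> V2) (hA : A1 -> A2).
Hypothesis hV_bij : bijective hV.
Hypothesis hA_inj : {in arcs N1 &, injective hA}.
Hypothesis hA_im : hA @: arcs N1 = arcs N2.
Hypothesis h_ends : hV (source N1) = source N2 /\ hV (sink N1) = sink N2.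
Hypothesis h_arcs : forall a, a \in arcs N1 ->
  [/\ tail N2 (hA a) = hV (tail N1 a), head N2 (hA a) = hV (head N1 a) & cap N2 (hA a) = cap N1 a].

Lemma iso_outflow g v : outflow N2 g (hV v) = outflow N1 (g \o hA) v.
Proof.
rewrite /outflow -hA_im big_imset_cond //=; apply: eq_bigl => a.
by case aN: (a \in arcs N1) => //=; case: (h_arcs aN) => -> _ _; rewrite (inj_eq (bij_inj hV_bij)).
Qed.

Lemma iso_inflow g v : inflow N2 g (hV v) = inflow N1 (g \o hA) v.
Proof.
rewrite /inflow -hA_im big_imset_cond //=; apply: eq_bigl => a.
by case aN: (a \in arcs N1) => //=; case: (h_arcs aN) => _ -> _; rewrite (inj_eq (bij_inj hV_bij)).
Qed.

Lemma iso_flow g : is_flow N2 g <-> is_flow N1 (g \o hA).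
Proof.
have [hs ht] := h_ends; split=> [[g_cap g_cons]|[g_cap g_cons]]; split.
- move=> a aN; have [_ _ <-] := h_arcs aN; apply: g_cap.
  by rewrite -hA_im imset_f.
- move=> v vs vt; rewrite -iso_inflow -iso_outflow; apply: g_cons.
    by rewrite -hs (inj_eq (bij_inj hV_bij)).
  by rewrite -ht (inj_eq (bij_inj hV_bij)).
- move=> b; rewrite -hA_im => /imsetP[a aN ->]; have [_ _ ->] := h_arcs aN; exact: g_cap.
- have [hV' hVK hV'K] := hV_bij.
  move=> v; rewrite -(hV'K v) -hs -ht !(inj_eq (bij_inj hV_bij)) iso_inflow iso_outflow.
  exact: g_cons.
Qed.

Lemma iso_flow_value g : flow_value N2 g = flow_value N1 (g \o hA).
Proof. by have [hs _] := h_ends; rewrite /flow_value -hs iso_outflow iso_inflow. Qed.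

Lemma eq_is_flow (f g : A1 -> R) : {in arcs N1, f =1 g} -> is_flow N1 f -> is_flow N1 g.
Proof.
move=> fg [f_cap f_cons]; split=> [a aN|v vs vt]; first by rewrite -fg //; apply: f_cap.
have := f_cons v vs vt; rewrite /inflow /outflow.
rewrite (eq_bigr g) => [|a /andP[aN _]]; last exact: fg.
by move=> ->; apply: eq_bigr => a /andP[aN _]; apply: fg.
Qed.

Lemma eq_flow_value (f g : A1 -> R) : {in arcs N1, f =1 g} -> flow_value N1 f = flow_value N1 g.
Proof.
move=> fg; rewrite /flow_value /outflow /inflow.
by congr (_ - _); apply: eq_bigr => a /andP[aN _]; apply: fg.
Qed.

(** Every flow of the second network pulls back along [hA] with the same value. *)
Lemma iso_max_flow (f1 : A1 -> R) (f2 : A2 -> R) :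
  {in arcs N1, forall a, f2 (hA a) = f1 a} -> is_max_flow N1 f1 -> is_max_flow N2 f2.
Proof.
move=> f12 [f_flow f_max]; split.
  by apply/iso_flow; apply: eq_is_flow f_flow => a aN /=; rewrite f12.
move=> g /iso_flow /f_max; rewrite !iso_flow_value.
by rewrite (@eq_flow_value (f2 \o hA) f1).
Qed.

End FlowIsomorphism.

(** * Numbering the vertices and arcs of a level network *)

Section LevelInstance.
Variables (R : realDomainType) (n : nat) (G : digraph R 'I_n) (s : 'I_n) (T : {set 'I_n * 'I_n}).
Variables (par : 'I_n -> 'I_n) (depth : 'I_n -> nat) (es : seq ('I_n * 'I_n)) (A : {set 'I_n}).
Hypothesis T_par : forall x y, ((x, y) \in T) = (y != s) && (x == par y).
Hypothesis depth_par : forall v, v != s -> depth v = (depth (par v)).+1.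
Hypothesis es_perm : perm_eq es (enum (edges G)).
Hypothesis sA : s \notin A.

Local Notation cen := (centroid_of s par).
Local Notation P := (components T A).

Definition level_tops : seq 'I_n := [seq v <- enum 'I_n | (v \in A) && (top par A v == v)].
Definition level_centroids : seq 'I_n := [seq cen (component T A v) | v <- level_tops].

(** Edges come first and sink arcs start at number [size es], so the program tells them apart by a
    comparison with [r_m]. *)
Definition level_arc (j : nat) : ('I_n * 'I_n) + 'I_n :=
  if j < size es then inl (nth (s, s) es j) else inr (nth s level_centroids (j - size es)).

Definition vertex_index (v : option 'I_n) : 'I_n.+1 :=
  if v is Some v then widen_ord (leqnSn n) v else ord_max.

Definition index_vertex (k : 'I_n.+1) : option 'I_n := insub (val k).

Definition level_size := size es + size level_centroids.

Local Notation N := (level_network G s P (cen @: P)).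

Definition level_instance : instance R :=
  @Instance R n.+1 level_size
    {| arcs := setT;
       tail := [ffun j : 'I_level_size => vertex_index (tail N (level_arc j))];
       head := [ffun j : 'I_level_size => vertex_index (head N (level_arc j))];
       cap := [ffun j : 'I_level_size => cap N (level_arc j)];
       source := vertex_index (Some s);
       sink := vertex_index None |}.

(** Carries a flow on numbered arcs back to the abstract labels; it is 0 on labels that are not
    arcs. *)
Definition level_flow (f : 'I_level_size -> R) (a : ('I_n * 'I_n) + 'I_n) : R :=
  if [pick j : 'I_level_size | level_arc j == a] is Some j then f j else 0%R.

Lemma vertex_indexK : cancel vertex_index index_vertex.
Proof.
case=> [v|]; rewrite /index_vertex /=; first by rewrite valK.
by rewrite insubN // ltnn.
Qed.

Lemma index_vertexK : cancel index_vertex vertex_index.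
Proof.
move=> k; rewrite /index_vertex; case: insubP => [v vn vk|kn]; apply: val_inj => /=;
  first exact: vk.
by have := ltn_ord k; rewrite -leqNgt in kn => kS; apply/eqP; rewrite eqn_leq kn -ltnS.
Qed.

Lemma mem_es e : (e \in es) = (e \in edges G).
Proof. by rewrite (perm_mem es_perm) mem_enum. Qed.

Lemma uniq_es : uniq es.
Proof. by rewrite (perm_uniq es_perm) enum_uniq. Qed.

Lemma mem_level_tops v : (v \in level_tops) = (v \in A) && (top par A v == v).
Proof. by rewrite mem_filter mem_enum andbT. Qed.

Lemma centroid_in U : U \in P -> cen U \in U.
Proof. by move=> UP; have /and3P[] := centroid_ofP T_par depth_par sA UP. Qed.

Lemma mem_level_centroids u : (u \in level_centroids) = (u \in cen @: P).
Proof.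
apply/mapP/imsetP=> [[v]|[U UP ->]].
  by rewrite mem_level_tops => /andP[vA _] ->; exists (component T A v) => //; apply: component_in.
case/componentsP: UP => x xA ->; exists (top par A x).
  by rewrite mem_level_tops (top_in depth_par sA xA) (top_idem depth_par sA xA) eqxx.
congr (cen _); apply: component_eq; first exact: component_in.
by rewrite (component_top T_par depth_par sA xA) inE (top_in depth_par sA xA) (top_idem depth_par
  sA xA) /=.
Qed.

Lemma uniq_level_centroids : uniq level_centroids.
Proof.
rewrite map_inj_in_uniq; first exact/filter_uniq/enum_uniq.
move=> v w.
rewrite !mem_level_tops => /andP[vA /eqP vv] /andP[wA /eqP ww] vw.
have vP := component_in T vA; have wP := component_in T wA.
have cv := centroid_in vP; have cw := centroid_in wP; rewrite -vw in cw.
have := components_disjoint vP wP cv cw => /setP/(_ v).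
rewrite mem_component // (component_top T_par depth_par sA wA) inE vA vv ww.
by move=> /esym/eqP.
Qed.

Lemma level_arc_inj : {in gtn level_size &, injective level_arc}.
Proof.
rewrite /level_size => j k; rewrite !inE /level_arc => jM kM.
case: ltnP => js; case: ltnP => ks // [].
  by move/eqP; rewrite nth_uniq ?uniq_es // => /eqP.
move/eqP; rewrite nth_uniq ?uniq_level_centroids ?ltn_subLR // => /eqP jk.
by rewrite -(subnK js) jk subnK.
Qed.

Lemma level_arcP a : reflect (exists2 j, j < level_size & level_arc j = a) (a \in arcs N).
Proof.
apply: (iffP idP) => [|[j jM <-]].
  case: a => [e|u].
    rewrite mem_level_arcs_inl -mem_es => e_es; exists (index e es).
      by rewrite /level_size ltn_addr // index_mem.
    by rewrite /level_arc index_mem e_es nth_index.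
  rewrite mem_level_arcs_inr -mem_level_centroids => u_c;
    exists (size es + index u level_centroids).
    by rewrite ltn_add2l index_mem.
  by rewrite /level_arc ltnNge leq_addr /= addKn nth_index.
rewrite /level_arc; case: ltnP => js.
  by rewrite mem_level_arcs_inl -mem_es mem_nth.
rewrite mem_level_arcs_inr -mem_level_centroids mem_nth //.
by rewrite ltn_subLR.
Qed.

Lemma level_flowE f (j : 'I_level_size) : level_flow f (level_arc j) = f j.
Proof.
rewrite /level_flow; case: pickP => [k /eqP kj|/(_ j)]; last by rewrite eqxx.
by congr f; apply/val_inj/level_arc_inj; rewrite ?inE ?ltn_ord.
Qed.

Lemma level_instance_iso f :
  flow_iso (inst_net level_instance) f N (level_flow f).
Proof.
exists index_vertex, (fun j => level_arc (val j)); split.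
- by exists vertex_index; [apply: index_vertexK | apply: vertex_indexK].
- by move=> j k _ _ jk; apply/val_inj/level_arc_inj; rewrite ?inE ?ltn_ord.
- apply/setP=> a; apply/imsetP/level_arcP=> [[j _ ->]|[j jM <-]].
    by exists j => //; apply: ltn_ord.
  by exists (Ordinal jM).
- by split; [apply: (vertex_indexK (Some s)) | apply: (vertex_indexK None)].
- by move=> j _; rewrite !ffunE !vertex_indexK level_flowE.
Qed.

Lemma level_flow_max f :
  is_max_flow (inst_net level_instance) f -> is_max_flow N (level_flow f).
Proof.
apply: (@iso_max_flow _ _ _ _ _ _ _ index_vertex (fun j : 'I_level_size => level_arc j)).
- by exists vertex_index; [apply: index_vertexK | apply: vertex_indexK].
- by move=> j k _ _ jk; apply/val_inj/level_arc_inj; rewrite ?inE ?ltn_ord.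
- apply/setP=> a; apply/imsetP/level_arcP=> [[j _ ->]|[j jM <-]].
    by exists j => //; apply: ltn_ord.
  by exists (Ordinal jM).
- by split; [apply: (vertex_indexK (Some s)) | apply: (vertex_indexK None)].
- by move=> j _; rewrite !ffunE !vertex_indexK.
- by move=> j _; apply: level_flowE.
Qed.

Lemma level_instance_admissible k :
  poly_bounded k G -> admissible k (inst_net level_instance).
Proof.
have sink_neq : vertex_index None != vertex_index (Some s) by rewrite (can_eq vertex_indexK).
move=> G_bnd; split.
- by rewrite eq_sym; apply: sink_neq.
- move=> j c _; rewrite ffunE /level_arc; case: ltnP => js; rewrite ffunE // => -[<-].
  have := G_bnd (nth (s, s) es j); rewrite -mem_es mem_nth // => /(_ isT)/andP[-> le_k] /=.
  (* The instance has one vertex more than [G], so the polynomial bound can only grow. *)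
  by apply: le_trans le_k _; rewrite !card_ord lerXn2r ?nnegrE ?ler0n ?ler_nat.
(* The root alone is the source side of a cut without infinite arcs: sink arcs start at centroids,
   which lie in [A]. *)
- exists [set vertex_index (Some s)]; split; [by rewrite inE | by rewrite inE; apply: sink_neq |].
  move=> j _; rewrite inE !ffunE /level_arc; case: ltnP => js //=.
  rewrite -[X in _ == X]/(vertex_index (Some s)) -[X in X == _]/(vertex_index (Some _)).
  rewrite (can_eq vertex_indexK) => /eqP[us].
  have : s \in level_centroids.
    by rewrite -us mem_nth // ltn_subLR ?ltn_ord.
  rewrite mem_level_centroids => /imsetP[U UP sU].
  by have := subsetP (components_sub UP) _ (centroid_in UP); rewrite -sU (negPf sA).
Qed.

Lemma level_size_bound : size level_centroids <= #|A|.
Proof.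
rewrite -(card_uniqP uniq_level_centroids); apply/subset_leq_card/subsetP=> u.
rewrite mem_level_centroids => /imsetP[U UP ->].
exact: (subsetP (components_sub UP) _ (centroid_in UP)).
Qed.

End LevelInstance.

Definition copy_arc : cmd :=
  Then (NSet v_x (NLoad a_tail (NReg v_i)))
  (Then (NSet v_y (NLoad a_head (NReg v_i)))
  (Then (NStore a_fhead (NReg v_i) (NReg v_y))
  (Then (NStore a_finf (NReg v_i) (NConst 0))
  (Then (WStore w_fcap (NReg v_i) (WLoad w_weight (NReg v_i)))
        (If (BAnd (BAnd (Left (NReg v_x)) (Left (NReg v_y)))
                  (EqN (Top (NReg v_x)) (Top (NReg v_y))))
           (NStore a_ftail (NReg v_i) (NReg v_x))
           (NStore a_ftail (NReg v_i) (NReg r_s))))))).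

Definition add_sink_arc : cmd :=
  If (BAnd (Left (NReg v_i)) (EqN (Top (NReg v_i)) (NReg v_i)))
    (Then (NStore a_ftail (NReg r_fm) (NLoad a_cen (NReg v_i)))
    (Then (NStore a_fhead (NReg r_fm) (NReg r_n))
    (Then (NStore a_finf (NReg r_fm) (NConst 1))
          (NSet r_fm (Incr (NReg r_fm))))))
    Skip.

Definition build_network : cmd :=
  Then (For v_i r_m copy_arc)
  (Then (NSet r_fm (NReg r_m))
  (Then (For v_i r_n add_sink_arc)
  (Then (NSet r_fn (Incr (NReg r_n)))
  (Then (NSet r_fs (NReg r_s))
        (NSet r_ft (NReg r_n)))))).

Section BuildNetwork.
Variables (R : realDomainType) (F : nat -> nat -> nat) (MF : oracle R).
Variables (n : nat) (G : digraph R 'I_n) (s : 'I_n) (T : {set 'I_n * 'I_n}).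
Variables (par : 'I_n -> 'I_n) (depth : 'I_n -> nat) (es : seq ('I_n * 'I_n)) (A : {set 'I_n}).
Hypothesis T_par : forall x y, ((x, y) \in T) = (y != s) && (x == par y).
Hypothesis depth_par : forall v, v != s -> depth v = (depth (par v)).+1.
Hypothesis es_perm : perm_eq es (enum (edges G)).
Hypothesis sA : s \notin A.

Local Notation cents := (level_centroids s T par A).
Local Notation P := (components T A).
Local Notation M := (level_size s T par es A).
Local Notation inst := (level_instance G s T par es A).

Definition input_data (st : state R) : Prop :=
  [/\ nreg st r_n = n, nreg st r_m = size es, nreg st r_s = s
    & forall j, j < size es ->
        [/\ narr st a_tail j = (nth (s, s) es j).1, narr st a_head j = (nth (s, s) es j).2
          & warr st w_weight j = weight G (nth (s, s) es j)]].

Definition centroid_state (st : state R) : Prop :=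
  (forall v : 'I_n, v \in A -> narr st a_top v = top par A v) /\
  (forall v : 'I_n, v \in A -> top par A v = v ->
     narr st a_cen v = centroid_of s par (component T A v)).

(** Turns membership in a common part into the constant-time test of [copy_arc]. *)
Lemma inner_edges_top e : e \in es ->
  (e \in inner_edges G P) = [&& e.1 \in A, e.2 \in A & top par A e.1 == top par A e.2].
Proof.
rewrite (mem_es es_perm) inE => -> /=;
  apply/exists_inP/and3P => [[U UP /andP[e1 e2]]|[e1 e2 /eqP t12]].
  have UA := subsetP (components_sub UP).
  split; rewrite ?UA //; move: e2; rewrite (component_eq UP e1).
  by rewrite (component_top T_par depth_par sA (UA _ e1)) inE eq_sym => /andP[].
exists (component T A e.1); first exact: component_in.
by rewrite mem_component // (component_top T_par depth_par sA e1) inE e2 t12 eqxx.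
Qed.

Let copied k (st : state R) : Prop := forall j, j < k ->
  let e := nth (s, s) es j in
  [/\ narr st a_ftail j = (if e \in inner_edges G P then e.1 : nat else s),
      narr st a_fhead j = e.2, narr st a_finf j = 0 & warr st w_fcap j = weight G e].

Lemma copy_arcP k st :
    input_data st -> left_state A st -> centroid_state st -> k < size es ->
    nreg st v_i = k -> copied k st ->
  copied k.+1 (set_nreg (straight copy_arc st) v_i k.+1).
Proof.
move=> [En Em Es Ees] Eleft [Etop _] kes Ei IH j.
have [Et Eh Ew] := Ees k kes; have e_in := mem_nth (s, s) kes; have inner := inner_edges_top e_in.
set e := nth (s, s) es k in Et Eh Ew e_in inner.
rewrite /= /upd /= Ei Et Eh !Eleft !lt0b.
set b := [&& _ && _, _ & _]; have -> : b = (e \in inner_edges G P).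
  rewrite inner /b -andbA; case e1: (e.1 \in A) => //=; case e2: (e.2 \in A) => //=.
  by rewrite -eqn_leq !Etop.
rewrite Es; case: ifP => e_inner; rewrite ltnS leq_eqVlt /= /upd /= /upd /=;
  by case: (eqVneq j k) => [-> _|_ /IH //]; rewrite -/e e_inner Ew.
Qed.

Lemma build_network_linear st X :
    input_data st -> left_state A st -> centroid_state st -> n < X -> size es < X ->
  linear_time F MF build_network st X (fun st' => flow_args st' inst).
Proof.
move=> input_st left_st cen_st nX eX; have [En Em Es Ees] := input_st.
have X0 : 0 < X by apply: leq_ltn_trans nX.
apply: (@linear_for_then _ _ _ copied _ _ _ (size es)) => //.
  move=> k st1 kes [f0 f1 _ f3] Ei IH; apply: copy_arcP => //.
  - by split; rewrite ?f0 // => j je; rewrite !f1 // f3 //; apply: Ees.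
  - by move=> v; rewrite f1.
  - by split=> v; rewrite f1 //; apply cen_st.
move=> st1 [fr0 fr1 fr2 fr3] Ecopy.
apply: (linear_then (Q1 := fun st2 => st2 = set_nreg st1 r_fm (size es))).
  by apply: linear_straight => //=; rewrite fr0 // Em.
move=> _ -> _.
(* The tops among the first [k] vertices; the scan meets them in the order of [level_tops]. *)
pose tops k := [seq v <- take k (enum 'I_n) | (v \in A) && (top par A v == v)].
pose cs k := [seq centroid_of s par (component T A v) | v <- tops k].
apply: (@linear_for_then _ _ _ (fun k st2 => 
   [/\ nreg st2 r_fm = size es + size (cs k), copied (size es) st2
     & forall l, l < size (cs k) -> [/\ narr st2 a_ftail (size es + l) = nth s (cs k) l,
          narr st2 a_fhead (size es + l) = n & narr st2 a_finf (size es + l) = 1]]) _ _ _ n) => //=.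
- by rewrite /upd /= fr0.
- by rewrite /cs /tops take0 /= /upd /= addn0; split.
- move=> k st2 kn [f0 f1 f2 f3] Ei [IHm IHcopy IHcs].
  have topsS : tops k.+1 = if (Ordinal kn \in A) && (top par A (Ordinal kn) == Ordinal kn)
                           then rcons (tops k) (Ordinal kn) else tops k.
    rewrite /tops (take_nth (Ordinal kn)) ?size_enum_ord // filter_rcons.
    by have -> : nth (Ordinal kn) (enum 'I_n) k = Ordinal kn by apply: (nth_ord_enum _ (Ordinal
      kn)).
  have Eleft : narr st2 a_left k = (Ordinal kn \in A) by rewrite f1 //= fr1 // -(left_st (Ordinal
    kn)).
  rewrite /= Ei Eleft lt0b /cs topsS; case kA: (Ordinal kn \in A) => //=.
  have -> : narr st2 a_top k = top par A (Ordinal kn).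
    by rewrite f1 //= fr1 //; case: cen_st => h _; apply: (h (Ordinal kn) kA).
  rewrite -eqn_leq -[top par A _ == _]val_eqE /=; case: eqP => kk //.
  have -> : narr st2 a_cen k = centroid_of s par (component T A (Ordinal kn)).
    rewrite f1 //= fr1 //; case: cen_st => _ h; apply: (h (Ordinal kn) kA); exact: val_inj.
  have En2 : nreg st2 r_n = n by rewrite f0 //= /upd /= fr0.
  rewrite /= /upd /= /upd /= En2 IHm map_rcons size_rcons -/(cs k); split.
  + by rewrite addn1 addnS.
  + move=> j jes /=; rewrite /upd /= /upd /=.
    have -> : (j == size es + size (cs k)) = false by lia.
    exact: IHcopy.
  + move=> l; rewrite ltnS leq_eqVlt eqn_add2l nth_rcons.
    by case: (eqVneq l (size (cs k))) => [-> _|_ /= lk]; rewrite ?ltnn // lk; apply: IHcs.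
move=> st2 [f0 f1 f2 f3] [Efm Ecopy2 Ecs].
have csE : cs n = cents by rewrite /cs /tops take_oversize // size_enum_ord.
rewrite csE in Efm Ecs.
apply: linear_straight => //=; split; rewrite /= /upd /=.
- by rewrite f0 //= /upd /= fr0 // En addn1.
- exact: Efm.
- by rewrite f0 //= /upd /= fr0 // Es.
- by rewrite f0 //= /upd /= fr0 // En.
split=> // j; rewrite !ffunE /level_arc; case: ltnP => js.
  by have [-> -> -> ->] := Ecopy2 j js; split=> //; case: ifP.
have [|Et Eh Ef] := Ecs (j - size es); first by rewrite ltn_subLR ?ltn_ord.
by rewrite subnKC // in Et Eh Ef; rewrite Et Eh Ef.
Qed.

End BuildNetwork.

(** * Using the flow of a level *)

(** A zero [v_have] stands for an infinite initial value, and a tie keeps the earlier cut. The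
    centroid is read back as the tail of its sink arc. *)
Definition scan_body : cmd :=
  If (BAnd (BLe (NReg r_m) (NReg v_i))
           (BNot (BAnd (Pos (NReg v_have)) (BWLe (WReg wr_value) (WLoad w_flow (NReg v_i))))))
    (Then (WSet wr_value (WLoad w_flow (NReg v_i)))
    (Then (NSet v_have (NConst 1))
    (Then (NSet v_better (NConst 1))
          (NSet v_best (NLoad a_ftail (NReg v_i))))))
    Skip.

Definition scan_candidates : cmd :=
  Then (NSet v_better (NConst 0)) (For v_i r_fm scan_body).

Definition push_arc (e1 e2 : nexp) : cmd :=
  Then (NStore a_gtail (NReg v_gm) e1)
  (Then (NStore a_ghead (NReg v_gm) e2)
        (NSet v_gm (Incr (NReg v_gm)))).

(* The arcs of the residual graph are reversed, so that the search from a
   centroid finds the vertices that reach it. *)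
Definition arc_unsaturated : bexp :=
  BNot (BAnd (BNot (Pos (NLoad a_finf (NReg v_i))))
             (BWLe (WLoad w_fcap (NReg v_i)) (WLoad w_flow (NReg v_i)))).

Definition arc_loaded : bexp := BNot (BWLe (WLoad w_flow (NReg v_i)) WZero).

Definition push_forward : cmd :=
  If arc_unsaturated (push_arc (NLoad a_fhead (NReg v_i)) (NLoad a_ftail (NReg v_i))) Skip.

Definition push_backward : cmd :=
  If arc_loaded (push_arc (NLoad a_ftail (NReg v_i)) (NLoad a_fhead (NReg v_i))) Skip.

Definition residual_body : cmd := Then push_forward push_backward.

(** A vertex of another part may reach [v_best] through the sink, so the vertices found are filtered
    by their top. *)
Definition mark_body : cmd :=
  If (BAnd (BAnd (Pos (NLoad a_seen (NReg v_i))) (Left (NReg v_i)))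
           (EqN (Top (NReg v_i)) (Top (NReg v_best))))
    (NStore a_Sbar (NReg v_i) (NConst 1))
    (NStore a_Sbar (NReg v_i) (NConst 0)).

Definition mark_cut : cmd :=
  Then (NSet v_gm (NConst 0))
  (Then (For v_i r_fm residual_body)
  (Then (NSet v_gn (NReg r_fn))
  (Then (NSet v_root (NReg v_best))
  (Then bfs (For v_i r_n mark_body))))).

Definition record_cut : cmd := If (Pos (NReg v_better)) mark_cut Skip.

Definition remove_body : cmd :=
  If (BLe (NReg r_m) (NReg v_i))
    (Then (NStore a_left (NLoad a_ftail (NReg v_i)) (NConst 0))
          (NSet v_rem (Decr (NReg v_rem))))
    Skip.

Definition remove_centroids : cmd := For v_i r_fm remove_body.

Section ScanCandidates.
Local Open Scope ring_scope.
Variables (R : realDomainType) (F : nat -> nat -> nat) (MF : oracle R).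

Definition scanned (m k : nat) (st0 st : state R) : Prop :=
  (forall j, (m <= j < k)%N -> (0 < nreg st v_have)%N /\ wreg st wr_value <= warr st0 w_flow j) /\
  ([/\ nreg st v_better = 0%N, nreg st v_have = nreg st0 v_have
     & wreg st wr_value = wreg st0 wr_value] \/
   [/\ nreg st v_better = 1%N, nreg st v_have = 1%N,
       (0 < nreg st0 v_have)%N -> wreg st wr_value <= wreg st0 wr_value
     & exists2 j0, (m <= j0 < k)%N &
         wreg st wr_value = warr st0 w_flow j0 /\ nreg st v_best = narr st0 a_ftail j0]).

Lemma scan_linear st m M X : nreg st r_m = m -> nreg st r_fm = M -> (M < X)%N ->
  linear_time F MF scan_candidates st X (scanned m M st).
Proof.
move=> Em EM MX; have X0 : (0 < X)%N by apply: leq_ltn_trans MX.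
apply: (linear_then (Q1 := fun st1 => st1 = set_nreg st v_better 0)).
  by apply: linear_straight.
move=> _ -> _.
apply: (@linear_for_end _ _ _ (fun k st1 => scanned m k st st1) _ _ _ M) => //.
- by split; [move=> j /andP[_] | left].
- move=> k st1 kM [f0 f1 _ f3] Ei [IHle IHval].
  rewrite /= Ei f0 //= /upd /= Em f3 //=.
  have jS j : (m <= j < k.+1)%N = (m <= j < k)%N || ((m <= k)%N && (j == k)).
    by apply/idP/idP; lia.
  case: (boolP (m <= k)%N) => [mk|mk] /=; last first.
    split=> [j|]; first by rewrite jS (negPf mk) orbF => /IHle.
    case: IHval => [h|[h1 h2 h3 [j0 j0k h]]]; [by left | right; split=> //; exists j0 => //].
    by rewrite jS j0k.
  case: ifPn => [|].
    rewrite negb_and => new; split=> [j|].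
      rewrite jS mk /= /upd /= => /orP[jk|/eqP -> //]; split=> //.
      have [h1 h2] := IHle j jk; case/orP: new; first by rewrite h1.
      by rewrite -ltNge => lt; apply: le_trans (ltW lt) h2.
    right; split=> //=; rewrite /upd /=.
      move=> have0; case/orP: new.
        by case: IHval => [[_ -> _]|[_ -> _]]; rewrite ?have0.
      rewrite -ltNge => lt; apply: le_trans (ltW lt) _.
      by case: IHval => [[_ _ ->]|[_ _ h _]] //; apply: h.
    exists k; first by rewrite mk /=.
    by rewrite Ei f1.
  rewrite negbK => /andP[h1 h2]; split=> [j|].
    by rewrite jS mk /= => /orP[/IHle //|/eqP ->].
  case: IHval => [h|[g1 g2 g3 [j0 j0k h]]]; [by left | right; split=> //; exists j0 => //].
  by rewrite jS j0k.
Qed.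

End ScanCandidates.

Section ArcLists.
Variables (R : realDomainType).

Definition holds_arcs (ga : seq (nat * nat)) (st : state R) : Prop :=
  nreg st v_gm = size ga /\
  forall l, l < size ga ->
    narr st a_gtail l = (nth (0, 0) ga l).1 /\ narr st a_ghead l = (nth (0, 0) ga l).2.

Lemma push_arcP ga st e1 e2 x y :
    holds_arcs ga st -> neval st e1 = x -> neval (set_narr st a_gtail (size ga) x) e2 = y ->
  holds_arcs (rcons ga (x, y)) (straight (push_arc e1 e2) st).
Proof.
move=> [Egm Ega] E1 E2; rewrite /holds_arcs /= /upd /= Egm E1 E2 size_rcons addn1; split=> // l.
rewrite /upd /= ltnS leq_eqVlt nth_rcons.
by case: (eqVneq l (size ga)) => [-> _|_ /= lg]; rewrite ?ltnn // lg; apply: Ega.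
Qed.

End ArcLists.

Section RecordCut.
Variables (R : realDomainType) (F : nat -> nat -> nat) (MF : oracle R).
Variables (n : nat) (G : digraph R 'I_n) (s : 'I_n) (T : {set 'I_n * 'I_n}).
Variables (par : 'I_n -> 'I_n) (depth : 'I_n -> nat) (es : seq ('I_n * 'I_n)) (A : {set 'I_n}).
Hypothesis T_par : forall x y, ((x, y) \in T) = (y != s) && (x == par y).
Hypothesis depth_par : forall v, v != s -> depth v = (depth (par v)).+1.
Hypothesis es_perm : perm_eq es (enum (edges G)).
Hypothesis sA : s \notin A.

Local Notation cents := (level_centroids s T par A).
Local Notation P := (components T A).
Local Notation M := (level_size s T par es A).
Local Notation inst := (level_instance G s T par es A).
Local Notation N := (level_network G s P (centroid_of s par @: P)).
Variable f : 'I_M -> R.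

Definition flow_state (st : state R) : Prop :=
  flow_args st inst /\ forall j : 'I_M, warr st w_flow j = f j.

Definition reversed_arc (st : state R) j (p : nat * nat) : bool :=
  (~~ ((narr st a_finf j == 0) && (warr st w_fcap j <= warr st w_flow j)%R)
     && (p == (narr st a_fhead j, narr st a_ftail j))) ||
  ((0 < warr st w_flow j)%R && (p == (narr st a_ftail j, narr st a_fhead j))).

Lemma residual_reversed st x y : flow_state st ->
  residual N (level_flow f) x y =
  [exists j : 'I_M, reversed_arc st j (vertex_index y : nat, vertex_index x : nat)].
Proof.
move=> [[_ _ _ _ [_ Earc]] Eflow].
have vE (z w : option 'I_n) : (vertex_index z == vertex_index w :> nat) = (z == w).
  by rewrite val_eqE (can_eq (@vertex_indexK n)).
have arcE (j : 'I_M) : reversed_arc st j (vertex_index y : nat, vertex_index x : nat) =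
    [&& tail N (level_arc s T par es A j) == x, head N (level_arc s T par es A j) == y
      & if cap N (level_arc s T par es A j) is Some c
        then (level_flow f (level_arc s T par es A j) < c)%R else true]
    || [&& head N (level_arc s T par es A j) == x, tail N (level_arc s T par es A j) == y
       & (0 < level_flow f (level_arc s T par es A j))%R].
  have := Earc j; rewrite !ffunE => -[Et Eh Ec].
  rewrite (level_flowE T_par depth_par es_perm sA) -Eflow /reversed_arc Et Eh !xpair_eqE !vE.
  rewrite !(eq_sym y) !(eq_sym x) Ec; congr (_ || _); rewrite andbC -andbA andbCA //.
  by congr (_ && (_ && _)); case: (narr st a_finf j == 0); rewrite // -ltNge.
apply/exists_inP/existsP=> [[a /(level_arcP T_par depth_par es_perm sA)[j jM <-]]|[j]].
  by move=> h; exists (Ordinal jM); rewrite arcE.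
rewrite arcE => h; exists (level_arc s T par es A j) => //.
by apply/(level_arcP T_par depth_par es_perm sA); exists j => //; apply: ltn_ord.
Qed.

Lemma mark_cut_linear st (u : 'I_n) X :
    flow_state st -> nreg st r_n = n -> left_state A st -> centroid_state s T par A st ->
    nreg st v_best = u -> u \in A -> n.+1 + 2 * M < X ->
  linear_time F MF mark_cut st X (fun st' => forall v : 'I_n,
    narr st' a_Sbar v = [&& v \in A, top par A v == top par A u
                          & connect (residual N (level_flow f)) (Some v) (Some u)]).
Proof.
move=> flow_st En left_st [Etop _] Ebest uA MX; have X0 : 0 < X by lia.
have [[Efn Efm _ _ [_ Earc]] Eflow] := flow_st; rewrite /= in Efn Efm Earc.
apply: (linear_then (Q1 := fun st1 => st1 = set_nreg st v_gm 0)).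
  by apply: linear_straight.
move=> _ -> _.
(* An arc yields at most one forward and one backward residual arc, whence [2 * k] here and [2 * M]
   in the bound on [X]. *)
apply: (@linear_for_then _ _ _ (fun k st1 => exists ga,
    [/\ holds_arcs ga st1, size ga <= 2 * k
      & forall p, p \in ga <-> exists2 j, j < k & reversed_arc st j p]) _ _ _ M) => //.
- lia.
- exists [::]; split=> // p; rewrite in_nil; split=> // -[] //.
- move=> k st1 kM [f0 f1 _ f3] Ei [ga [ga_st ga_size ga_mem]].
  have [Ex1 Ex2 Ex3] : [/\ narr st1 a_ftail = narr st a_ftail, narr st1 a_fhead = narr st a_fhead
      & narr st1 a_finf = narr st a_finf] by rewrite !f1.
  have [Ex4 Ex5] : warr st1 w_fcap = warr st w_fcap /\ warr st1 w_flow = warr st w_flow by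
    rewrite !f3.
  set c1 := ~~ ((narr st a_finf k == 0) && (warr st w_fcap k <= warr st w_flow k)%R).
  set c2 := (0 < warr st w_flow k)%R.
  set x := narr st a_fhead k; set y := narr st a_ftail k.
  pose ga1 := if c1 then rcons ga (x, y) else ga.
  pose ga2 := if c2 then rcons ga1 (y, x) else ga1.
  exists ga2; split.
  + pose st2 := straight push_forward st1.
    have E2 : st2 = if c1 then straight (push_arc (NLoad a_fhead (NReg v_i)) (NLoad a_ftail (NReg
      v_i))) st1
                    else st1.
      have <- : beval st1 arc_unsaturated = c1 by rewrite /= Ei Ex3 Ex4 Ex5 -eqn0Ngt.
      by [].
    have st2_ga1 : holds_arcs ga1 st2.
      rewrite E2 /ga1; case: ifP => // _; apply: push_arcP => //=; first by rewrite Ei Ex2.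
      by rewrite /upd /= Ei Ex1.
    have [Ei2 Ey1 Ey2 Ey3] : [/\ nreg st2 v_i = k, narr st2 a_ftail = narr st a_ftail,
        narr st2 a_fhead = narr st a_fhead & warr st2 w_flow = warr st w_flow].
      by rewrite E2; case: ifP.
    have goal2 : holds_arcs ga2 (straight push_backward st2).
      have -> : straight push_backward st2 =
          if c2 then straight (push_arc (NLoad a_ftail (NReg v_i)) (NLoad a_fhead (NReg v_i)))
            st2 else st2.
        have <- : beval st2 arc_loaded = c2 by rewrite /= Ei2 Ey3 -ltNge.
        by [].
      rewrite /ga2; case: ifP => // _; apply: push_arcP => //=; first by rewrite Ei2 Ey1.
      by rewrite /upd /= Ei2 Ey2.
    exact: goal2.
  + rewrite /ga2 /ga1 mulnS; case: (c1); case: (c2); rewrite ?size_rcons ?addSn ?add0n ?ltnS //.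
      exact: leqW.
    exact: leqW.
    exact/leqW/leqW.
  + move=> p; have ga2E : (p \in ga2) = (p \in ga) || reversed_arc st k p.
      rewrite /ga2 /ga1 /reversed_arc -/c1 -/c2 -/x -/y.
      case: (c1); case: (c2);
        rewrite ?mem_rcons ?inE ?mem_rcons ?inE /= ?orbF ?orbA // 1?orbC ?orbA //.
      by rewrite orbAC.
    rewrite ga2E; split=> [/orP[/ga_mem[j jk jp]|kp]|[j]].
    * by exists j => //; apply: ltnW.
    * by exists k.
    * rewrite ltnS leq_eqVlt => /predU1P[-> ->|jk jp]; first by rewrite orbT.
      by apply/orP; left; apply/ga_mem; exists j.
move=> st1 [f0 f1 _ f3] [ga [ga_st ga_size ga_mem]].
have ga_in p : p \in ga -> p.1 < n.+1 /\ p.2 < n.+1.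
  case/ga_mem=> j jM; rewrite /reversed_arc; move: (Earc (Ordinal jM)) => /= [-> -> _].
  by case/orP=> /andP[_ /eqP ->] /=; split; apply: ltn_ord.
apply: (linear_then (Q1 := fun st2 => st2 = set_nreg st1 v_gn n.+1)).
  by apply: linear_straight => //=; rewrite f0 //= /upd /= Efn.
move=> _ -> _.
apply: (linear_then (Q1 := fun st2 => st2 = set_nreg (set_nreg st1 v_gn n.+1) v_root u)).
  by apply: linear_straight => //=; rewrite /upd /= f0 //= /upd /= Ebest.
move=> _ -> _.
pose gt l := (nth (0, 0) ga l).1; pose gh l := (nth (0, 0) ga l).2.
have [Egm Ega] := ga_st.
apply: linear_then.
  apply: (@bfs_linear n.+1 (size ga) gt gh u) => //.
  - by move=> l lg; apply: ga_in; apply: mem_nth.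
  - by rewrite ltnS ltnW.
  - lia.
move=> st2 [q [[q_uniq [q0 q_root] q_pred q_closed] _ _ Eseen]] [g0 g1 _ _].
(* One direction follows predecessors in the queue; the other uses closure along a residual path,
   from its end [u] backwards. *)
have seenE (v : 'I_n) : (val v \in q) = connect (residual N (level_flow f)) (Some v) (Some u).
  apply/idP/idP=> [vq|].
    suff H k : k < size q -> connect (residual N (level_flow f)) (index_vertex (inord (nth 0 q
      k))) (Some u).
      have := H (index (val v) q); rewrite index_mem nth_index // => /(_ vq).
      have -> : inord (val v) = vertex_index (Some v) by apply: val_inj;
        rewrite /= inordK // ltnS ltnW.
      by rewrite vertex_indexK.
    elim/ltn_ind: k => k IHk kq; case: (posnP k) => [->|k0].
      rewrite q_root; have -> : inord u = vertex_index (Some u) by apply: val_inj;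
        rewrite /= inordK // ltnS ltnW.
      by rewrite vertex_indexK connect0.
    have [|k' [j [k'k jM gtj ghj]]] := q_pred k; first by rewrite k0.
    apply: connect_trans (IHk k' k'k (ltn_trans k'k kq)); apply: connect1.
    have jga : (gt j, gh j) \in ga by rewrite /gt /gh -surjective_pairing mem_nth.
    have [t_in h_in] := ga_in _ jga.
    rewrite (residual_reversed _ _ flow_st) !index_vertexK !inordK -?gtj -?ghj //.
    by have /ga_mem[l lM lp] := jga; apply/existsP; exists (Ordinal lM).
  have rq : nat_of_ord u \in q by rewrite -q_root mem_nth.
  case/connectP=> p; rewrite -[val v]/(val (vertex_index (Some v))).
  elim: p (Some v) => [|y p IHp] x /=; first by move=> _ <-; apply: rq.
  case/andP=> xy p_path p_last; have yq := IHp y p_path p_last.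
  have : (vertex_index y : nat, vertex_index x : nat) \in ga.
    by apply/ga_mem; move: xy; rewrite (residual_reversed _ _ flow_st) => /existsP[j jp];
      exists j => //; apply: ltn_ord.
  move/(nthP (0, 0))=> [l lg lE]; have := q_closed l lg; rewrite /gt /gh lE /=; exact.
apply: (@linear_for_end _ _ _ (fun k st3 => forall v : 'I_n, v < k ->
    narr st3 a_Sbar v = [&& v \in A, top par A v == top par A u
                          & connect (residual N (level_flow f)) (Some v) (Some u)]) _ _ _ n) => //.
- by rewrite g0 //= /upd /= f0.
- lia.
- move=> k st3 kn [h0 h1 _ _] Ei IH v; rewrite ltnS leq_eqVlt.
  have Eleft : narr st3 a_left k = (Ordinal kn \in A).
    by rewrite h1 //= g1 //= f1 //= -(left_st (Ordinal kn)).
  have Es : narr st3 a_seen k = (k \in q) by rewrite h1 //= Eseen // ltnS ltnW.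
  have Eb : nreg st3 v_best = u by rewrite h0 //= g0 //= /upd /= f0.
  have Et : narr st3 a_top = narr st a_top by rewrite h1 //= g1 //= f1.
  rewrite [straight _ _]/= Ei Eleft Es Eb !Et !lt0b Etop //.
  set b := [&& _ && _, _ & _].
  have -> : b = [&& Ordinal kn \in A, top par A (Ordinal kn) == top par A u
                          & connect (residual N (level_flow f)) (Some (Ordinal kn)) (Some u)].
    rewrite /b -(seenE (Ordinal kn)) /= -andbA andbCA; case kA: (Ordinal kn \in A) => //=.
    by rewrite -[narr _ _ k]/(narr st a_top (Ordinal kn)) Etop // -eqn_leq val_eqE andbC.
  have [vk _|vk /= vk'] := eqVneq (v : nat) k.
    have -> : v = Ordinal kn by apply: val_inj.
    by case: ifP => _; rewrite /= /upd /= /upd /= eqxx.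
  by case: ifP => _; rewrite /= /upd /= /upd (negPf vk) IH.
- by move=> st3 _ IH v; apply: IH.
Qed.

Lemma remove_linear st X :
    flow_state st -> nreg st r_m = size es -> left_state A st -> nreg st v_rem = #|A| -> M < X ->
  linear_time F MF remove_centroids st X (fun st' =>
    left_state (A :\: centroid_of s par @: P) st' /\
    nreg st' v_rem = #|A :\: centroid_of s par @: P|).
Proof.
move=> [[_ Efm _ _ [_ Earc]] _] Em left_st Erem MX; rewrite /= in Efm Earc.
apply: (@linear_for_end _ _ _ (fun k st1 =>
   (forall v : 'I_n, narr st1 a_left v = (v \in A) && (v \notin take (k - size es) cents)) /\
   nreg st1 v_rem = #|A| - (k - size es)) _ _ _ M) => //.
- by split; rewrite /= ?subn0 // => v; rewrite take0 andbT.
- move=> k st1 kM [f0 f1 _ _] Ei [IH1 IH2]; rewrite /= Ei f0 //= Em.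
  case: leqP => [mk|km] /=; last first.
    have k0 : k - size es = 0 by apply/eqP; rewrite subn_eq0 ltnW.
    have -> : k.+1 - size es = 0 by apply/eqP; rewrite subn_eq0.
    by rewrite k0 in IH1 IH2; split.
  have kc : k - size es < size cents by rewrite ltn_subLR.
  rewrite (f1 a_ftail) //=; have [-> _ _] := Earc (Ordinal kM).
  rewrite ffunE /level_arc /= ltnNge mk /= ffunE /upd /= /upd /= subSn // IH2; split;
    last by rewrite subn1 -subnS.
  move=> v; rewrite (take_nth s kc) mem_rcons inE negb_or val_eqE.
  by case: eqP => [->|_] /=; rewrite ?andbF // IH1.
- move=> st1 _ [IH1 IH2].
  have take_all : take (M - size es) cents = cents by rewrite take_oversize // /level_size; lia.
  split=> [v|]; first by rewrite IH1 take_all in_setD andbC (mem_level_centroids T_par depth_par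
    sA).
  rewrite IH2 cardsD; congr (_ - _).
  have -> : M - size es = size cents by rewrite /level_size; lia.
  rewrite -(card_uniqP (uniq_level_centroids T_par depth_par sA)).
  apply: eq_card => v; rewrite inE (mem_level_centroids T_par depth_par sA).
  case: imsetP => [[U UP ->]|]; last by rewrite andbF.
  by rewrite (subsetP (components_sub UP)) // (centroid_in T_par depth_par sA).
Qed.

End RecordCut.

Definition prepare_flow : cmd := Then find_centroids build_network.
Definition use_flow : cmd := Then scan_candidates (Then record_cut remove_centroids).
Definition run_level : cmd := Then prepare_flow (Then MaxFlow use_flow).

(** The interface between a level and the search for the best candidate. If nothing was recorded
    before, only the second case can hold, so the first level always sets the output. *)
Definition level_result (R : realDomainType) n (P : {set {set 'I_n}}) (value : {set 'I_n} -> R)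
    (cut : {set 'I_n} -> {set 'I_n}) (st st' : state R) : Prop :=
  0 < nreg st' v_have /\
  ([/\ 0 < nreg st v_have, wreg st' wr_value = wreg st wr_value,
       narr st' a_Sbar = narr st a_Sbar
     & forall W, W \in P -> (wreg st wr_value <= value W)%R] \/
   exists U,
   [/\ U \in P, wreg st' wr_value = value U,
       forall v : 'I_n, narr st' a_Sbar v = (v \in cut U),
       forall W, W \in P -> (value U <= value W)%R
     & 0 < nreg st v_have -> (value U <= wreg st wr_value)%R]).

Section RunLevel.
Variables (R : realDomainType) (F : nat -> nat -> nat) (MF : oracle R).
Variables (n : nat) (G : digraph R 'I_n) (s : 'I_n) (T : {set 'I_n * 'I_n}).
Variables (par : 'I_n -> 'I_n) (depth : 'I_n -> nat) (es : seq ('I_n * 'I_n)).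
Variables (order pos : 'I_n -> 'I_n) (A : {set 'I_n}).
Hypothesis T_par : forall x y, ((x, y) \in T) = (y != s) && (x == par y).
Hypothesis depth_par : forall v, v != s -> depth v = (depth (par v)).+1.
Hypotheses (orderK : cancel order pos) (posK : cancel pos order).
Hypothesis pos_par : forall v, v != s -> pos (par v) < pos v.
Hypothesis es_perm : perm_eq es (enum (edges G)).
Hypothesis sA : s \notin A.
Hypothesis A_neq0 : A != set0.

Local Notation cen := (centroid_of s par).
Local Notation cents := (level_centroids s T par A).
Local Notation P := (components T A).
Local Notation M := (level_size s T par es A).
Local Notation inst := (level_instance G s T par es A).
Local Notation N := (level_network G s P (cen @: P)).
Local Notation g := (level_flow (@MF inst)).

Definition part_value (U : {set 'I_n}) : R := g (inr (cen U)).

Definition part_cut (U : {set 'I_n}) : {set 'I_n} :=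
  [set v in U | connect (residual N g) (Some v) (Some (cen U))].

Lemma sink_arc_flow j (jM : j < M) : size es <= j ->
  g (inr (nth s cents (j - size es))) = @MF inst (Ordinal jM).
Proof.
move=> js; rewrite -(level_flowE T_par depth_par es_perm sA) /level_arc /= ltnNge js //.
Qed.

Lemma level_centroidsP j : size es <= j -> j < M ->
  exists2 U, U \in P & nth s cents (j - size es) = cen U.
Proof.
move=> js jM; have : nth s cents (j - size es) \in cents by rewrite mem_nth // ltn_subLR.
by rewrite (mem_level_centroids T_par depth_par sA) => /imsetP[U UP ->]; exists U.
Qed.

(** A nonempty level has a centroid, hence a sink arc; so the scan leaves [v_have] positive. *)
Lemma level_size_gt : size es < M.
Proof.
have /set0Pn[x xA] := A_neq0; rewrite /level_size -[ltnLHS]addn0 ltn_add2l.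
have := mem_level_centroids T_par depth_par sA (cen (component T A x)).
by rewrite imset_f ?component_in //; case: cents.
Qed.

Lemma use_flow_linear st X :
    flow_state G (@MF inst) st -> input_data G s es st -> left_state A st ->
    centroid_state s T par A st -> nreg st v_rem = #|A| -> n.+1 + 2 * M < X ->
  linear_time F MF use_flow st X (fun st' =>
    [/\ left_state (A :\: cen @: P) st', nreg st' v_rem = #|A :\: cen @: P| & level_result P
      part_value part_cut st st']).
Proof.
move=> flow_st input_st left_st cen_st Erem MX.
have [[Efn Efm Efs Eft [Eset Earc]] Eflow] := flow_st; have [En Em Es Ees] := input_st.
have [Etop Ecen] := cen_st.
have X0 : 0 < X by lia.
have MX' : M < X by lia.
apply: linear_then (scan_linear F MF Em Efm MX') _ => st1 [all_le best_st1] [f0 f1 _ f3].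
have flow_st1 : flow_state G (@MF inst) st1.
  split=> [|j]; last by rewrite f3 // Eflow.
  split; rewrite ?f0 //; split=> // j; rewrite !f1 // f3 //; exact: Earc.
have left_st1 : left_state A st1 by move=> v; rewrite f1.
have cen_st1 : centroid_state s T par A st1.
  by split=> v; rewrite f1 //; [apply: Etop | apply: Ecen].
have flowE j (jM : j < M) : size es <= j -> warr st w_flow j = g (inr (nth s cents (j - size es))).
  by move=> js; rewrite (sink_arc_flow jM) //; apply: (Eflow (Ordinal jM)).
have all_leP W : W \in P -> (wreg st1 wr_value <= g (inr (cen W)))%R.
  move=> WP; have : cen W \in cents by rewrite (mem_level_centroids T_par depth_par sA) imset_f.
  case/(nthP s)=> l lc lW.
  have jM : size es + l < M by rewrite ltn_add2l.
  have [|_] := all_le (size es + l); first by rewrite leq_addr.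
  by rewrite flowE ?leq_addr // addKn lW.
pose res st2 := level_result P part_value part_cut st st2.
have have1 : 0 < nreg st1 v_have.
  have [|//] := all_le (size es); by rewrite leqnn level_size_gt.
apply: (linear_then (Q1 := res)).
  apply: linear_if => //= better; last first.
    apply: linear_straight => //; split=> //; left.
    case: best_st1 => [[h1 h2 h3]|[h1 _ _ _]]; last by rewrite h1 in better.
    split=> //; rewrite -?h2 ?h3 //; first by rewrite f1.
    by move=> W WP; rewrite -h3; apply: all_leP.
  case: best_st1 => [[h1 _ _]|[h1 h2 h3 [j0 /andP[j0s j0M] [h4 h5]]]];
    first by rewrite h1 in better.
  have [U UP cU] := level_centroidsP j0s j0M.
  have valU : wreg st1 wr_value = g (inr (cen U)) by rewrite h4 flowE // cU.
  have uU : cen U \in U by apply: (centroid_in T_par depth_par sA).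
  have uA := subsetP (components_sub UP) _ uU.
  have Ebest : nreg st1 v_best = cen U.
    rewrite h5; have [-> _ _] := Earc (Ordinal j0M).
    by rewrite ffunE /level_arc /= ltnNge j0s /= ffunE /= cU.
  apply: linear_weaken (linear_frame (mark_cut_linear F MF T_par depth_par es_perm sA flow_st1 _
    left_st1 cen_st1 Ebest uA MX)).
    move=> st2 [Sbar2 [k0 _ k2 _]]; split; first by rewrite k0.
    right; exists U; split; [exact: UP | by rewrite k2 | move=> v
      | by move=> W WP; rewrite {1}/part_value -valU; apply: all_leP
      | by rewrite /part_value -valU].
    rewrite Sbar2 /part_cut inE andbA; congr (nat_of_bool (_ && _)).
    have -> : (v \in U) = (v \in component T A (cen U)) by rewrite -(component_eq UP uU).
    by rewrite (component_top T_par depth_par sA uA) inE.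
  by rewrite f0.
move=> st2 res2 [k0 k1 _ k3].
have flow_st2 : flow_state G (@MF inst) st2.
  case: flow_st1 => [[a1 a2 a3 a4 [a5 a6]] a7].
  split=> [|j]; last by rewrite k3 // a7.
  split; rewrite ?k0 //; split=> // j; rewrite !k1 // k3 //; exact: a6.
apply: linear_weaken (linear_frame (remove_linear F MF T_par depth_par es_perm sA flow_st2 _ _ _
  MX')).
- move=> st3 [[h1 h2] [m0 m1 m2 _]]; split=> //.
  case: res2 => r1 r2; split; first by rewrite m0.
  case: r2 => [[q1 q2 q3 q4]|[U [q1 q2 q3 q4 q5]]]; [left | right; exists U]; split;
    rewrite ?m1 ?m2 //.
- by rewrite k0 // f0.
- by move=> v; rewrite k1.
- by rewrite k0 // f0.
Qed.

Lemma run_level_halts st X :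
    input_data G s es st -> tree_state par order st -> left_state A st ->
    nreg st v_rem = #|A| -> n.+1 + 2 * M < X ->
  halts F MF run_level st (6 * (cmd_size prepare_flow + cmd_size use_flow) * X + (F M n.+1).+1)
    [:: inst]
    (fun st' => [/\ input_data G s es st', tree_state par order st', left_state (A :\: cen @: P)
      st',
                    nreg st' v_rem = #|A :\: cen @: P| & level_result P part_value part_cut st
                      st']).
Proof.
move=> input_st tree_st left_st Erem MX.
have [En Em Es Ees] := input_st; have [_ Epar Eord] := tree_st.
have M0 := level_size_gt.
have nX : n < X by lia.
have eX : size es < X by apply: ltn_trans M0 _; lia.
have prep : linear_time F MF prepare_flow st X (fun st2 =>
    flow_args st2 inst /\ centroid_state s T par A st2).
  apply: linear_then (find_centroids_linear F MF T_par depth_par orderK posK pos_par sA tree_st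
    left_st nX) _.
  move=> st1 cen_st1 [f0 f1 _ f3].
  have input_st1 : input_data G s es st1.
    by split; rewrite ?f0 // => j js; rewrite !f1 // f3 //; apply: Ees.
  have left_st1 : left_state A st1 by move=> v; rewrite f1.
  apply: linear_weaken (linear_frame (build_network_linear F MF T_par depth_par es_perm sA
    input_st1 left_st1 cen_st1 nX eX)).
  move=> st2 [args2 [_ k1 _ _]]; split=> //; case: cen_st1 => c1 c2.
  by split=> v; rewrite k1 //; [apply: c1 | apply: c2].
have whole : halts F MF run_level st
   (6 * cmd_size prepare_flow * X + ((F M n.+1).+1 + 6 * cmd_size use_flow * X)) ([::] ++ [::
     inst] ++ [::])
   (fun st' => [/\ left_state (A :\: cen @: P) st', nreg st' v_rem = #|A :\: cen @: P| &
     level_result P part_value part_cut st st']).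
  apply: halts_then (halts_frame prep) _ => st2 [[args2 cen2] [f0 f1 f2 f3]].
  apply: (halts_then (Q1 := fun st3 => st3 = set_flow st2 (@MF inst))).
    by exists (set_flow st2 (@MF inst)), (F M n.+1).+1; split=> //;
      apply: (@ExMaxFlow _ F MF st2 inst).
  move=> st3 ->; set st3' := set_flow _ _.
  apply: halts_weaken (use_flow_linear (X := X) _ _ _ _ _ MX) => //.
  - move=> st4 [h1 h2 [h3 h4]]; split=> //; split=> //.
    move: h4; rewrite /= f0 // f1 // f2 //; exact.
  - split; first by case: args2.
    by move=> j; rewrite /= /upd /= (valK j).
  - split; rewrite /= ?f0 // => j js; rewrite /= /upd /= !f1 // f3 //; exact: Ees.
  - by move=> v; rewrite /= f1.
  - by rewrite /= f0.
apply: halts_weaken (halts_frame whole).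
  by rewrite mulnDr mulnDl; lia.
move=> st' [[h1 h2 h3] [f0 f1 _ f3]]; split=> //.
  by split; rewrite ?f0 // => j js; rewrite !f1 // f3 //; apply: Ees.
by split; rewrite ?f0 // => v; rewrite f1.
Qed.

End RunLevel.

(** * The whole algorithm *)

Definition tree_arc : cmd :=
  If (Pos (NLoad a_tree (NReg v_i)))
    (Then (NStore a_par (NLoad a_head (NReg v_i)) (NLoad a_tail (NReg v_i)))
          (push_arc (NLoad a_tail (NReg v_i)) (NLoad a_head (NReg v_i))))
    Skip.

Definition copy_order : cmd :=
  Then (NStore a_order (NReg v_i) (NLoad a_queue (NReg v_i)))
       (NStore a_left (NReg v_i) (NConst 1)).

Definition initialize : cmd :=
  Then (NSet v_gm (NConst 0))
  (Then (For v_i r_m tree_arc)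
  (Then (NStore a_par (NReg r_s) (NReg r_s))
  (Then (NSet v_gn (NReg r_n))
  (Then (NSet v_root (NReg r_s))
  (Then bfs
  (Then (For v_i r_n copy_order)
  (Then (NStore a_left (NReg r_s) (NConst 0))
  (Then (NSet v_rem (Decr (NReg r_n)))
        (NSet v_have (NConst 0)))))))))).

Definition centroid_algorithm : cmd :=
  Then initialize (While (Pos (NReg v_rem)) run_level).

Section Initialize.
Variables (R : realDomainType) (F : nat -> nat -> nat) (MF : oracle R).
Variables (n : nat) (G : digraph R 'I_n) (s : 'I_n) (T : {set 'I_n * 'I_n}).
Variables (es : seq ('I_n * 'I_n)).
Hypothesis T_arb : arborescence G s T.
Hypothesis es_perm : perm_eq es (enum (edges G)).

Local Notation par := (parent s T).

Let T_par := arborescence_parent T_arb.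

Definition tree_marks (st : state R) : Prop :=
  forall j, j < size es -> narr st a_tree j = (nth (s, s) es j \in T).

Let tree_inv k (st : state R) : Prop :=
  (exists ga, [/\ holds_arcs ga st, size ga <= k
    & forall p : nat * nat, p \in ga <-> exists2 j, j < k &
        nth (s, s) es j \in T /\ p = (nat_of_ord (nth (s, s) es j).1, nat_of_ord (nth (s, s) es
          j).2)]) /\
  (forall j, j < k -> nth (s, s) es j \in T ->
     narr st a_par (nth (s, s) es j).2 = (nth (s, s) es j).1).

Lemma tree_arcP k st : input_data G s es st -> tree_marks st -> k < size es ->
  nreg st v_i = k -> tree_inv k st -> tree_inv k.+1 (set_nreg (straight tree_arc st) v_i k.+1).
Proof.
move=> [_ _ _ Ees] Etree kes Ei [[ga [ga_st ga_size ga_mem]] IHpar].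
have [Et Eh _] := Ees k kes; set e := nth (s, s) es k in Et Eh.
have -> : straight tree_arc st = if e \in T then
    straight (push_arc (NLoad a_tail (NReg v_i)) (NLoad a_head (NReg v_i))) (set_narr st a_par
      e.2 e.1) else st.
  have <- : beval st (Pos (NLoad a_tree (NReg v_i))) = (e \in T) by rewrite /= Ei Etree // lt0b.
  have -> : set_narr st a_par e.2 e.1 =
      straight (NStore a_par (NLoad a_head (NReg v_i)) (NLoad a_tail (NReg v_i))) st.
    by rewrite /= Ei Et Eh.
  by [].
have [eT|eT] := boolP (e \in T); last first.
  split; last first.
    move=> j; rewrite ltnS leq_eqVlt => /predU1P[->|]; last exact: IHpar.
    by rewrite -/e (negPf eT).
  exists ga; split=> //; first exact: leqW.
  move=> p; split=> [/ga_mem[j jk jp]|[j]]; first by exists j => //; apply: ltnW.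
  rewrite ltnS leq_eqVlt => /predU1P[-> []|jk jp]; first by rewrite -/e (negPf eT).
  by apply/ga_mem; exists j.
split.
  exists (rcons ga (nat_of_ord e.1, nat_of_ord e.2)); split.
  - have st1_ga : holds_arcs ga (set_narr st a_par e.2 e.1) by [].
    have := @push_arcP R ga _ (NLoad a_tail (NReg v_i)) (NLoad a_head (NReg v_i)) e.1 e.2 st1_ga.
    by rewrite /= /upd /= Ei Et Eh => /(_ erefl erefl).
  - by rewrite size_rcons.
  - move=> p; rewrite mem_rcons inE; split=> [/predU1P[->|/ga_mem[j jk jp]]|[j]].
    + by exists k.
    + by exists j => //; apply: ltnW.
    + rewrite ltnS leq_eqVlt => /predU1P[-> [_ ->]|jk jp]; first by rewrite eqxx.
      by apply/orP; right; apply/ga_mem; exists j.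
move=> j; rewrite ltnS leq_eqVlt /= /upd /= /upd => /predU1P[-> _|jk jT]; first by rewrite eqxx.
(* Another tree edge with the same head has the same tail, so overwriting the entry changes
   nothing. *)
case: eqP => [/val_inj e2|_]; last exact: IHpar.
move: (eT) (jT); rewrite (surjective_pairing e) (surjective_pairing (nth _ _ j)) !T_par e2.
by move=> /andP[_ /eqP ->] /andP[_ /eqP ->].
Qed.

Lemma initialize_linear st X :
    input_data G s es st -> tree_marks st -> n + size es < X ->
  linear_time F MF initialize st X (fun st' => exists order pos : 'I_n -> 'I_n,
    [/\ cancel order pos, cancel pos order, forall v, v != s -> pos (par v) < pos v,
        tree_state par order st'
      & [/\ left_state [set~ s] st', nreg st' v_rem = #|[set~ s]| & nreg st' v_have = 0]]).
Proof.
move=> input_st tree_st nmX; have [En Em Es Ees] := input_st.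
have X0 : 0 < X by lia.
apply: (linear_then (Q1 := fun st1 => st1 = set_nreg st v_gm 0)).
  by apply: linear_straight.
move=> _ -> _.
apply: (@linear_for_then _ _ _ tree_inv _ _ _ (size es)) => //.
- by apply: leq_ltn_trans (leq_addl _ _) nmX.
- by split=> //; exists [::]; split=> // p; rewrite in_nil; split=> // -[] //.
- move=> k st1 kes [f0 f1 _ f3] Ei IH; apply: tree_arcP => //.
    by split; rewrite ?f0 // => j js; rewrite !f1 // f3 //; apply: Ees.
  by move=> j js; rewrite f1 //; apply: tree_st.
move=> st1 [f0 f1 _ _] [[ga [[Egm Ega] ga_size ga_mem]] Epar].
have T_es e : e \in T -> exists2 j, j < size es & nth (s, s) es j = e.
  by move=> eT; apply/nthP; rewrite (mem_es es_perm); case: T_arb => /subsetP/(_ e eT).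
pose st2 := set_nreg (set_nreg (set_narr st1 a_par s s) v_gn n) v_root s.
apply: (linear_then (Q1 := fun st' => st' = set_narr st1 a_par s s)).
  by apply: linear_straight => //=; rewrite f0 //= /upd /= Es.
move=> _ -> _.
apply: (linear_then (Q1 := fun st' => st' = set_nreg (set_narr st1 a_par s s) v_gn n)).
  by apply: linear_straight => //=; rewrite f0 //= /upd /= En.
move=> _ -> _.
apply: (linear_then (Q1 := fun st' => st' = st2)).
  by apply: linear_straight => //=; rewrite /upd /= f0 //= /upd /= Es.
move=> _ -> _.
pose gt l := (nth (0, 0) ga l).1; pose gh l := (nth (0, 0) ga l).2.
have ga_in p : p \in ga -> p.1 < n /\ p.2 < n by case/ga_mem=> j _ [_ ->] /=; split; apply: ltn_ord.
apply: linear_then.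
  apply: (@bfs_linear n (size ga) gt gh s) => //.
  - by move=> l lg; apply: ga_in; apply: mem_nth.
  - by apply: leq_ltn_trans nmX; rewrite leq_add2l.
move=> st3 [q [[[q_uniq q_lt] [q0 q_root] q_pred q_closed] _ Equeue _]] [g0 g1 _ _].
(* [T] reaches every vertex from [s], so the queue lists each vertex exactly once; [order] and [pos]
   are then mutually inverse. *)
have q_all (v : 'I_n) : nat_of_ord v \in q.
  have [_ _ T_conn] := T_arb; have sq : nat_of_ord s \in q by rewrite -q_root mem_nth.
  case/connectP: (T_conn v) => p; elim: p s sq => [|y p IHp] x xq /=; first by move=> _ ->.
  case/andP=> xyT p_path; apply: IHp p_path.
  have [j js jE] := T_es _ xyT.
  have : (nat_of_ord x, nat_of_ord y) \in ga by apply/ga_mem; exists j; rewrite ?jE.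
  by move/(nthP (0, 0))=> [l lg lE]; have := q_closed l lg; rewrite /gt /gh lE /=; apply.
have q_size : size q = n.
  apply/eqP; rewrite eqn_leq (size_order q_uniq q_lt) /= -[leqLHS](size_iota 0).
  apply: uniq_leq_size (iota_uniq _ _) _ => x; rewrite mem_iota /= add0n => xn.
  exact: (q_all (Ordinal xn)).
(* The default [s] never shows: all entries and indices are below [n]. *)
pose order (k : 'I_n) : 'I_n := insubd s (nth 0 q k).
pose pos (v : 'I_n) : 'I_n := insubd s (index (val v) q).
have orderE k : order k = nth 0 q k :> nat.
  have kq : nth 0 q k < n by apply: (allP q_lt); rewrite mem_nth // q_size.
  by rewrite val_insubd kq.
have posE v : pos v = index (nat_of_ord v) q :> nat.
  have iq : index (nat_of_ord v) q < n by have := q_all v; rewrite -index_mem q_size.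
  by rewrite val_insubd iq.
apply: (@linear_for_then _ _ _ (fun k st4 => forall v, v < k ->
    narr st4 a_order v = nth 0 q v /\ narr st4 a_left v = 1) _ _ _ n) => //.
- by rewrite g0 //= /upd /= f0 //= /upd /= En.
- by apply: leq_ltn_trans (leq_addr _ _) nmX.
- move=> k st4 kn [_ h1 _ _] Ei IH v; rewrite ltnS leq_eqVlt /= /upd /= /upd /= Ei.
  by case: (eqVneq v k) => [-> _|_ /IH //]; rewrite h1 //= Equeue ?q_size.
move=> st4 [h0 h1 _ _] Eorder.
have Es4 : nreg st4 r_s = s by rewrite h0 //= g0 //= /upd /= f0 //= /upd /= Es.
have En4 : nreg st4 r_n = n by rewrite h0 //= g0 //= /upd /= f0 //= /upd /= En.
apply: linear_straight => //=; exists order, pos; split.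
- by move=> k; apply: ord_inj; rewrite posE orderE index_uniq ?q_size ?ltn_ord.
- by move=> v; apply: ord_inj; rewrite orderE posE nth_index.
(* The earlier in-neighbour of [v] in the queue is joined to it by a tree edge, so it is the parent
   of [v]. *)
- move=> v vs; rewrite !posE /=.
  have k0 : 0 < index (nat_of_ord v) q.
    rewrite lt0n; apply: contra vs => /eqP i0; apply/eqP/ord_inj.
    by rewrite -(nth_index 0 (q_all v)) i0 q_root.
  have [|k' [j [k'k jg gtj ghj]]] := q_pred (index (nat_of_ord v) q);
    first by rewrite k0 index_mem q_all.
  have : (gt j, gh j) \in ga by rewrite /gt /gh -surjective_pairing mem_nth.
  case/ga_mem=> l _ [lT [lt lh]].
  have e2 : (nth (s, s) es l).2 = v.
    by apply: ord_inj; rewrite -lh ghj nth_index.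
  have e1 : (nth (s, s) es l).1 = par v.
    by apply/eqP; move: lT; rewrite (surjective_pairing (nth _ _ _)) T_par e2 => /andP[].
  rewrite -e1 /= -lt gtj index_uniq //; apply: ltn_trans k'k _.
  by rewrite index_mem q_all.
- split=> [|v|k]; rewrite /= /upd /=; first exact: En4.
    rewrite h1 //= g1 //= /upd /= /upd; have [/ord_inj ->|vs] := eqVneq (v : nat) s.
      by rewrite /parent eqxx.
    have vs' : v != s by apply: contra_neq vs => ->.
    have pvT : (par v, v) \in T by rewrite T_par vs' eqxx.
    by have [j js jE] := T_es _ pvT; have := Epar j js; rewrite jE; apply.
  by rewrite orderE; case: (Eorder k (ltn_ord k)).
- split=> [v||]; rewrite /= /upd /=.
  + rewrite /upd Es4 in_setC1 -val_eqE /=; case: eqP => //= _.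
    by case: (Eorder v (ltn_ord v)).
  + by rewrite En4 cardsC1 card_ord subn1.
  + by [].
Qed.

End Initialize.

Section BestCandidate.
Variables (R : realDomainType) (n : nat) (P : nat -> {set {set 'I_n}}).
Variables (value : nat -> {set 'I_n} -> R) (cut : nat -> {set 'I_n} -> {set 'I_n}).

Definition best_below i i0 (U0 : {set 'I_n}) (st : state R) : Prop :=
  [/\ i0 < i, U0 \in P i0,
      forall j W, j < i -> W \in P j -> (value i0 U0 <= value j W)%R,
      wreg st wr_value = value i0 U0
    & forall v : 'I_n, narr st a_Sbar v = (v \in cut i0 U0)].

Definition best_so_far i (st : state R) : Prop :=
  if i is 0 then nreg st v_have = 0
  else 0 < nreg st v_have /\ exists i0 U0, best_below i i0 U0 st.

Lemma best_so_far_step i st st' : best_so_far i st ->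
  level_result (P i) (value i) (cut i) st st' -> best_so_far i.+1 st'.
Proof.
move=> best [have' res]; split=> //.
case: res => [[have0 val0 Sbar0 le0]|[U [UP valU SbarU leU le_old]]].
  case: i best le0 => [/= h _|i]; first by rewrite h in have0.
  move=> [_ [i0 [U0 [i0i U0P le1 val1 Sbar1]]]] le0.
  exists i0, U0; split; rewrite ?val0 ?Sbar0 // ?ltnS; first exact: ltnW.
  move=> j W; rewrite ltnS leq_eqVlt => /predU1P[->|ji]; last exact: le1.
  by rewrite -val1; apply: le0.
exists i, U; split=> // j W; rewrite ltnS leq_eqVlt => /predU1P[->|ji WP]; first exact: leU.
case: i best UP ji leU le_old {SbarU valU} => // i [have0 [i0 [U0 [i0i U0P le1 val1 _]]]] UP ji _
  le_old.
by apply: le_trans (le_old have0) _; rewrite val1; apply: le1.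
Qed.

End BestCandidate.

Fact search_size_bound p x m : x <= 2 * m -> p.+1 + 2 * x < p.+2 + 4 * m.
Proof. lia. Qed.

(** * Iterating the levels and assembling the run *)

Section AlgorithmRun.
Variables (R : realDomainType) (F : nat -> nat -> nat) (MF : oracle R) (k : nat).
Variables (n : nat) (G : digraph R 'I_n) (s : 'I_n) (T : {set 'I_n * 'I_n}).
Variables (es : seq ('I_n * 'I_n)).
Hypothesis F_mono : forall m m' p p', m <= m' -> p <= p' -> F m p <= F m' p'.
Hypothesis G_bounded : poly_bounded k G.
Hypothesis T_arb : arborescence G s T.
Hypothesis es_perm : perm_eq es (enum (edges G)).
Hypothesis MF_max : max_flow_oracle k MF.
Hypothesis n_gt1 : 1 < n.

Local Notation par := (parent s T).
Local Notation cen := (centroid_of s par).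
Local Notation left_at := (remaining s T cen).
Local Notation inst i := (level_instance G s T par es (left_at i)).
Local Notation flow i := (level_flow (@MF (inst i))).
Local Notation value i := (part_value MF G s T par es (left_at i)).
Local Notation cut i := (part_cut MF G s T par es (left_at i)).
Local Notation best_at := (best_so_far (fun i => components T (left_at i)) (fun i => value i)
  (fun i => cut i)).

Let T_par := arborescence_parent T_arb.
Let root_notin i : s \notin left_at i. Proof. exact: remaining_root. Qed.

(** By strong induction: centroids are known to lie in their parts at a level only once these parts
    are known to be components of [left_at]. *)
Lemma parts_centroid i : parts s T cen i = components T (left_at i).
Proof.
have [depth depth_par] := arborescence_depth T_arb.
elim/ltn_ind: i => i IHi; apply: parts_components => j U ji; rewrite IHi //.
exact: (centroid_in T_par depth_par (root_notin j)).
Qed.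

Lemma parts_is_centroid i U : U \in parts s T cen i -> is_centroid T U (cen U).
Proof.
have [depth depth_par] := arborescence_depth T_arb.
by rewrite parts_centroid => /(centroid_of_is_centroid T_par depth_par (root_notin i)).
Qed.

(** A nonempty part at this level would, by halving, give a power of 2 at most [n] whose exponent
    exceeds the logarithm. *)
Lemma remaining_empty : left_at (trunc_log 2 n).+1 = set0.
Proof.
apply/eqP/contraT=> /set0Pn[x xA].
have UP : component T (left_at (trunc_log 2 n).+1) x \in parts s T cen (trunc_log 2 n).+1.
  by rewrite parts_centroid component_in.
have /= := parts_card_bound (fun i U _ => @parts_is_centroid i U) (leqnn _) UP.
rewrite card_ord => bound; have : 2 ^ (trunc_log 2 n).+1 <= n.
  by apply: leq_trans bound; rewrite leq_pmulr // card_gt0; apply/set0Pn; exists x;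
    apply: mem_component.
by move/(trunc_log_max (isT : 1 < 2)); rewrite ltnn.
Qed.

(** The range ends at [(trunc_log 2 n).+1], a level proved empty, so [find] succeeds. *)
Definition num_levels : nat := find (fun i => left_at i == set0) (iota 0 (trunc_log 2 n).+2).

Lemma num_levels_le : num_levels <= (trunc_log 2 n).+1.
Proof.
rewrite -ltnS -[ltnRHS](size_iota 0) -has_find; apply/hasP.
by exists (trunc_log 2 n).+1; [rewrite mem_iota ltnSn | rewrite remaining_empty].
Qed.

Lemma remaining_num_levels : left_at num_levels = set0.
Proof.
have d_lt : num_levels < (trunc_log 2 n).+2 by rewrite ltnS num_levels_le.
have : has (fun i => left_at i == set0) (iota 0 (trunc_log 2 n).+2) by rewrite has_find size_iota.
by move/(nth_find 0); rewrite -/num_levels nth_iota // => /eqP.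
Qed.

Lemma remaining_neq0 i : i < num_levels -> left_at i != set0.
Proof.
move=> id; have /negbT := before_find 0 id; rewrite nth_iota //.
exact: leq_trans id (leqW num_levels_le).
Qed.

(** The cost of one level. Its largest search has [n.+1] vertices and at most twice [2 * size es]
    arcs, so [n.+2 + 4 * size es] exceeds every iteration count. *)
Definition time_bound : nat :=
  6 * (cmd_size prepare_flow + cmd_size use_flow) * (n.+2 + 4 * size es) +
  (F (2 * size es) (2 * n)).+1.

Lemma size_es_edges : size es = #|edges G|.
Proof. by rewrite (perm_size es_perm) -cardE. Qed.

Lemma order_le_size : n <= (size es).+1.
Proof. by rewrite size_es_edges -[leqLHS](card_ord n); apply: arborescence_card_edges T_arb. Qed.

(** There is at most one sink arc per remaining vertex, that is fewer than [n] of them, hence at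
    most [size es]. *)
Lemma level_size_le i : level_size s T par es (left_at i) <= 2 * size es.
Proof.
have [depth depth_par] := arborescence_depth T_arb.
have cents_le := level_size_bound T_par depth_par (root_notin i).
have A_lt : #|left_at i| < n.
  rewrite -[ltnRHS](card_ord n) -cardsT; apply: proper_card; apply/properP; split;
    first exact: subsetT.
  by exists s.
have := order_le_size; rewrite /level_size mul2n -addnn leq_add2l => n_le.
by apply: leq_trans cents_le _; rewrite -ltnS; apply: leq_trans A_lt n_le.
Qed.

Section Levels.
Variables (order pos : 'I_n -> 'I_n).
Hypotheses (orderK : cancel order pos) (posK : cancel pos order).
Hypothesis pos_par : forall v, v != s -> pos (par v) < pos v.

Definition level_inv i (st : state R) : Prop :=
  [/\ input_data G s es st, tree_state par order st, left_state (left_at i) st,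
      nreg st v_rem = #|left_at i| & best_at i st].

Lemma level_inv_step i st : i < num_levels -> level_inv i st ->
  halts F MF run_level st time_bound [:: inst i] (level_inv i.+1).
Proof.
have [depth depth_par] := arborescence_depth T_arb.
move=> id [input_st tree_st left_st Erem best].
have bound : n.+1 + 2 * level_size s T par es (left_at i) < n.+2 + 4 * size es.
  exact/search_size_bound/level_size_le.
apply: halts_weaken (run_level_halts F MF T_par depth_par orderK posK pos_par es_perm (root_notin i)
  (remaining_neq0 id) input_st tree_st left_st Erem bound).
  rewrite leq_add2l ltnS; apply: F_mono; first exact: level_size_le.
  by rewrite mul2n -addnn -[X in X < _]addn0 ltn_add2l ltnW.
move=> st' [h1 h2 h3 h4 h5]; rewrite /level_inv /= parts_centroid; split=> //.
exact: (best_so_far_step (P := fun i => components T (left_at i)) (value := fun i => value i)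
  (cut := fun i => cut i) best h5).
Qed.

Lemma levels_halt j i st : i + j = num_levels -> level_inv i st ->
  halts F MF (While (Pos (NReg v_rem)) run_level) st (j * time_bound.+1).+1
    [seq inst l | l <- iota i j] (level_inv num_levels).
Proof.
elim: j i st => [|j IHj] i st.
  rewrite addn0 => -> inv_st; exists st, 1; split=> //; apply: ExWhileEnd.
  by case: inv_st => _ _ _ /= -> _; rewrite remaining_num_levels cards0.
move=> ijd inv_st; have id : i < num_levels by rewrite -ijd addnS ltnS leq_addr.
have [st1 [t1 [e1 b1 inv1]]] := level_inv_step id inv_st.
have [|st2 [t2 [e2 b2 inv2]]] := IHj i.+1 st1 _ inv1; first by rewrite addSnnS.
exists st2, (t1 + t2).+1; split=> //.
  apply: (@ExWhile _ F MF _ _ _ _ _ _ _ [:: inst i]) e1 e2.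
  by case: inv_st => _ _ _ /= -> _; rewrite card_gt0 remaining_neq0.
by rewrite ltnS mulSn addSn -addnS leq_add.
Qed.

End Levels.

Lemma input_state_data : input_data G s es (input_state G s T es).
Proof.
split=> // j js; rewrite /= /upd /=.
by rewrite !(nth_map (s, s)).
Qed.

Lemma input_state_marks : tree_marks s T es (input_state G s T es).
Proof. by move=> j js; rewrite /= /upd /= (nth_map (s, s)). Qed.

Lemma centroid_algorithm_run :
  exists st t l (r : run R 'I_n),
    [/\ exec F MF centroid_algorithm (input_state G s T es) st t l,
        centroid_run G s T r, carries_out G s T MF st l r
      & t <= 6 * cmd_size initialize * (n.+2 + 4 * size es) +
             ((trunc_log 2 n).+1 * time_bound.+1).+1].
Proof.
have [depth depth_par] := arborescence_depth T_arb.
have [|st1 [t1 [e1 b1 [order [pos [orderK posK pos_par tree_st [left_st Erem Ehave]]]]]]] :=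
  initialize_linear F MF T_arb es_perm (X := n.+2 + 4 * size es) input_state_data input_state_marks.
  by move: (size es) => a; lia.
have [f0 f1 _ f3] := exec_frame e1.
have inv0 : level_inv order 0 st1.
  split=> //; case: input_state_data => En Em Es Ees.
  by split; rewrite ?f0 // => j js; rewrite !f1 // f3 //; apply: Ees.
have [st [t2 [e2 b2 [_ _ _ _ best]]]] := levels_halt orderK posK pos_par (add0n num_levels) inv0.
(* With at least two vertices something remains at level 0, so a candidate has been recorded when
   the loop ends. *)
have d_gt0 : 0 < num_levels.
  rewrite lt0n; apply/eqP=> d0; have := remaining_num_levels; rewrite d0 /= => /setP A0.
  have : 1 < #|'I_n| by rewrite card_ord.
  by rewrite (cardD1 s) => /card_gt0P[x]; have := A0 x; rewrite !inE => ->.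
have [i0 [U0 [i0d U0P le0 val0 Sbar0]]] : exists i0 U0,
    best_below (fun i => components T (left_at i)) (fun i => value i) (fun i => cut i) num_levels
      i0 U0 st.
  by case: num_levels d_gt0 best => // d _ [].
(* The centroids and flows of this run do not depend on the execution: they are [centroid_of] and
   the oracle's flows carried back to the level networks. *)
pose r : run R 'I_n := Run cen num_levels (fun i => flow i) (wreg st wr_value)
  (cut i0 U0).
exists st, (t1 + t2), ([::] ++ [seq inst l | l <- iota 0 num_levels]), r; split.
- exact: ExThen e1 e2.
- split.
  + split=> [i id|]; rewrite /= parts_centroid ?components_eq0; first exact: remaining_neq0.
    by apply/eqP; rewrite components_eq0 remaining_num_levels.
  + by move=> i U [_ UP]; apply: parts_is_centroid UP.
  + move=> i id; rewrite /run_network /= parts_centroid.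
    apply: (level_flow_max T_par depth_par es_perm (root_notin i)).
    by apply: MF_max; apply: (level_instance_admissible T_par depth_par es_perm (root_notin i)).
  + exists i0, U0; split; [split | | exact: val0 | ].
    * exact: i0d.
    * by rewrite [run_centroid _]/= parts_centroid.
    * by move=> j W [jd]; rewrite [run_centroid _]/= parts_centroid; apply: le0.
    * by rewrite /candidate_Sbar /run_network [run_centroid _]/= parts_centroid.
- split=> //; exists (fun i => inst i); split=> // i id.
  rewrite /run_network /= parts_centroid.
  exact: (level_instance_iso T_par depth_par es_perm (root_notin i)).
- apply: leq_add b1 (leq_trans b2 _); rewrite ltnS leq_mul2r.
  by apply/orP; right; apply: num_levels_le.
Qed.

End AlgorithmRun.

(** For [f] the flow time and [L] the logarithm. As [n <= m.+1] and [0 < m], the factor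
    [n.+2 + 4 * m] is at most [8 * m], and [L.+1 <= 2 * L]. So 48 is 6 times 8, 96 is its double,
    and 5 adds 4 from [2 * L * (2 * m)] to 1 for the last unit step. *)
Lemma time_bound_le a0 a1 K f Fm n m L :
    n <= m.+1 -> 0 < m -> 0 < L -> Fm <= K * f ->
  6 * a0 * (n.+2 + 4 * m) + (L.+1 * (6 * a1 * (n.+2 + 4 * m) + Fm.+1).+1).+1
    <= (48 * a0 + 96 * a1 + 2 * K + 5) * ((f + m) * L).
Proof.
move=> nm m0 L0 FK.
have X_le : n.+2 + 4 * m <= 8 * m by lia.
have L_le : L.+1 <= 2 * L by lia.
have B_le : (6 * a1 * (n.+2 + 4 * m) + Fm.+1).+1 <= 48 * a1 * m + K * f + 2 * m.
  have : 6 * a1 * (n.+2 + 4 * m) <= 6 * a1 * (8 * m) by rewrite leq_mul2l X_le orbT.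
  rewrite mulnA (mulnAC 6); lia.
have C_le : 6 * a0 * (n.+2 + 4 * m) <= 48 * a0 * (m * L).
  apply: (@leq_trans (6 * a0 * (8 * m))); first by rewrite leq_mul2l X_le orbT.
  have -> : 48 * a0 * (m * L) = 6 * a0 * (8 * m) * L by ring.
  by rewrite leq_pmulr.
have mL : 0 < m * L by rewrite muln_gt0 m0.
apply: (@leq_trans (48 * a0 * (m * L) + (2 * L * (48 * a1 * m + K * f + 2 * m) + m * L))).
  by apply: leq_add C_le _; rewrite -[X in X <= _]addn1; apply: leq_add (leq_mul L_le B_le) mL.
have -> : 48 * a0 * (m * L) + (2 * L * (48 * a1 * m + K * f + 2 * m) + m * L) =
    (48 * a0 + 96 * a1 + 5) * (m * L) + 2 * K * (f * L) by ring.
have -> : (48 * a0 + 96 * a1 + 2 * K + 5) * ((f + m) * L) =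
    (48 * a0 + 96 * a1 + 5) * (m * L) + 2 * K * (f * L) +
    (2 * K * (m * L) + (48 * a0 + 96 * a1 + 5) * (f * L)) by ring.
exact: leq_addr.
Qed.

Theorem theorem2p7 (R : realDomainType) :
  exists P : cmd,
  forall (F : nat -> nat -> nat) (k : nat), regular_time F ->
  exists c : nat,
  forall (n : nat) (G : digraph R 'I_n) (s : 'I_n) (S : {set 'I_n})
         (T : {set 'I_n * 'I_n}),
    poly_bounded k G ->
    is_min_scut G s S ->
    arborescence G s T ->
    #|T :&: out_edges G S| = 1 ->
    (forall r : run R 'I_n, centroid_run G s T r ->
       is_min_scut G s (~: run_Sbar r) /\
       run_value r = cut_weight G (~: run_Sbar r)) /\
    (forall (MF : oracle R) (es : seq ('I_n * 'I_n)),
       max_flow_oracle k MF ->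
       perm_eq es (enum (edges G)) ->
       exists (st : state R) (t : nat) (l : seq (instance R)) (r : run R 'I_n),
         [/\ exec F MF P (input_state G s T es) st t l,
             centroid_run G s T r,
             carries_out G s T MF st l r
           & t <= c * ((F #|edges G| n + #|edges G|) * trunc_log 2 n)]).
Proof.
exists centroid_algorithm => F k [F_mono [K F_K]].
exists (48 * cmd_size initialize + 96 * (cmd_size prepare_flow + cmd_size use_flow) + 2 * K + 5).
move=> n G s S T G_bounded S_min T_arb T_cross; split; first by move=> r;
  apply: (run_correct S_min T_arb T_cross).
move=> MF es MF_max es_perm.
(* Both sides of the minimum cut are nonempty. This makes the logarithm in the bound positive. *)
have n_gt1 : 1 < n.
  have [[sS /set0Pn[x xS]] _] := S_min.
  rewrite -(card_ord n); apply/card_gt1P; exists s, x; split=> //.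
  by apply: contraTneq xS => <-; rewrite inE sS.
have [st [t [l [r [e_run r_run r_out t_le]]]]] :=
  centroid_algorithm_run F_mono G_bounded T_arb es_perm MF_max n_gt1.
exists st, t, l, r; split=> //; apply: leq_trans t_le _.
have n_le := order_le_size T_arb es_perm.
rewrite -(size_es_edges es_perm); have es_gt0 : 0 < size es by rewrite -ltnS; apply: leq_trans n_le.
(* The constant [K] absorbs the doubling of both arguments of [F]. *)
apply: time_bound_le => //; last exact: F_K.
by apply: trunc_log_max; rewrite ?expn1.
Qed.
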